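(* Suppose that Assumption 1 and Assumption 2 hold (with functions $b$ and $a$), or that Assumption 1 and Assumption 2' hold (with functions $b$ and $a$). Suppose moreover that $\int \mathrm{d}|\mu|(y)\, e^{a(y)+2b(y)} < \infty$. Then \[ Z = \exp\Bigl\{ \sum_{n\geq1} \int\mathrm{d}\mu(x_1) \cdots \int\mathrm{d}\mu(x_n) \, \varphi(x_1,\dots,x_n) \Bigr\}, \] where the series in the exponential converges absolutely, i.e. $\sum_{n\ge1}\int\mathrm{d}|\mu|(x_1)\cdots\int\mathrm{d}|\mu|(x_n)\,|\varphi(x_1,\dots,x_n)|<\infty$. Furthermore, for $|\mu|$-almost all $x_1 \in \mathbb{X}$, \[ \sum_{n\geq2} n \int\mathrm{d}|\mu|(x_2) \cdots \int\mathrm{d}|\mu|(x_n) \, |\varphi(x_1,\dots,x_n)| \leq \bigl(e^{a(x_1)}-1\bigr) e^{2b(x_1)} \] under Assumptions 1 and 2, and the same bound with $e^{b(x_1)}$ in place of $e^{2b(x_1)}$ under Assumptions 1 and 2'.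
   Context: Let $(\mathbb{X},\mathcal{X},\mu)$ be a measure space with $\mu$ a complex measure, and $|\mu|$ its total variation. Let $u,\zeta$ be complex measurable symmetric functions on $\mathbb{X}\times\mathbb{X}$ with $\zeta(x,y)=e^{-u(x,y)}-1$; the real part of $u$ may take the value $+\infty$, in which case $\zeta(x,y)=-1$. Define \[ Z=\sum_{n\ge0}\frac1{n!}\int\mathrm{d}\mu(x_1)\cdots\int\mathrm{d}\mu(x_n)\prod_{1\le i<j\le n}\bigl(1+\zeta(x_i,x_j)\bigr), \] the $n=0$ term being $1$. Let $\overline u(x,y)=u(x,y)$ if $\mathrm{Re}\,u(x,y)\ne\infty$ and $\overline u(x,y)=1$ if $\mathrm{Re}\,u(x,y)=\infty$. Assumption 1 (stability): there is a nonnegative function $b$ on $\mathbb{X}$ such that for all $n$ and $\otimes^n\mu$-almost all $x_1,\dots,x_n$: $\prod_{1\le i<j\le n}|1+\zeta(x_i,x_j)|\le\prod_{i=1}^n e^{b(x_i)}$. Assumption 2: there is a nonnegative function $a$ on $\mathbb{X}$ such that for almost all $x$: $\int\mathrm{d}|\mu|(y)\,|\zeta(x,y)|\,e^{a(y)+2b(y)}\le a(x)$. Assumption 2': there is a nonnegative function $a$ on $\mathbb{X}$ such that for almost all $x$: $\int\mathrm{d}|\mu|(y)\,|\overline u(x,y)|\,e^{a(y)+b(y)}\le a(x)$. Let $\mathcal{C}_n$ be the set of connected graphs (unoriented, no loops) on vertex set $\{1,\dots,n\}$. Define $\varphi(x_1)=1$ and, for $n\ge2$, $\varphi(x_1,\dots,x_n)=\frac1{n!}\sum_{G\in\mathcal{C}_n}\prod_{\{i,j\}\in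 G}\zeta(x_i,x_j)$ (product over edges of $G$). *)

(* Defs.v *)
From mathcomp Require Import all_boot all_order all_algebra.
From mathcomp Require Import all_classical all_reals all_analysis.
From mathcomp Require Import measurable_realfun.
From mathcomp Require Import complex.
Set Implicit Arguments.
Unset Strict Implicit.
Unset Printing Implicit Defensive.
Import Order.TTheory GRing.Theory Num.Theory.
Import numFieldNormedType.Exports.
Local Open Scope classical_set_scope.
Local Open Scope ring_scope.
Local Open Scope complex_scope.

Section Cluster.
Context {R : realType}.

Definition cRe (z : R[i]) : R := complex.Re z.
Definition cIm (z : R[i]) : R := complex.Im z.

Definition cmod (z : R[i]) : R := Num.sqrt (cRe z ^+ 2 + cIm z ^+ 2).

Definition cexp (z : R[i]) : R[i] :=
  (expR (cRe z))%:C * (cos (cIm z) +i* sin (cIm z)).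

Context {d : measure_display} {X : measurableType d}.

(* The interaction u = ur + i ui : X*X -> C, whose real part ur may be +oo. *)
Definition zeta (ur : X * X -> \bar R) (ui : X * X -> R) (x y : X) : R[i] :=
  if ur (x, y) == +oo%E then -1
  else cexp (- ((fine (ur (x, y))) +i* (ui (x, y)))) - 1.

Definition ubar (ur : X * X -> \bar R) (ui : X * X -> R) (x y : X) : R[i] :=
  if ur (x, y) == +oo%E then 1 else (fine (ur (x, y))) +i* (ui (x, y)).

(* The complex measure mu is represented by its polar decomposition
   d mu = h d|mu|, with nu = |mu| (a finite positive measure) and
   h a measurable phase with |h| = 1. *)
Variable nu : {finite_measure set X -> \bar R}.

Definition cint (g : X -> R[i]) : R[i] :=
  (Rintegral nu setT (fun x => cRe (g x))) +i* (Rintegral nu setT (fun x => cIm (g x))).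

Fixpoint iint (h : X -> R[i]) (n : nat) (F : seq X -> R[i]) : R[i] :=
  match n with
  | 0 => F [::]
  | n'.+1 => cint (fun x => h x * iint h n' (fun s => F (x :: s)))
  end.

Fixpoint iabs (n : nat) (F : seq X -> \bar R) : \bar R :=
  match n with
  | 0 => F [::]
  | n'.+1 => (\int[nu]_x iabs n' (fun s => F (x :: s)))%E
  end.

(* P holds for (x_1,...,x_n) outside a null set of the n-fold product of nu *)
Definition prod_ae (n : nat) (P : seq X -> Prop) : Prop :=
  iabs n (fun s => ((\1_[set s' | ~ P s'] s : R))%:E) = 0%E.

Definition graph_on (n : nat) (G : {set 'I_n * 'I_n}) : bool :=
  [forall e in G, (e.1 < e.2)%N].

Definition gadj (n : nat) (G : {set 'I_n * 'I_n}) : rel 'I_n :=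
  fun i j => ((i, j) \in G) || ((j, i) \in G).

Definition gconnected (n : nat) (G : {set 'I_n * 'I_n}) : bool :=
  [forall i, forall j, connect (gadj G) i j].

Definition phi (ur : X * X -> \bar R) (ui : X * X -> R) (s : seq X) : R[i] :=
  (((size s)`!)%:R)^-1 *
  \sum_(G : {set 'I_(size s) * 'I_(size s)} | graph_on G && gconnected G)
     \prod_(e in G) zeta ur ui (nth point s e.1) (nth point s e.2).

Definition Zterm (ur : X * X -> \bar R) (ui : X * X -> R) (s : seq X) : R[i] :=
  \prod_(i < size s) \prod_(j < size s | (i < j)%N)
     (1 + zeta ur ui (nth point s i) (nth point s j)).

Definition Zpartial (h : X -> R[i]) (ur : X * X -> \bar R) (ui : X * X -> R)
  (N : nat) : R[i] :=
  \sum_(n < N) ((n`!)%:R)^-1 * iint h n (Zterm ur ui).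

Definition logZpartial (h : X -> R[i]) (ur : X * X -> \bar R) (ui : X * X -> R)
  (N : nat) : R[i] :=
  \sum_(1 <= n < N) iint h n (phi ur ui).

End Cluster.

(* Main.v *)
Require Import Defs.
From HB Require Import structures.
From mathcomp Require Import all_boot all_order all_algebra.
From mathcomp Require Import all_classical all_reals all_analysis.
From mathcomp Require Import measurable_realfun.
From mathcomp Require Import complex ring zify.
Set Implicit Arguments.
Unset Strict Implicit.
Unset Printing Implicit Defensive.
Import Order.TTheory GRing.Theory Num.Theory.
Import numFieldNormedType.Exports.
Local Open Scope classical_set_scope.
Local Open Scope ring_scope.
Local Open Scope complex_scope.

(* Expand the sum over connected graphs by deletion and contraction, taking the edges
   e in decreasing order of w e = |1 + z e| (Kruskal's algorithm). Every connected graph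
   is thereby assigned to a spanning tree T; the edges of T contribute z, the edges
   that close a cycle contribute 1 + z. If |z| <= t max(1, w), the contribution of T
   is at most prod_T t times the product of w over the pairs inside the components
   of some partition of the vertices, and stability bounds this product by
   prod e^b. Both t = |zeta| and t = |ubar| are admissible, so Assumptions 2 and 2'
   are treated at once, and even the first one yields the factor e^b.

   The tree sums are explored root by root, which gives a recursion whose integrated
   form shows by induction that sum_m 1/m! int (rooted forests with roots x_i) is at
   most prod e^{a(x_i)}. This is the pointwise bound; integrating it over x_1
   gives sum_n n int |phi| < oo.

   For Z, splitting a graph along the component of its first vertex yields
   (n + 1) Z_{n+1} = sum_k (k + 1) L_{k+1} Z_{n-k} for the terms Z_n and L_n of the
   two series. Hence z(s) e^{-l(s)}, built from the truncated series with powers of s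
   inserted, has a derivative that is uniformly small on [0, 1], because
   sum n |L_n| and sum |Z_n| are finite; it equals 1 at s = 0. *)

(** * Complex numbers *)

Section ComplexParts.
Context {R : realType}.
Implicit Types z w : R[i].

Lemma cReD z w : cRe (z + w) = cRe z + cRe w. Proof. by case: z; case: w. Qed.
Lemma cImD z w : cIm (z + w) = cIm z + cIm w. Proof. by case: z; case: w. Qed.
Lemma cReN z : cRe (- z) = - cRe z. Proof. by case: z. Qed.
Lemma cImN z : cIm (- z) = - cIm z. Proof. by case: z. Qed.

Lemma complex_ext z w : cRe z = cRe w -> cIm z = cIm w -> z = w.
Proof. by case: z => x y; case: w => u v /= -> ->. Qed.

Lemma cReM z w : cRe (z * w) = cRe z * cRe w - cIm z * cIm w.
Proof. by case: z; case: w. Qed.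

Lemma cImM z w : cIm (z * w) = cRe z * cIm w + cIm z * cRe w.
Proof. by case: z; case: w. Qed.

End ComplexParts.

Section Modulus.
Context {R : realType}.
Implicit Types z w : R[i].

Lemma cmod_normr z : cmod z = `|z : Rcomplex R|.
Proof. by case: z. Qed.

Lemma cmod_ge0 z : 0 <= cmod z.
Proof. exact: sqrtr_ge0. Qed.

Lemma ecmod_ge0 z : (0 <= (cmod z)%:E)%E.
Proof. by rewrite lee_fin cmod_ge0. Qed.

Lemma cmod0 : cmod (0 : R[i]) = 0.
Proof. by rewrite cmod_normr normr0. Qed.

Lemma cmodN z : cmod (- z) = cmod z.
Proof. by rewrite !cmod_normr; exact: normrN. Qed.

Lemma cmodD z w : cmod (z + w) <= cmod z + cmod w.
Proof. by rewrite !cmod_normr; exact: ler_normD. Qed.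

Lemma cmod_sum (I : Type) (r : seq I) (P : pred I) (F : I -> R[i]) :
  cmod (\sum_(i <- r | P i) F i) <= \sum_(i <- r | P i) cmod (F i).
Proof.
rewrite cmod_normr (eq_bigr _ (fun i _ => cmod_normr (F i))).
exact: (@ler_norm_sum _ (Rcomplex R)).
Qed.

Lemma cmodM z w : cmod (z * w) = cmod z * cmod w.
Proof. by rewrite !cmod_normr; exact: Normc.normcM. Qed.

Lemma cmodV z : cmod z^-1 = (cmod z)^-1.
Proof. by rewrite !cmod_normr; exact: Normc.normcV. Qed.

Lemma cmod_real (r : R) : cmod r%:C = `|r|.
Proof. by rewrite /cmod /= expr0n addr0 sqrtr_sqr. Qed.

Lemma cmod_nat n : cmod (n%:R : R[i]) = n%:R.
Proof. by rewrite -(rmorph_nat (real_complex R)) cmod_real normr_nat. Qed.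

Lemma cmod1 : cmod (1 : R[i]) = 1.
Proof. exact: (cmod_nat 1). Qed.

Lemma cmod_prod (I : Type) (r : seq I) (P : pred I) (F : I -> R[i]) :
  cmod (\prod_(i <- r | P i) F i) = \prod_(i <- r | P i) cmod (F i).
Proof. exact: (big_morph _ cmodM cmod1). Qed.

Lemma sqr_cmod z : cmod z ^+ 2 = cRe z ^+ 2 + cIm z ^+ 2.
Proof. by rewrite sqr_sqrtr// addr_ge0 ?sqr_ge0. Qed.

Lemma normr_cRe_le z : `|cRe z| <= cmod z.
Proof. by rewrite -sqrtr_sqr ler_sqrt ?addr_ge0 ?sqr_ge0// lerDl sqr_ge0. Qed.

Lemma normr_cIm_le z : `|cIm z| <= cmod z.
Proof. by rewrite -sqrtr_sqr ler_sqrt ?addr_ge0 ?sqr_ge0// lerDr sqr_ge0. Qed.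

Lemma cmod_le_cRe_cIm z : cmod z <= `|cRe z| + `|cIm z|.
Proof.
rewrite -[leRHS]ger0_norm ?addr_ge0// -sqrtr_sqr ler_sqrt ?sqr_ge0//.
by rewrite sqrrD !real_normK ?num_real// addrAC lerDl mulrn_wge0 ?mulr_ge0.
Qed.

Lemma cRe_cIm_dot_le z w : cRe z * cRe w + cIm z * cIm w <= cmod z * cmod w.
Proof.
have -> : cRe z * cRe w + cIm z * cIm w = cRe ((cRe z -i* cIm z) * w).
  by rewrite cReM /= mulNr opprK.
apply: le_trans (ler_norm _) (le_trans (normr_cRe_le _) _).
by rewrite cmodM /cmod /= sqrrN.
Qed.

End Modulus.
#[global] Hint Resolve cmod_ge0 ecmod_ge0 : core.

Section ComplexExponential.
Context {R : realType}.
Implicit Types z w : R[i].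

Lemma cRe_cexp z : cRe (cexp z) = expR (cRe z) * cos (cIm z).
Proof. by rewrite /cexp cReM /= mul0r subr0. Qed.

Lemma cIm_cexp z : cIm (cexp z) = expR (cRe z) * sin (cIm z).
Proof. by rewrite /cexp cImM /= mul0r addr0. Qed.

Lemma cexp0 : cexp 0 = 1 :> R[i].
Proof.
by apply: complex_ext; rewrite ?cRe_cexp ?cIm_cexp /= expR0 ?cos0 ?sin0 mul1r.
Qed.

Lemma cexpD z w : cexp (z + w) = cexp z * cexp w.
Proof.
apply: complex_ext.
  by rewrite cReM !(cRe_cexp, cIm_cexp) cReD cImD expRD cosD; ring.
by rewrite cImM !(cRe_cexp, cIm_cexp) cReD cImD expRD sinD; ring.
Qed.

Lemma cmod_cexp z : cmod (cexp z) = expR (cRe z).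
Proof.
rewrite /cmod cRe_cexp cIm_cexp !exprMn -mulrDr cos2Dsin2 mulr1 sqrtr_sqr.
by rewrite ger0_norm ?expR_ge0.
Qed.

End ComplexExponential.

Section ComplexDerivative.
Context {R : realType}.
Implicit Types (f g : R -> R[i]) (df dg c : R[i]) (t : R).

Definition is_cderive t f df :=
  is_derive t 1 (fun u => cRe (f u)) (cRe df) /\
  is_derive t 1 (fun u => cIm (f u)) (cIm df).

Lemma is_cderive_cst t c : is_cderive t (fun=> c) 0.
Proof. by split; exact: is_derive_cst. Qed.

Lemma is_cderiveD t f g df dg : is_cderive t f df -> is_cderive t g dg ->
  is_cderive t (fun u => f u + g u) (df + dg).
Proof.
move=> [fr fi] [gr gi]; split.
  by rewrite cReD; under eq_fun do rewrite cReD; exact: is_deriveD.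
by rewrite cImD; under eq_fun do rewrite cImD; exact: is_deriveD.
Qed.

Lemma is_cderiveN t f df : is_cderive t f df -> is_cderive t (fun u => - f u) (- df).
Proof.
move=> [fr fi]; split.
  by rewrite cReN; under eq_fun do rewrite cReN; exact: is_deriveN.
by rewrite cImN; under eq_fun do rewrite cImN; exact: is_deriveN.
Qed.

Lemma is_cderiveM t f g df dg : is_cderive t f df -> is_cderive t g dg ->
  is_cderive t (fun u => f u * g u) (df * g t + f t * dg).
Proof.
move=> [fr fi] [gr gi]; split.
  under eq_fun do rewrite cReM; rewrite cReD !cReM.
  by apply: is_derive_eq (is_deriveB (is_deriveM fr gr) (is_deriveM fi gi)) _;
    rewrite /GRing.scale /=; ring.
under eq_fun do rewrite cImM; rewrite cImD !cImM.
by apply: is_derive_eq (is_deriveD (is_deriveM fr gi) (is_deriveM fi gr)) _;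
  rewrite /GRing.scale /=; ring.
Qed.

Lemma is_cderive_real t (f : R -> R) (df : R) :
  is_derive t 1 f df -> is_cderive t (fun u => (f u)%:C) df%:C.
Proof. by move=> fd; split => //; exact: is_derive_cst. Qed.

Lemma is_cderive_cexp t f df : is_cderive t f df ->
  is_cderive t (fun u => cexp (f u)) (df * cexp (f t)).
Proof.
move=> [fr fi].
have de := @is_derive1_comp _ expR _ t _ _ (is_derive_expR _) fr.
have dc := @is_derive1_comp _ cos _ t _ _ (is_derive_cos _) fi.
have ds := @is_derive1_comp _ sin _ t _ _ (is_derive_sin _) fi.
split.
  under eq_fun do rewrite cRe_cexp; rewrite cReM cRe_cexp cIm_cexp.
  by apply: is_derive_eq (is_deriveM de dc) _; rewrite /GRing.scale /=; ring.
under eq_fun do rewrite cIm_cexp; rewrite cImM cRe_cexp cIm_cexp.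
by apply: is_derive_eq (is_deriveM de ds) _; rewrite /GRing.scale /=; ring.
Qed.

Lemma is_cderive_sum t (I : Type) (r : seq I) (f : I -> R -> R[i]) (df : I -> R[i]) :
  (forall i, is_cderive t (f i) (df i)) ->
  is_cderive t (fun u => \sum_(i <- r) f i u) (\sum_(i <- r) df i).
Proof.
move=> fd; elim: r => [|i r IHr].
  by rewrite big_nil; under eq_fun do rewrite big_nil; exact: is_cderive_cst.
by rewrite big_cons; under eq_fun do rewrite big_cons; exact: is_cderiveD.
Qed.

(* The real mean value theorem is applied to the component of [f] in the
   direction of the increment [f 1 - f 0]. *)
Lemma cmod_increment_le f (df : R -> R[i]) (M : R) :
  (forall t, is_cderive t f (df t)) ->
  (forall t, 0 <= t <= 1 -> cmod (df t) <= M) -> cmod (f 1 - f 0) <= M.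
Proof.
move=> fd dfM; pose D := f 1 - f 0.
pose comp (w : R[i]) := cRe D * cRe w + cIm D * cIm w.
have compd t : is_derive t 1 (fun u => comp (f u)) (comp (df t)).
  have [fr fi] := fd t.
  exact: (is_deriveD (is_deriveZ (cRe D) fr) (is_deriveZ (cIm D) fi)).
have compc : {within `[0, 1], continuous (fun u => comp (f u))}.
  by apply: derivable_within_continuous => t _; have [] := compd t.
have [t t01] := @MVT_segment _ _ _ 0 1 ler01 (fun t _ => compd t) compc.
rewrite subr0 mulr1 => incr.
have M0 : 0 <= M by apply: le_trans (cmod_ge0 _) (dfM t t01).
have [->//|D0] := eqVneq (cmod D) 0.
have Dp : 0 < cmod D by rewrite lt_def D0 cmod_ge0.
rewrite -(ler_pM2l Dp) -expr2 sqr_cmod.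
have -> : cRe D ^+ 2 + cIm D ^+ 2 = comp (df t).
  by rewrite -incr /comp /D cReD cImD cReN cImN; ring.
exact: le_trans (cRe_cIm_dot_le _ _) (ler_wpM2l (cmod_ge0 _) (dfM t t01)).
Qed.

Lemma cmod_cexp_sub1_le (w : R[i]) :
  cmod (cexp w - 1) <= cmod w * Num.max 1 (expR (cRe w)).
Proof.
have wd t : is_cderive t (fun u => cexp (w * u%:C)) (w * cexp (w * t%:C)).
  apply: is_cderive_cexp.
  have := is_cderiveM (is_cderive_cst t w) (is_cderive_real (is_derive_id t 1)).
  by rewrite mul0r add0r mulr1.
have := @cmod_increment_le _ _ (cmod w * Num.max 1 (expR (cRe w))) wd.
rewrite mulr1 mulr0 cexp0; apply => t /andP[t0 t1].
rewrite cmodM cmod_cexp ler_wpM2l ?cmod_ge0// cReM /= mulr0 subr0.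
rewrite le_max; have [w0|w0] := leP (cRe w) 0.
  by rewrite -[X in _ <= X]expR0 ler_expR mulr_le0_ge0.
by rewrite [X in _ || X]ler_expR ler_piMr ?orbT// ltW.
Qed.

End ComplexDerivative.

(** * Tree-graph inequality *)

Section ExtensionSums.
Import mathcomp.boot.fintype mathcomp.boot.finset.
Variable V : finType.
Implicit Types (e : V) (E A G : {set V}) (s : seq V) (P : pred {set V}).

Lemma big_subset_setU1 (S : nmodType) e E P (f : {set V} -> S) : e \notin E ->
  \sum_(G : {set V} | (G \subset e |: E) && P G) f G =
  \sum_(G : {set V} | (G \subset E) && P G) f G +
  \sum_(G : {set V} | (G \subset E) && P (e |: G)) f (e |: G).
Proof.
move=> eE; rewrite (bigID (fun G : {set V} => e \in G)) /= addrC; congr (_ + _).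
  by apply: eq_bigl => G; rewrite andbAC -subsetD1 setU1K.
rewrite (reindex_onto (fun G => e |: G) (fun G => G :\ e)) /=; last first.
  by move=> G /andP[_ eG]; rewrite setD1K.
apply: eq_bigl => G; rewrite setU11 andbT andbAC; congr (_ && _).
apply/andP/idP => [[sub /eqP <-]|sub].
  by rewrite subDset.
have eG : e \notin G by apply: contra eE => /(subsetP sub).
by rewrite setUS// setU1K.
Qed.

Section OneWeight.
Variables (S : comPzSemiRingType) (P : pred {set V}) (f : V -> S).

Definition extension_sum s A : S :=
  \sum_(G : {set V} | (G \subset [set e in s]) && P (G :|: A)) \prod_(e in G) f e.

Lemma extension_sum_nil A : extension_sum [::] A = (P A)%:R.
Proof.
have -> : extension_sum [::] A = \sum_(G : {set V} | G == set0) (P A)%:R.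
  rewrite /extension_sum big_mkcondr.
  have nil0 : [set e in [::]] = set0 :> {set V} by apply/setP => x; rewrite !inE.
  apply: eq_big => G; rewrite nil0 subset0// => /eqP ->.
  by rewrite set0U big_set0; case: (P A).
by rewrite big_pred1_eq.
Qed.

Lemma extension_sum_cons e s A : e \notin s ->
  extension_sum (e :: s) A = extension_sum s A + f e * extension_sum s (e |: A).
Proof.
move=> es; rewrite /extension_sum set_cons big_subset_setU1 ?inE//; congr (_ + _).
rewrite big_distrr /=; apply: eq_big => [G|G /andP[Gs _]].
  by rewrite setUCA setUA.
by rewrite big_setU1//; apply: contra es => /(subsetP Gs); rewrite inE.
Qed.

End OneWeight.

Lemma extension_sum_ge0 (R : numDomainType) P (f : V -> R) s A :
  (forall e, 0 <= f e) -> 0 <= extension_sum P f s A.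
Proof. by move=> f0; apply: sumr_ge0 => G _; apply: prodr_ge0. Qed.

Lemma prod1D_subsets (S : comPzSemiRingType) (f : V -> S) s : uniq s ->
  \prod_(e <- s) (1 + f e) =
  \sum_(G : {set V} | G \subset [set e in s]) \prod_(e in G) f e.
Proof.
move=> us; transitivity (extension_sum xpredT f s set0); last first.
  by apply: eq_bigl => G; rewrite andbT.
move: (set0 : {set V}) => A; elim: s us A => [|e s IHs] /=.
  by move=> _ A; rewrite big_nil extension_sum_nil.
move=> /andP[es us] A; rewrite big_cons extension_sum_cons// mulrDl mul1r.
by congr (_ + _ * _); exact: IHs.
Qed.

End ExtensionSums.

Section GraphConnectivity.
Import mathcomp.boot.fintype mathcomp.boot.finset.
Variable n : nat.
Implicit Types (A B G : {set 'I_n * 'I_n}) (e f : 'I_n * 'I_n) (x y : 'I_n).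

Definition joined A : rel 'I_n := connect (gadj A).

Lemma gadj_sym A : symmetric (gadj A).
Proof. by move=> x y; rewrite /gadj orbC. Qed.

Lemma joined_sym A : symmetric (joined A).
Proof. exact: (sym_connect_sym (@gadj_sym A)). Qed.

Lemma joined_trans A : transitive (joined A).
Proof. by move=> y x z; exact: connect_trans. Qed.

Lemma joinedS A B x y : A \subset B -> joined A x y -> joined B x y.
Proof.
move=> AB; apply: connect_sub => u v uv; apply: connect1; move: uv.
by rewrite /gadj => /orP[] /(subsetP AB) ->; rewrite ?orbT.
Qed.

Lemma joined_edge A e : e \in A -> joined A e.1 e.2.
Proof. by move=> eA; apply: connect1; rewrite /gadj -surjective_pairing eA. Qed.

Lemma joined_invariant A (P : pred 'I_n) x y :
  (forall u v, P u -> gadj A u v -> P v) -> P x -> joined A x y -> P y.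
Proof.
move=> inv Px /connectP[p]; elim: p x Px => [|v p IHp] x Px /=; first by move=> _ ->.
by move=> /andP[xv vp] yE; apply: (IHp v) => //; apply: inv xv.
Qed.

Lemma joined_setU1 A e x y : joined (e |: A) x y ->
  [\/ joined A x y, joined A x e.1 /\ joined A e.2 y |
      joined A x e.2 /\ joined A e.1 y].
Proof.
case/connectP => p; elim: p x => [|v p IHp] x /=.
  by move=> _ ->; apply: Or31; apply: connect0.
case/andP => xv vp yE; have {IHp vp yE} vy := IHp v vp yE.
have [xvA|xvA] := boolP (gadj A x v).
  have xvj : joined A x v by apply: connect1.
  case: vy => [vy|[v1 y2]|[v2 y1]].
  - by apply: Or31; apply: joined_trans vy.
  - by apply: Or32; split=> //; apply: joined_trans v1.
  - by apply: Or33; split=> //; apply: joined_trans v2.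
have {xv xvA} xvE : (x, v) = e \/ (v, x) = e.
  move: xv xvA; rewrite /gadj !inE.
  by case/orP=> /orP[/eqP|->]; rewrite ?orbT//; [left|right].
move: vy; case: xvE => <- /= [vy|[v1 y2]|[v2 y1]].
- by apply: Or32; split => //; apply: connect0.
- by apply: Or32; split => //; apply: connect0.
- by apply: Or31.
- by apply: Or33; split => //; apply: connect0.
- by apply: Or31.
- by apply: Or33; split => //; apply: connect0.
Qed.

Lemma joined_loop A e x y :
  joined A e.1 e.2 -> joined (e |: A) x y = joined A x y.
Proof.
move=> eA; apply/idP/idP; last exact/joinedS/subsetUr.
case/joined_setU1=> [//|[x1 y2]|[x2 y1]].
  exact: joined_trans (joined_trans x1 eA) y2.
by rewrite joined_sym in eA; apply: joined_trans (joined_trans x2 eA) y1.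
Qed.

Lemma gconnected_loop A e :
  joined A e.1 e.2 -> gconnected (e |: A) = gconnected A.
Proof.
by move=> eA; apply: eq_forallb => x; apply: eq_forallb => y; exact: joined_loop.
Qed.

Definition acyclic A := [forall e in A, ~~ joined (A :\ e) e.1 e.2].

Lemma acyclic0 : acyclic set0.
Proof. by apply/forall_inP => e; rewrite inE. Qed.

Lemma acyclicS A B : A \subset B -> acyclic B -> acyclic A.
Proof.
move=> AB /forall_inP acB; apply/forall_inP => e eA.
by apply: contra (acB e (subsetP AB _ eA)); exact/joinedS/setSD.
Qed.

Lemma acyclic_setU1 A e : acyclic A -> ~~ joined A e.1 e.2 -> acyclic (e |: A).
Proof.
move=> /forall_inP acA eA; apply/forall_inP => f.
have eNA : e \notin A by apply: contra eA => /joined_edge.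
rewrite !inE => /orP[/eqP ->|fA]; first by rewrite setU1K.
have fe : f != e by apply: contraNneq eNA => <-.
have -> : (e |: A) :\ f = e |: (A :\ f).
  by apply/setP => x; rewrite !inE; case: eqVneq => // ->; rewrite (negbTE fe).
apply: contra (acA f fA) => /joined_setU1.
have lift u v : joined (A :\ f) u v -> joined A u v by apply/joinedS/subD1set.
have f12 : joined A f.1 f.2 := joined_edge fA.
case=> [//|[/lift f1 /lift f2]|[/lift f1 /lift f2]]; case/negP: eA.
  rewrite joined_sym in f1; rewrite joined_sym in f2.
  exact: joined_trans f1 (joined_trans f12 f2).
rewrite joined_sym in f12.
exact: joined_trans f2 (joined_trans f12 f1).
Qed.

End GraphConnectivity.

Section ClosingWeights.
Import mathcomp.boot.fintype mathcomp.boot.finset.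
Context {R : realFieldType}.
Variables (n : nat) (w : 'I_n * 'I_n -> R).
Hypothesis w_ge0 : forall e, 0 <= w e.
Implicit Types (e : 'I_n * 'I_n) (s : seq ('I_n * 'I_n)) (A Q : {set 'I_n * 'I_n}).

Definition closing_weight s Q := \prod_(e <- s | joined Q e.1 e.2) w e.

Definition closing_weight_bounded s A M :=
  forall Q, A \subset Q -> closing_weight s Q <= M.

Lemma closing_weight_ge0 s Q : 0 <= closing_weight s Q.
Proof. by apply: prodr_ge0 => *. Qed.

Lemma closing_weight_bound_ge0 s A M : closing_weight_bounded s A M -> 0 <= M.
Proof. by move=> /(_ A (subxx A)); apply: le_trans; exact: closing_weight_ge0. Qed.

Lemma closing_weight_anti s A Q : {in s, forall e, w e <= 1} -> A \subset Q ->
  closing_weight s Q <= closing_weight s A.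
Proof.
move=> w1 AQ; rewrite /closing_weight big_mkcond [leRHS]big_mkcond /=.
rewrite !big_seq; apply: ler_prod => e es; apply/andP; split; first by case: ifP.
case: ifPn => [_|eQ]; first by case: ifP => // _; exact: w1.
by rewrite (contraNF (joinedS AQ) eQ).
Qed.

Lemma closing_weight_bounded_loop e s A M : 0 < w e -> joined A e.1 e.2 ->
  closing_weight_bounded (e :: s) A M -> closing_weight_bounded s A (M / w e).
Proof.
move=> we eA sM Q AQ; have := sM Q AQ.
by rewrite /closing_weight big_cons (joinedS AQ eA) ler_pdivlMr// mulrC.
Qed.

Section Bridge.
Variables (e : 'I_n * 'I_n) (s : seq ('I_n * 'I_n)) (A : {set 'I_n * 'I_n}) (M : R).
Hypotheses (w_max : {in s, forall f, w f <= w e}) (eA : ~~ joined A e.1 e.2).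
Hypothesis sM : closing_weight_bounded (e :: s) A M.

Let closing_weight_le_small Q : w e < 1 -> A \subset Q -> closing_weight s Q <= M.
Proof.
move=> we AQ; apply: le_trans (sM (subxx A)).
rewrite /closing_weight big_cons (negbTE eA); apply: closing_weight_anti => //.
by move=> f fs; apply: le_trans (w_max fs) (ltW we).
Qed.

Lemma closing_weight_bounded_delete : closing_weight_bounded s A M.
Proof.
move=> Q AQ; have [we|we] := ltP (w e) 1; first exact: closing_weight_le_small.
apply: le_trans (sM AQ); rewrite /closing_weight big_cons; case: ifP => // _.
exact: ler_peMl (closing_weight_ge0 _ _) we.
Qed.

Lemma closing_weight_bounded_contract :
  closing_weight_bounded s (e |: A) (M / Num.max 1 (w e)).
Proof.
move=> Q eAQ; have AQ := subset_trans (subsetUr _ _) eAQ.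
rewrite ler_pdivlMr ?lt_max ?ltr01// mulrC.
have [we|we] := ltP (w e) 1; first by rewrite mul1r closing_weight_le_small.
have := sM AQ; rewrite /closing_weight big_cons.
by rewrite (joined_edge (subsetP eAQ _ (setU11 _ _))).
Qed.

End Bridge.

End ClosingWeights.

Section Kruskal.
Import mathcomp.boot.fintype mathcomp.boot.finset.
Context {R : realType}.
Variables (n : nat) (z : 'I_n * 'I_n -> R[i]) (t : 'I_n * 'I_n -> R).
Hypothesis t_ge0 : forall e, 0 <= t e.
Let w e := cmod (1 + z e).
Hypothesis z_le : forall e, cmod (z e) <= t e * Num.max 1 (w e).
Implicit Types (e : 'I_n * 'I_n) (s : seq ('I_n * 'I_n)) (A Q : {set 'I_n * 'I_n}).

Let w_ge0 e : 0 <= w e. Proof. exact: cmod_ge0. Qed.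

Let connecting_sum := extension_sum (@gconnected n) z.

Let tree_sum :=
  extension_sum (fun G : {set 'I_n * 'I_n} => gconnected G && acyclic G) t.

Let tree_sum_ge0 s A : 0 <= tree_sum s A. Proof. exact: extension_sum_ge0. Qed.

Let connecting_sum_loop e s A : e \notin s -> joined A e.1 e.2 ->
  connecting_sum (e :: s) A = (1 + z e) * connecting_sum s A.
Proof.
move=> es eA; rewrite /connecting_sum extension_sum_cons// mulrDl mul1r.
congr (_ + _ * _); apply: eq_bigl => G; rewrite setUCA gconnected_loop//.
exact: joinedS (subsetUr _ _) eA.
Qed.

(* Edges are processed in decreasing order of [w], as in Kruskal's algorithm: an
   edge inside a component of [A] contributes its full factor [1 + z e], the
   others are deleted or contracted. *)
Let connecting_sum_le s A M :
  uniq s -> sorted (fun e f => w f <= w e) s -> acyclic A ->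
  closing_weight_bounded w s A M ->
  cmod (connecting_sum s A) <= M * tree_sum s A.
Proof.
elim: s A M => [|e s IHs] A M /=.
  move=> _ _ acA /(_ A (subxx A)); rewrite /closing_weight big_nil => M1.
  rewrite /connecting_sum /tree_sum !extension_sum_nil acA andbT cmod_nat.
  by rewrite ler_peMl.
move=> /andP[es us] sorted_es acA sM.
have sorted_s := path_sorted sorted_es.
have w_max : {in s, forall f, w f <= w e}.
  have wtr : transitive (fun e f => w f <= w e).
    by move=> f g h gf hf; apply: le_trans hf gf.
  by apply/allP; exact: order_path_min wtr sorted_es.
have M0 := closing_weight_bound_ge0 w_ge0 sM.
have tree_cons : tree_sum (e :: s) A = tree_sum s A + t e * tree_sum s (e |: A).
  exact: extension_sum_cons.
have [eA|eA] := boolP (joined A e.1 e.2).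
  rewrite connecting_sum_loop// cmodM -/(w e).
  apply: (@le_trans _ _ (M * tree_sum s A)); last first.
    by rewrite ler_wpM2l// tree_cons lerDl mulr_ge0.
  have [we0|we0] := eqVneq (w e) 0; first by rewrite we0 mul0r mulr_ge0.
  have we : 0 < w e by rewrite lt_def we0 w_ge0.
  rewrite mulrC -ler_pdivlMr// mulrAC; apply: IHs => //.
  exact: closing_weight_bounded_loop.
rewrite {1}/connecting_sum extension_sum_cons// tree_cons mulrDr.
apply: le_trans (cmodD _ _) (lerD _ _).
  by apply: IHs => //; exact: closing_weight_bounded_delete eA sM.
have max_gt0 : 0 < Num.max 1 (w e) by rewrite lt_max ltr01.
rewrite cmodM; apply: (@le_trans _ _ ((t e * Num.max 1 (w e)) *
    (M / Num.max 1 (w e) * tree_sum s (e |: A)))).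
  apply: ler_pM; rewrite ?cmod_ge0//; apply: IHs => //.
    exact: acyclic_setU1.
  exact: closing_weight_bounded_contract.
by rewrite le_eqVlt; apply/orP; left; apply/eqP; field; rewrite gt_eqF.
Qed.

Lemma tree_graph_le M :
  (forall Q, \prod_(e : 'I_n * 'I_n | (e.1 < e.2)%N && joined Q e.1 e.2) w e <= M) ->
  cmod (\sum_(G : {set 'I_n * 'I_n} | graph_on G && gconnected G) \prod_(e in G) z e)
  <= M * \sum_(G : {set 'I_n * 'I_n} | [&& graph_on G, gconnected G & acyclic G])
           \prod_(e in G) t e.
Proof.
move=> wM; pose ordered_pairs := [set e : 'I_n * 'I_n | (e.1 < e.2)%N].
pose s := sort (fun e f => w f <= w e) (enum ordered_pairs).
have graph_onE G : graph_on G = (G \subset [set e in s]).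
  have -> : [set e in s] = ordered_pairs.
    by apply/setP => e; rewrite inE mem_sort mem_enum.
  by apply/forall_inP/subsetP => sub e /sub; rewrite inE.
suff : cmod (connecting_sum s set0) <= M * tree_sum s set0.
  rewrite /connecting_sum /tree_sum /extension_sum.
  by congr (cmod _ <= _ * _); apply: eq_bigl => G; rewrite setU0 graph_onE.
apply: connecting_sum_le; last 2 first.
- exact: acyclic0.
- move=> Q _; apply: le_trans (wM Q); rewrite /closing_weight.
  rewrite (perm_big (enum ordered_pairs)) ?perm_sort//= big_enum_cond.
  by rewrite le_eqVlt; apply/orP; left; apply/eqP/eq_bigl => e; rewrite inE.
- by rewrite sort_uniq enum_uniq.
- by apply: sort_sorted => e f; exact: le_total.
Qed.

End Kruskal.

(** * Rooted forests *)

Section SplitSums.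
Import mathcomp.boot.fintype mathcomp.boot.finset.

Fixpoint split_sum (S : nmodType) (T : Type) (A : seq T -> seq T -> S) (J : seq T) : S :=
  if J is y :: J' then
    split_sum (fun K L => A (y :: K) L) J' + split_sum (fun K L => A K (y :: L)) J'
  else A [::] [::].

Lemma eq_split_sum (S : nmodType) (T : Type) (A B : seq T -> seq T -> S) J :
  (forall K L, A K L = B K L) -> split_sum A J = split_sum B J.
Proof. by elim: J A B => [|y J IHJ] A B AB //=; congr (_ + _); exact: IHJ. Qed.

Lemma split_sum_map (S : nmodType) (T U : Type) (f : U -> T) (A : seq T -> seq T -> S) J :
  split_sum A (map f J) = split_sum (fun K L => A (map f K) (map f L)) J.
Proof. by elim: J A => //= y J IHJ A; rewrite !IHJ. Qed.

Lemma split_sum_ge0 (S : numDomainType) (T : Type) (A : seq T -> seq T -> S) J :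
  (forall K L, 0 <= A K L) -> 0 <= split_sum A J.
Proof. by elim: J A => //= y J IHJ A A0; rewrite addr_ge0 ?IHJ. Qed.

Lemma split_sum_mulr (S : pzSemiRingType) (T : Type) (A : seq T -> seq T -> S) c J :
  split_sum A J * c = split_sum (fun K L => A K L * c) J.
Proof. by elim: J A => //= y J IHJ A; rewrite mulrDl !IHJ. Qed.

Lemma split_sum_prodr (S : comPzSemiRingType) (T : Type) (f : T -> S)
    (A : seq T -> seq T -> S) J :
  split_sum A J * \prod_(x <- J) f x =
  split_sum (fun K L => A K L * ((\prod_(x <- K) f x) * \prod_(x <- L) f x)) J.
Proof.
elim: J A => [|y J IHJ] A /=; first by rewrite !big_nil !mulr1.
rewrite big_cons mulrDl !mulrA !(split_sum_mulr _ (f y)) !IHJ.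
congr (_ + _); apply: eq_split_sum => K L; rewrite big_cons -!mulrA.
  by [].
by congr (_ * _); rewrite mulrCA.
Qed.

Lemma split_sum_setE (S : nmodType) (V : finType) (A : seq V -> seq V -> S) (J : seq V) :
  uniq J ->
  split_sum A J = \sum_(K : {set V} | K \subset [set x in J])
    A [seq x <- J | x \in K] [seq x <- J | x \notin K].
Proof.
elim: J A => [|y J IHJ] A /=.
  move=> _; rewrite (big_pred1 set0) ?filter_pred0// => K /=.
  suff -> : [set x in [::]] = set0 :> {set V} by rewrite subset0.
  by apply/setP => x; rewrite !inE.
move=> /andP[yJ uJ]; rewrite !IHJ// set_cons.
under [RHS]eq_bigl => K do rewrite -[_ \subset _]andbT.
rewrite big_subset_setU1 ?inE// addrC.
congr (_ + _); apply: eq_big => [K|K KJ]; rewrite ?andbT//=.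
  have -> // : (y \in K) = false.
  by apply: contraNF yJ => /(subsetP KJ); rewrite inE.
rewrite setU11 /=; congr (A (_ :: _) _); apply: eq_in_filter => x xJ;
  by rewrite !inE; case: eqVneq => // xy; rewrite -xy xJ in yJ.
Qed.

End SplitSums.

Section ForestSums.
Import mathcomp.boot.fintype mathcomp.boot.finset.
Context {R : numDomainType} {T : Type}.
Implicit Types (t : T -> T -> R) (I J : seq T).

(* The total weight of the forests on the vertices [I ++ J] with set of roots [I],
   explored from the first root; [m] is the fuel, and [size I + size J < m]
   suffices. *)
Fixpoint forest_sum t (m : nat) I J : R :=
  if m is m'.+1 then
    if I is i :: I' then
      split_sum (fun K L => (\prod_(k <- K) t i k) * forest_sum t m' (I' ++ K) L) J
    else (size J == 0)%:R
  else 0.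

Lemma forest_sum_ge0 t m I J : (forall x y, 0 <= t x y) -> 0 <= forest_sum t m I J.
Proof.
move=> t0; elim: m I J => //= m IHm [|i I] J; first by case: (size J).
by apply: split_sum_ge0 => K L; rewrite mulr_ge0 ?prodr_ge0.
Qed.

End ForestSums.

Lemma forest_sum_map (R : numDomainType) (T U : Type) (f : U -> T) (t : T -> T -> R) m I J :
  forest_sum t m (map f I) (map f J) = forest_sum (fun x y => t (f x) (f y)) m I J.
Proof.
elim: m I J => //= m IHm [|i I] J /=; first by rewrite size_map.
rewrite split_sum_map; apply: eq_split_sum => K L.
by rewrite big_map -map_cat IHm.
Qed.

(* Every vertex of [J] is the child of exactly one edge. *)
Lemma forest_sum_child_weight (R : numDomainType) (T : Type) (t : T -> T -> R)
    (B : T -> R) m I J :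
  forest_sum (fun x y => t x y * B y) m I J = forest_sum t m I J * \prod_(y <- J) B y.
Proof.
elim: m I J => [|m IHm] [|i I] J //=; rewrite ?mul0r//.
  by case: J => [|y J] /=; rewrite ?big_nil ?mulr1 ?mul0r.
rewrite split_sum_prodr; apply: eq_split_sum => K L.
by rewrite IHm big_split /=; ring.
Qed.

Section RootedForests.
Import mathcomp.boot.fintype mathcomp.boot.finset.
Variable n : nat.
Implicit Types (i j k : 'I_n) (I J : seq 'I_n) (G H : {set 'I_n * 'I_n}).

Definition edge i j := if (i < j)%N then (i, j) else (j, i).

Lemma edge_inj i : injective (edge i).
Proof. by move=> j k; rewrite /edge; case: ifP; case: ifP => ? ? [] => // -> ->. Qed.

Lemma gadj_edge G i j : graph_on G -> gadj G i j = (edge i j \in G).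
Proof.
move=> /forall_inP ordered; rewrite /gadj /edge; case: ltnP => ij.
  have [jiG|//] := boolP ((j, i) \in G); last by rewrite orbF.
  by have := ordered _ jiG; rewrite /= ltnNge (ltnW ij).
have [ijG|//] := boolP ((i, j) \in G).
by have := ordered _ ijG; rewrite /= ltnNge ij.
Qed.

Lemma graph_onS G H : G \subset H -> graph_on H -> graph_on G.
Proof.
by move=> GH /forall_inP ordered; apply/forall_inP => e /(subsetP GH)/ordered.
Qed.

Definition edges_within (C : {pred 'I_n}) G :=
  [forall e in G, (e.1 \in C) && (e.2 \in C)].

Definition rooted_forest I J G :=
  [&& graph_on G, acyclic G, edges_within (mem (I ++ J)) G,
      all (fun j => has (joined G j) I) J &
      pairwise (fun i i' => ~~ joined G i i') I].

Definition children i J G := [set k in J | gadj G i k].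

Definition delete_vertex i G := [set e in G | (e.1 != i) && (e.2 != i)].

Lemma delete_vertexS i G : delete_vertex i G \subset G.
Proof. by apply/subsetP => e; rewrite inE => /andP[]. Qed.

Section FirstRoot.
Variables (i : 'I_n) (I J : seq 'I_n) (G : {set 'I_n * 'I_n}).
Hypotheses (uIJ : uniq (i :: I ++ J)) (forestG : rooted_forest (i :: I) J G).

Local Notation K := (children i J G).
Local Notation G' := (delete_vertex i G).
Local Notation fK := [seq x <- J | x \in K].
Local Notation fL := [seq x <- J | x \notin K].

Let orderedG : graph_on G. Proof. by case/and5P: forestG. Qed.
Let acyclicG : acyclic G. Proof. by case/and5P: forestG. Qed.

Let gadj_memJ k : gadj G i k -> k \in J.
Proof.
move=> ik; case/and5P: forestG => _ _ /forall_inP within _ /= /andP[/allP sep _].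
have : k \in (i :: I) ++ J by move: ik; rewrite /gadj => /orP[] /within /andP[].
have ki : k != i.
  apply: contraTneq ik => ->; rewrite /gadj orbb; apply/negP.
  by move/(forall_inP orderedG); rewrite ltnn.
rewrite mem_cat inE (negbTE ki) /= => /orP[kI|//].
by have := sep _ kI; rewrite /joined connect1.
Qed.

Let mem_children k : (k \in K) = gadj G i k.
Proof.
by rewrite inE; have [/gadj_memJ ->|] := boolP (gadj G i k); rewrite ?andbF.
Qed.

Let uniq_fK : uniq fK.
Proof. by rewrite filter_uniq//; move: uIJ; rewrite /= cat_uniq => /and4P[]. Qed.

Lemma root_edgesE : [set e in G | ~~ ((e.1 != i) && (e.2 != i))] = edge i @: K.
Proof.
apply/setP => e; rewrite inE negb_and !negbK; apply/andP/imsetP.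
  move=> [eG /orP[] /eqP ei].
  - exists e.2; last by rewrite /edge -ei (forall_inP orderedG _ eG) -surjective_pairing.
    by rewrite mem_children /gadj -ei -surjective_pairing eG.
  - exists e.1; last first.
      rewrite /edge -ei ltnNge ltnW ?(forall_inP orderedG _ eG)//=.
      by rewrite -surjective_pairing.
    by rewrite mem_children /gadj -ei -surjective_pairing eG orbT.
case=> k; rewrite mem_children gadj_edge// => ikG ->; split => //.
by rewrite /edge; case: ifP => _ /=; rewrite eqxx ?orbT.
Qed.

Lemma forest_root_setU : G = G' :|: edge i @: K.
Proof.
rewrite -root_edgesE; apply/setP => e; rewrite !inE -andb_orr.
by rewrite orbN andbT.
Qed.

Let joined_delete x y : joined G x y -> x != i ->
  (y != i /\ joined G' x y) \/ exists2 k, k \in K & joined G' x k.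
Proof.
case/connectP => p; elim: p x => [|v p IHp] x /=.
  by move=> _ -> xi; left; split => //; apply: connect0.
move=> /andP[xv vp] yE xi; have [vi|vi] := eqVneq v i.
  by right; exists x; [rewrite mem_children gadj_sym -vi|apply: connect0].
have xvj : joined G' x v.
  by apply: connect1; move: xv; rewrite /gadj !inE /= xi vi !andbT.
case: (IHp v vp yE vi) => [[yi vy]|[k kK vk]].
  by left; split => //; apply: joined_trans vy.
by right; exists k => //; apply: joined_trans vk.
Qed.

Let delete_root_within : edges_within (mem ((I ++ fK) ++ fL)) G'.
Proof.
case/and5P: forestG => _ _ /forall_inP within _ _.
apply/forall_inP => e; rewrite inE => /andP[/within/andP[e1 e2] /andP[e1i e2i]].
have keep x : x != i -> x \in (i :: I) ++ J -> x \in (I ++ fK) ++ fL.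
  move=> /negbTE xi; rewrite !mem_cat !mem_filter inE xi /=.
  by case/orP => ->; rewrite ?orbT// !andbT -orbA orbN orbT.
by apply/andP; split; exact: keep.
Qed.

Let delete_root_reachable : all (fun j => has (joined G' j) (I ++ fK)) fL.
Proof.
case/and5P: forestG => _ _ _ /allP reach _.
apply/allP => j; rewrite mem_filter => /andP[_ jJ].
have ji : j != i.
  apply: contraTneq jJ => ->; move: uIJ => /=.
  by rewrite mem_cat negb_or => /andP[/andP[]].
have /hasP[i0 i0I ji0] := reach j jJ.
apply/hasP; case: (joined_delete ji0 ji) => [[i0i ji0']|[k kK jk]].
  by exists i0 => //; move: i0I; rewrite mem_cat inE (negbTE i0i) /= => ->.
exists k => //; rewrite mem_cat mem_filter kK; apply/orP; right.
by move: kK; rewrite inE => /andP[].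
Qed.

Let children_separated k k' :
  k \in K -> k' \in K -> k != k' -> ~~ joined G' k k'.
Proof.
rewrite !mem_children !gadj_edge// => ik ik' kk'; apply/negP => kk'j.
have : joined (G :\ edge i k) i k.
  apply: (@joined_trans _ _ k').
    have : edge i k' \in G :\ edge i k.
      by rewrite !inE ik' andbT (inj_eq (@edge_inj i)) eq_sym.
    by move=> ik'e; apply: connect1; move: ik'e; rewrite /edge /gadj;
      case: ifP => _ ->; rewrite ?orbT.
  rewrite joined_sym; apply: joinedS kk'j; apply/subsetP => e; rewrite !inE.
  move=> /andP[-> /andP[e1i e2i]]; rewrite andbT.
  apply/eqP => eE; move: e1i e2i; rewrite eE /edge.
  by case: ifP => _ /=; rewrite eqxx.
have := forall_inP acyclicG _ ik; rewrite {2 3}/edge; case: ifP => _ /= /negP sep;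
  by move=> ikj; apply: sep; rewrite // joined_sym.
Qed.

Let delete_root_separated : pairwise (fun j j' => ~~ joined G' j j') (I ++ fK).
Proof.
case/and5P: forestG => _ _ _ _ /= /andP[/allP iI sepI].
have sub := delete_vertexS i G.
rewrite pairwise_cat; apply/and3P; split.
- apply/allrelP => j k jI; rewrite mem_filter mem_children => /andP[ik _].
  apply: contra (iI _ jI) => /(joinedS sub) jk.
  by apply: (@joined_trans _ _ k); [exact: connect1|rewrite joined_sym].
- by apply: sub_pairwise sepI => j j'; apply: contra; exact: joinedS.
have := uniq_fK; rewrite uniq_pairwise.
apply: (@sub_in_pairwise _ [in K]) => [k k'|]; last first.
  by apply/allP => x; rewrite mem_filter => /andP[].
exact: children_separated.
Qed.

Lemma delete_root_forest : rooted_forest (I ++ fK) fL G'.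
Proof.
have sub := delete_vertexS i G.
apply/and5P; split; [exact: graph_onS sub orderedG|exact: acyclicS sub acyclicG|
  exact: delete_root_within|exact: delete_root_reachable|exact: delete_root_separated].
Qed.

Lemma forest_root_prod (S : comPzSemiRingType) (t : 'I_n -> 'I_n -> S) :
  (forall x y, t x y = t y x) ->
  \prod_(e in G) t e.1 e.2 =
  (\prod_(k <- fK) t i k) * \prod_(e in G') t e.1 e.2.
Proof.
move=> t_sym; rewrite (bigID (fun e => (e.1 != i) && (e.2 != i))) /= mulrC.
congr (_ * _); last by apply: eq_bigl => e; rewrite inE.
transitivity (\prod_(e in edge i @: K) t e.1 e.2).
  by apply: eq_bigl => e; rewrite -root_edgesE inE.
rewrite big_imset /=; last by move=> x y _ _; exact: edge_inj.
rewrite big_uniq//; apply: eq_big => [k|k _]; last by rewrite /edge; case: ifP.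
by rewrite mem_filter; case: (boolP (k \in K)) => //; rewrite inE => /andP[->].
Qed.

End FirstRoot.

Lemma ler_sum_image (R : numDomainType) (V : finType) (P Q : {pred V}) (d : V -> V)
    (f : V -> R) :
  (forall x, 0 <= f x) -> {in P &, injective d} -> {homo d : x / x \in P >-> x \in Q} ->
  \sum_(x in P) f (d x) <= \sum_(x in Q) f x.
Proof.
move=> f0 dinj dPQ.
rewrite -(@big_imset _ _ _ _ _ d (mem P) f)//=.
rewrite [leLHS]big_mkcond [leRHS]big_mkcond; apply: ler_sum => x _.
case: ifPn => [/imsetP[y yP ->]|_]; last by case: ifP.
by rewrite dPQ.
Qed.

Section ForestSumBound.
Context {R : numDomainType}.
Variable t : 'I_n -> 'I_n -> R.
Hypotheses (t_sym : forall x y, t x y = t y x) (t_ge0 : forall x y, 0 <= t x y).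

Let weight G := \prod_(e in G) t e.1 e.2.

Let weight_ge0 G : 0 <= weight G. Proof. exact: prodr_ge0. Qed.

Let sum_rooted_forest_nil J m :
  \sum_(G | rooted_forest [::] J G) weight G <= forest_sum t m.+1 [::] J.
Proof.
case: J => [|j J] /=; last first.
  by rewrite big_pred0// => G; rewrite /rooted_forest /= !andbF.
rewrite -[leRHS](_ : \sum_(G : {set 'I_n * 'I_n} | G == set0) weight G = _).
  rewrite [leLHS]big_mkcond [leRHS]big_mkcond; apply: ler_sum => G _.
  case: ifP => [/and5P[_ _ /forall_inP within _ _]|_]; last by case: ifP.
  have -> : G = set0.
    by apply/eqP; apply: contraT => /set0Pn[e /within]; rewrite in_nil.
  by rewrite eqxx.
by rewrite big_pred1_eq /weight big_set0.
Qed.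

Let sum_rooted_forest_children i I J (K : {set 'I_n}) : uniq (i :: I ++ J) ->
  \sum_(G | rooted_forest (i :: I) J G && (children i J G == K)) weight G <=
  (\prod_(k <- [seq x <- J | x \in K]) t i k) *
  \sum_(G | rooted_forest (I ++ [seq x <- J | x \in K]) [seq x <- J | x \notin K] G)
    weight G.
Proof.
move=> uIJ; pose P := [pred G | rooted_forest (i :: I) J G && (children i J G == K)].
rewrite (eq_bigr (fun G => (\prod_(k <- [seq x <- J | x \in K]) t i k) *
    weight (delete_vertex i G))); last first.
  by move=> G /andP[forestG /eqP <-]; rewrite /weight (forest_root_prod uIJ forestG).
rewrite -big_distrr /=; apply: ler_wpM2l; first exact: prodr_ge0.
apply: (@ler_sum_image _ _ P) => // [G1 G2|G].
  move=> /andP[forest1 /eqP K1] /andP[forest2 /eqP K2] G12.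
  by rewrite (forest_root_setU forest1) (forest_root_setU forest2) G12 K1 K2.
by move=> /andP[forestG /eqP <-]; exact: delete_root_forest.
Qed.

Lemma sum_rooted_forest_le m I J : uniq (I ++ J) -> (size I + size J < m)%N ->
  \sum_(G | rooted_forest I J G) weight G <= forest_sum t m I J.
Proof.
elim: m I J => // m IHm [|i I] J uIJ szm; first exact: sum_rooted_forest_nil.
have uJ : uniq J by move: uIJ; rewrite cat_uniq => /and3P[].
rewrite /= split_sum_setE//.
rewrite (partition_big (children i J) (fun K : {set 'I_n} => K \subset [set x in J]));
  last by move=> G _; apply/subsetP => k; rewrite !inE => /andP[].
apply: ler_sum => K KJ; apply: le_trans (sum_rooted_forest_children _ uIJ) _.
apply: ler_wpM2l; first exact: prodr_ge0.
have permJ : perm_eq ([seq x <- J | x \in K] ++ [seq x <- J | x \notin K]) J.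
  exact/permPl/perm_filterC.
apply: IHm.
  rewrite -catA; move: uIJ => /= /andP[_]; apply: etrans; apply: perm_uniq.
  by rewrite perm_cat2l.
by rewrite size_cat -addnA -size_cat (perm_size permJ); move: szm => /=; rewrite addSn.
Qed.

End ForestSumBound.

End RootedForests.

(** * Connected components *)

Section PairsProduct.
Variable S : comPzSemiRingType.

Fixpoint pairs_prod (T : Type) (f : T -> T -> S) (s : seq T) : S :=
  if s is x :: s' then (\prod_(y <- s') f x y) * pairs_prod f s' else 1.

Lemma pairs_prodE (T : Type) (f : T -> T -> S) x0 s :
  \prod_(i < size s) \prod_(j < size s | (i < j)%N) f (nth x0 s i) (nth x0 s j) =
  pairs_prod f s.
Proof.
elim: s => [|x s IHs]; first by rewrite big_ord0.
rewrite /= big_ord_recl /=; congr (_ * _).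
  rewrite big_mkcond big_ord_recl /= mul1r (big_nth x0) big_mkord.
  by apply: eq_bigr => i _.
rewrite -IHs; apply: eq_bigr => i _; rewrite big_mkcond big_ord_recl /= mul1r.
by rewrite [RHS]big_mkcond; apply: eq_bigr => j _; rewrite /bump /= !add1n ltnS.
Qed.

Lemma pairs_prod_map (T U : Type) (g : U -> T) (f : T -> T -> S) s :
  pairs_prod f (map g s) = pairs_prod (fun x y => f (g x) (g y)) s.
Proof. by elim: s => //= x s ->; rewrite big_map. Qed.

Lemma pairs_prod_sorted n (f : 'I_n -> 'I_n -> S) (s : seq 'I_n) :
  sorted (fun i j : 'I_n => (i < j)%N) s ->
  pairs_prod f s =
  \prod_(e : 'I_n * 'I_n | [&& e.1 \in s, e.2 \in s & (e.1 < e.2)%N]) f e.1 e.2.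
Proof.
move=> sorted_s.
have lt_tr : transitive (fun i j : 'I_n => (i < j)%N) by move=> i j k; exact: ltn_trans.
have us : uniq s by apply: sorted_uniq sorted_s => // i; rewrite ltnn.
transitivity (\prod_(i <- s) \prod_(j <- s | (i < j)%N) f i j); last first.
  rewrite big_uniq//=
    (eq_bigr (fun i : 'I_n => \prod_(j : 'I_n | (j \in s) && (i < j)%N) f i j)).
    by rewrite pair_big_dep.
  move=> i _; rewrite big_mkcond big_uniq//= [RHS]big_mkcond [LHS]big_mkcond.
  by apply: eq_bigr => j _; case: (j \in s).
elim: s sorted_s {us} => [|x s IHs] sorted_s /=; first by rewrite big_nil.
have x_lt : {in s, forall y : 'I_n, (x < y)%N}.
  by apply/allP; exact: order_path_min lt_tr sorted_s.
rewrite !big_cons ltnn IHs; last exact: path_sorted sorted_s.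
congr (_ * _).
  by rewrite [RHS]big_mkcond !big_seq; apply: eq_bigr => y /x_lt ->.
rewrite big_seq [RHS]big_seq; apply: eq_bigr => i /x_lt xi.
by rewrite big_cons ltnNge ltnW.
Qed.

End PairsProduct.

Lemma cmod_pairs_prod {R : realType} (T : Type) (f : T -> T -> R[i]) s :
  cmod (pairs_prod f s) = pairs_prod (fun x y => cmod (f x y)) s.
Proof. by elim: s => [|x s /= <-]; rewrite ?cmod1//= cmodM cmod_prod. Qed.

Lemma pairs_prod_ge0 (R : numDomainType) (T : Type) (f : T -> T -> R) s :
  (forall x y, 0 <= f x y) -> 0 <= pairs_prod f s.
Proof. by move=> f0; elim: s => //= x s IHs; rewrite mulr_ge0 ?prodr_ge0. Qed.

Lemma sorted_enum_ord n : sorted (fun i j : 'I_n => (i < j)%N) (enum 'I_n).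
Proof.
by rewrite -(sorted_map (f := val) (e' := ltn)) val_enum_ord iota_ltn_sorted.
Qed.

Lemma map_nth_enum_ord (T : Type) (x0 : T) s :
  [seq nth x0 s i | i : 'I_(size s) <- enum 'I_(size s)] = s.
Proof.
rewrite -[RHS](map_tnth_enum (in_tuple s)); apply: eq_map => i.
exact/esym/tnth_nth.
Qed.

Definition connected_sum (S : comPzSemiRingType) (T : Type) (x0 : T) (z : T -> T -> S)
    (s : seq T) : S :=
  \sum_(G : {set 'I_(size s) * 'I_(size s)} | graph_on G && gconnected G)
    \prod_(e in G) z (nth x0 s e.1) (nth x0 s e.2).

Section GraphComponents.
Import mathcomp.boot.fintype mathcomp.boot.finset.
Variables (n : nat) (v0 : 'I_n).
Implicit Types (C D : {set 'I_n}) (G H : {set 'I_n * 'I_n}).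

Definition graph_within C G := graph_on G && edges_within C G.

Definition connected_on C G :=
  graph_within C G && [forall j in C, joined G v0 j].

Definition induced C G := [set e in G | (e.1 \in C) && (e.2 \in C)].

Definition component G := [set j | joined G v0 j].

Lemma mem_induced C G e :
  (e \in induced C G) = (e \in G) && ((e.1 \in C) && (e.2 \in C)).
Proof. by rewrite inE. Qed.

Lemma inducedS C G : induced C G \subset G.
Proof. by apply/subsetP => e; rewrite inE => /andP[]. Qed.

Lemma graph_within_induced C G : graph_on G -> graph_within C (induced C G).
Proof.
move=> ordered; rewrite /graph_within (graph_onS (inducedS C G))//=.
by apply/forall_inP => e; rewrite inE => /andP[].
Qed.

Lemma mem_component G : v0 \in component G.
Proof. by rewrite inE; exact: connect0. Qed.

Lemma component_edge G e : e \in G -> (e.1 \in component G) = (e.2 \in component G).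
Proof.
move=> /joined_edge e12; rewrite !inE; apply/idP/idP => v0j.
  exact: joined_trans v0j e12.
by rewrite joined_sym in e12; exact: joined_trans v0j e12.
Qed.

Lemma component_within D G : v0 \in D -> edges_within D G -> component G \subset D.
Proof.
move=> v0D /forall_inP within; apply/subsetP => j; rewrite inE.
apply: joined_invariant v0D => u v _.
by move=> /orP[] /within /andP[].
Qed.

Lemma connected_on_component G :
  graph_on G -> connected_on (component G) (induced (component G) G).
Proof.
move=> ordered; rewrite /connected_on graph_within_induced//=.
apply/forall_inP => j; rewrite inE.
apply: joined_invariant (connect0 _ _) => u v v0u uv.
apply: (joined_trans v0u); apply: connect1.
have uC : u \in component G by rewrite inE; apply: joinedS v0u; exact: inducedS.
have keep e : e \in G -> (e.1 \in component G) || (e.2 \in component G) ->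
    e \in induced (component G) G.
  by move=> eG; rewrite component_edge// orbb => e2; rewrite mem_induced eG component_edge ?e2.
by rewrite /gadj; case/orP: uv => /keep; rewrite uC ?orbT => /(_ isT) ->; rewrite ?orbT.
Qed.

Lemma induced_component_setU D G : edges_within D G ->
  G = induced (component G) G :|: induced (D :\: component G) G.
Proof.
move=> /forall_inP within; apply/setP => e; rewrite in_setU !mem_induced !in_setD.
have [eG|//] := boolP (e \in G).
have /andP[-> ->] := within _ eG.
by rewrite component_edge// !andbT !andbb orbN.
Qed.

Section DisjointUnion.
Variables (C D : {set 'I_n}) (G H : {set 'I_n * 'I_n}).
Hypotheses (GC : edges_within C G) (HD : edges_within (D :\: C) H).

Let memG e : e \in G -> (e.1 \in C) && (e.2 \in C). Proof. exact: (forall_inP GC). Qed.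

Let memH e : e \in H ->
  [&& e.1 \notin C, e.1 \in D, e.2 \notin C & e.2 \in D].
Proof. by move=> /(forall_inP HD); rewrite !inE => /andP[/andP[-> ->] /andP[-> ->]]. Qed.

Lemma induced_setUl : induced C (G :|: H) = G.
Proof.
apply/setP => e; rewrite !inE; have [/memG ->//|_] := boolP (e \in G).
by have [/memH/and4P[/negbTE -> _ _ _]|] := boolP (e \in H); rewrite ?andbF.
Qed.

Lemma induced_setUr : induced (D :\: C) (G :|: H) = H.
Proof.
apply/setP => e; rewrite !inE.
have [/memH/and4P[-> -> -> ->]|_] := boolP (e \in H); first by rewrite orbT.
by have [/memG/andP[-> _]|] := boolP (e \in G).
Qed.

Lemma disjoint_edges : [disjoint G & H]%B.
Proof.
rewrite -setI_eq0; apply/eqP/setP => e; rewrite !inE; apply/negP => /andP[/memG eG /memH].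
by case/andP: eG => ->.
Qed.

Lemma component_setU : v0 \in C -> [forall j in C, joined G v0 j] ->
  component (G :|: H) = C.
Proof.
move=> v0C /forall_inP conn; apply/setP => j; rewrite inE; apply/idP/idP.
  apply: (joined_invariant (P := fun u => u \in C)) v0C => u v uC; rewrite /gadj !inE.
  by move=> /orP[] /orP[/memG|/memH] /=; rewrite uC /= ?andbF// => /andP[].
by move=> /conn; apply: joinedS; exact: subsetUl.
Qed.

End DisjointUnion.

Section WeightedSums.
Variables (S : comPzSemiRingType) (z : 'I_n * 'I_n -> S).

Let weight G := \prod_(e in G) z e.

Lemma sum_component C D : v0 \in C -> C \subset D ->
  \sum_(G | graph_within D G && (component G == C)) weight G =
  (\sum_(G | connected_on C G) weight G) * \sum_(G | graph_within (D :\: C) G) weight G.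
Proof.
move=> v0C CD; rewrite big_distrlr /= pair_big /=.
rewrite (reindex_onto (fun p => p.1 :|: p.2) (fun G => (induced C G, induced (D :\: C) G)));
  last by move=> G /andP[/andP[_ /induced_component_setU GE] /eqP <-] /=; rewrite -GE.
have within_induced A G H : induced A G = H -> edges_within A H.
  by move=> <-; apply/forall_inP => e; rewrite inE => /andP[].
apply: eq_big => [[G H]|[G H] /andP[_ /eqP[GE HE]]] /=; last first.
  have GH := disjoint_edges (within_induced _ _ _ GE) (within_induced _ _ _ HE).
  by rewrite /weight -(bigU _ _ _ GH); apply: eq_bigl => e; rewrite in_setU.
apply/andP/andP.
  case=> [/andP[/andP[ordered _] /eqP CE] /eqP[GE HE]]; split.
    by rewrite -GE -CE; exact: connected_on_component.
  by rewrite -HE; exact: graph_within_induced.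
case=> [/andP[/andP[orderedG GC] conn] /andP[orderedH HD]]; split; last first.
  by rewrite (induced_setUl GC HD) (induced_setUr GC HD).
rewrite (component_setU GC HD)// eqxx andbT; apply/andP; split.
  apply/forall_inP => e; rewrite inE.
  by move=> /orP[/(forall_inP orderedG)|/(forall_inP orderedH)].
apply/forall_inP => e; rewrite inE => /orP[/(forall_inP GC)/andP[e1 e2]|].
  by rewrite !(subsetP CD).
by move=> /(forall_inP HD); rewrite !inE => /andP[/andP[_ ->] /andP[_ ->]].
Qed.

Lemma sum_graph_within D : v0 \in D ->
  \sum_(G | graph_within D G) weight G =
  \sum_(C : {set 'I_n} | (C \subset D) && (v0 \in C))
    (\sum_(G | connected_on C G) weight G) * \sum_(G | graph_within (D :\: C) G) weight G.
Proof.
move=> v0D.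
rewrite (partition_big component (fun C => (C \subset D) && (v0 \in C))) /=; last first.
  by move=> G /andP[_ within]; rewrite component_within ?mem_component.
by apply: eq_bigr => C /andP[CD v0C]; rewrite sum_component.
Qed.

End WeightedSums.
End GraphComponents.

Lemma pairs_prod1D_sorted (S : comPzSemiRingType) n (z : 'I_n -> 'I_n -> S) (s : seq 'I_n) :
  sorted (fun i j : 'I_n => (i < j)%N) s ->
  pairs_prod (fun i j => 1 + z i j) s =
  \sum_(G | graph_within (finset (fun i => i \in s)) G) \prod_(e in G) z e.1 e.2.
Proof.
move=> sorted_s; rewrite pairs_prod_sorted//.
pose E := enum [pred e : 'I_n * 'I_n | [&& e.1 \in s, e.2 \in s & (e.1 < e.2)%N]].
transitivity (\prod_(e <- E) (1 + z e.1 e.2)); first by rewrite big_enum.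
rewrite (@prod1D_subsets _ _ (fun e => z e.1 e.2)) ?enum_uniq//.
apply: eq_bigl => G; apply/fintype.subsetP/andP.
  move=> GE; split; apply/forall_inP => e /GE; rewrite !inE mem_enum inE.
    by case/and3P.
  by case/and3P => -> ->.
move=> [/forall_inP ordered /forall_inP within] e eG; rewrite inE mem_enum inE.
by have := within e eG; rewrite !inE => /andP[-> ->]; rewrite ordered.
Qed.

Section Relabelling.
Import mathcomp.boot.fintype mathcomp.boot.finset.
Variables (k n : nat) (g : 'I_k -> 'I_n).
Hypothesis g_mono : {mono g : i j / (i < j)%N}.
Implicit Types (G : {set 'I_k * 'I_k}) (H : {set 'I_n * 'I_n}).

Let g_inj : injective g.
Proof.
move=> i j gij; apply/val_inj; case: (ltngtP i j) => // ij; move: (ij);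
  by rewrite -g_mono gij ltnn.
Qed.

Definition relabel G := [set (g e.1, g e.2) | e in G].

Let edge_map_inj : injective (fun e : 'I_k * 'I_k => (g e.1, g e.2)).
Proof. by move=> [i j] [i' j'] /= [/g_inj -> /g_inj ->]. Qed.

Lemma mem_relabel G i j : ((g i, g j) \in relabel G) = ((i, j) \in G).
Proof. exact: (mem_imset _ (i, j) edge_map_inj). Qed.

Lemma relabelK G : [set e | (g e.1, g e.2) \in relabel G] = G.
Proof. by apply/setP => -[i j]; rewrite inE mem_relabel. Qed.

Lemma joined_relabel G i j : joined (relabel G) (g i) (g j) = joined G i j.
Proof.
have gadjE u v : gadj (relabel G) (g u) (g v) = gadj G u v.
  by rewrite /gadj !mem_relabel.
apply/idP/idP => [gij|].
  pose reached v := [exists u, (v == g u) && joined G i u].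
  have /existsP[u /andP[/eqP/g_inj -> //]] : reached (g j).
  apply: joined_invariant gij => [u v|]; last first.
    by apply/existsP; exists i; rewrite eqxx; exact: connect0.
  move=> /existsP[u' /andP[/eqP -> iu']] u'v.
  have [v' vE] : exists v', v = g v'.
    by move: u'v => /orP[/imsetP[e _ [_ ->]]|/imsetP[e _ [-> _]]]; eexists.
  apply/existsP; exists v'; rewrite vE eqxx /=; apply: joined_trans iu' _.
  by apply: connect1; rewrite -gadjE -vE.
apply: (@joined_invariant _ G (fun v => joined (relabel G) (g i) (g v))).
  by move=> u v iu uv; apply: joined_trans iu _; apply: connect1; rewrite gadjE.
exact: connect0.
Qed.

Lemma connected_on_relabel i0 G :
  connected_on (g i0) (g @: setT) (relabel G) = graph_on G && gconnected G.
Proof.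
apply/andP/andP.
  move=> [/andP[/forall_inP ordered _] /forall_inP conn]; split.
    apply/forall_inP => -[i j] ijG /=; rewrite -g_mono.
    by apply: (ordered (g i, g j)); rewrite mem_relabel.
  have i0j j : joined G i0 j by rewrite -joined_relabel conn// imset_f.
  apply/forallP => i; apply/forallP => j; apply: joined_trans (i0j j).
  by rewrite joined_sym.
move=> [/forall_inP ordered /forallP conn]; split.
  apply/andP; split; apply/forall_inP => _ /imsetP[e eG ->] /=.
    by rewrite g_mono; exact: ordered.
  by rewrite !imset_f.
apply/forall_inP => _ /imsetP[j _ ->]; rewrite joined_relabel.
exact: (forallP (conn i0)).
Qed.

Lemma sum_connected_relabel (S : comPzSemiRingType) (z : 'I_n -> 'I_n -> S) i0 :
  \sum_(G | graph_on G && gconnected G) \prod_(e in G) z (g e.1) (g e.2) =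
  \sum_(H | connected_on (g i0) (g @: setT) H) \prod_(e in H) z e.1 e.2.
Proof.
rewrite (reindex_onto relabel (fun H => [set e | (g e.1, g e.2) \in H])) /=.
  apply: eq_big => [G|G _]; first by rewrite relabelK eqxx andbT connected_on_relabel.
  by rewrite big_imset//= => e e' _ _; exact: edge_map_inj.
move=> H /andP[/andP[_ /forall_inP within] _]; apply/setP => -[u v]; apply/imsetP/idP.
  by move=> [e]; rewrite inE => eH ->.
move=> uvH; have /andP[/imsetP[i _ /= ui] /imsetP[j _ /= vj]] := within _ uvH.
by exists (i, j); rewrite ?inE/= -?ui -?vj.
Qed.

End Relabelling.

Section ConnectedSums.
Import mathcomp.boot.fintype mathcomp.boot.finset.
Variable S : comPzSemiRingType.

Lemma connected_sum_sorted n (T : Type) (x0 : T) (f : 'I_n -> T) (z : T -> T -> S)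
    (i : 'I_n) (s : seq 'I_n) :
  sorted (fun i j : 'I_n => (i < j)%N) (i :: s) ->
  connected_sum x0 z (map f (i :: s)) =
  \sum_(G | connected_on i [set j in i :: s] G) \prod_(e in G) z (f e.1) (f e.2).
Proof.
move=> sorted_s; set p := i :: s; rewrite /connected_sum.
have lt_tr : transitive (fun i j : 'I_n => (i < j)%N) by move=> u v w; exact: ltn_trans.
have lt_size (j : 'I_(size (map f p))) : (j < size p)%N.
  by apply: leq_trans (ltn_ord j) _; rewrite size_map.
pose g (j : 'I_(size (map f p))) := nth i p j.
have g_mono : {mono g : u v / (u < v)%N}.
  have g_lt (u v : 'I_(size (map f p))) : (u < v)%N -> (g u < g v)%N.
    by move=> uv; apply: (sorted_ltn_nth lt_tr i sorted_s); rewrite ?inE ?lt_size.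
  move=> u v; apply/idP/idP => [|/g_lt//]; case: (ltngtP u v) => // [/g_lt vu uv|/val_inj ->].
    by have := ltn_trans vu uv; rewrite ltnn.
  by rewrite ltnn.
have g_image : g @: setT = [set j in p].
  apply/setP => j; rewrite inE; apply/imsetP/idP => [[u _ ->]|jp].
    by rewrite mem_nth.
  have jsz : (index j p < size (map f p))%N by rewrite size_map index_mem.
  by exists (Ordinal jsz) => //; rewrite /g /= nth_index.
have sz_gt0 : (0 < size (map f p))%N by [].
rewrite -g_image.
rewrite -(sum_connected_relabel g_mono (fun u v => z (f u) (f v)) (Ordinal sz_gt0)).
apply: eq_bigr => G _; apply: eq_bigr => e _.
by rewrite !(nth_map i) ?lt_size.
Qed.

Let pairs_prod1D_split_sum_ord n (T : Type) (x0 : T) (f : 'I_n -> T) (z : T -> T -> S)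
    (i : 'I_n) (s : seq 'I_n) :
  sorted (fun i j : 'I_n => (i < j)%N) (i :: s) ->
  pairs_prod (fun x y => 1 + z x y) (map f (i :: s)) =
  split_sum (fun K L => connected_sum x0 z (f i :: K) *
                        pairs_prod (fun x y => 1 + z x y) L) (map f s).
Proof.
move=> sorted_is; have lt_tr : transitive (fun i j : 'I_n => (i < j)%N).
  by move=> u v w; exact: ltn_trans.
have i_lt : {in s, forall j : 'I_n, (i < j)%N}.
  by apply/allP; exact: order_path_min lt_tr sorted_is.
have sorted_s := path_sorted sorted_is.
have us : uniq s by apply: sorted_uniq sorted_s => // j; rewrite ltnn.
have i_notin : i \notin s by apply/negP => /i_lt; rewrite ltnn.
rewrite pairs_prod_map (pairs_prod1D_sorted (fun u v => z (f u) (f v)))//.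
rewrite set_cons (sum_graph_within _ (setU11 _ _)).
rewrite big_subset_setU1 ?inE// big1 ?add0r => [|C /andP[Cs iC]]; last first.
  by have := subsetP Cs i iC; rewrite inE (negbTE i_notin).
rewrite split_sum_map split_sum_setE//.
apply: eq_big => [K|K /andP[Ks _]]; first by rewrite setU11 andbT.
congr (_ * _).
  have sorted_iK : sorted (fun i j : 'I_n => (i < j)%N) (i :: [seq j <- s | j \in K]).
    rewrite /= path_min_sorted ?sorted_filter//.
    by apply/allP => j; rewrite mem_filter => /andP[_ /i_lt].
  rewrite -map_cons connected_sum_sorted//.
  apply: eq_bigl => G; congr (connected_on _ _ _); apply/setP => j.
  rewrite !inE mem_filter; case: eqVneq => //= _.
  by apply/idP/andP => [jK|[//]]; have := subsetP Ks j jK; rewrite inE.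
rewrite pairs_prod_map (pairs_prod1D_sorted (fun u v => z (f u) (f v))) ?sorted_filter//.
apply: eq_bigl => G.
congr (graph_within _ _); apply/setP => j; rewrite !inE mem_filter negb_or.
by case: eqVneq => [->|_] //=; rewrite (negbTE i_notin) andbF.
Qed.

(* Expanding the product into graphs, [x :: K] is the component of [x]. *)
Lemma pairs_prod1D_split_sum (T : Type) (x0 : T) (z : T -> T -> S) x J :
  pairs_prod (fun x y => 1 + z x y) (x :: J) =
  split_sum (fun K L => connected_sum x0 z (x :: K) *
                        pairs_prod (fun x y => 1 + z x y) L) J.
Proof.
pose f (i : 'I_(size (x :: J))) := nth x0 (x :: J) i.
have := map_nth_enum_ord x0 (x :: J); rewrite -/f enum_ordSl /=.
have := sorted_enum_ord (size (x :: J)); rewrite enum_ordSl.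
set s := map _ _ => sorted_s [JE].
have := pairs_prod1D_split_sum_ord x0 f z sorted_s.
by rewrite map_cons JE.
Qed.

End ConnectedSums.

Section ConnectedSumBound.
Import mathcomp.boot.fintype mathcomp.boot.finset.
Context {R : realType}.

Lemma prod_joined_le n (w : 'I_n -> 'I_n -> R) (B : 'I_n -> R) (Q : {set 'I_n * 'I_n}) :
  (forall i j, 0 <= w i j) ->
  (forall s, subseq s (enum 'I_n) -> pairs_prod w s <= \prod_(i <- s) B i) ->
  \prod_(e : 'I_n * 'I_n | (e.1 < e.2)%N && joined Q e.1 e.2) w e.1 e.2 <=
  \prod_(i : 'I_n) B i.
Proof.
move=> w0 stable; pose rt := fingraph.root (gadj Q).
have joinedE i j : joined Q i j = (rt i == rt j).
  by rewrite /joined /rt (fingraph.root_connect (sym_connect_sym (@gadj_sym _ Q))).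
rewrite (partition_big rt predT)//= (partition_big (fun e => rt e.1) predT)//=.
apply: ler_prod => r _; rewrite prodr_ge0//=.
pose s := [seq i <- enum 'I_n | rt i == r].
have mem_s i : (i \in s) = (rt i == r) by rewrite mem_filter mem_enum andbT.
have sorted_s : sorted (fun i j : 'I_n => (i < j)%N) s.
  by apply: sorted_filter (sorted_enum_ord n) => i j k; exact: ltn_trans.
have := stable s (filter_subseq _ _); rewrite pairs_prod_sorted//.
rewrite big_filter big_enum_cond; apply: le_trans.
rewrite le_eqVlt; apply/orP; left; apply/eqP/eq_bigl => e; rewrite !mem_s joinedE.
by case: (rt e.1 =P r) => [->|]; rewrite ?andbT ?andbF// eq_sym andbC.
Qed.

Lemma tree_rooted_forest n (G : {set 'I_n.+1 * 'I_n.+1}) :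
  [&& graph_on G, gconnected G & acyclic G] ->
  rooted_forest [:: ord0] (behead (enum 'I_n.+1)) G.
Proof.
move=> /and3P[ordered conn acyc].
have enumE : [:: ord0] ++ behead (enum 'I_n.+1) = enum 'I_n.+1 by rewrite enum_ordSl.
apply/and5P; split => //.
  by apply/forall_inP => e _; rewrite enumE !mem_enum.
by apply/allP => j _ /=; rewrite orbF; move/forallP: conn => /(_ j)/forallP/(_ ord0).
Qed.

Lemma connected_sum_le (T : eqType) (x0 : T) (z : T -> T -> R[i]) (t : T -> T -> R)
    (B : T -> R) x s m :
  (forall x y, t x y = t y x) -> (forall x y, 0 <= t x y) ->
  (forall x y, cmod (z x y) <= t x y * Num.max 1 (cmod (1 + z x y))) ->
  (forall s', subseq s' (x :: s) ->
     pairs_prod (fun x y => cmod (1 + z x y)) s' <= \prod_(y <- s') B y) ->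
  ((size s).+1 < m)%N ->
  cmod (connected_sum x0 z (x :: s)) <=
  (\prod_(y <- x :: s) B y) * forest_sum t m [:: x] s.
Proof.
move=> t_sym t_ge0 z_le stable szm.
pose f (i : 'I_(size (x :: s))) := nth x0 (x :: s) i.
have xsE : map f (enum 'I_(size (x :: s))) = x :: s by exact: map_nth_enum_ord.
have prodBE : \prod_(y <- x :: s) B y = \prod_i B (f i) by rewrite -[in LHS]xsE big_map big_enum.
have sE : map f (behead (enum 'I_(size (x :: s)))) = s by rewrite -behead_map xsE.
apply: le_trans (tree_graph_le (z := fun e => z (f e.1) (f e.2))
   (t := fun e => t (f e.1) (f e.2)) (M := \prod_(y <- x :: s) B y) _ _ _) _ => //.
  move=> Q; rewrite prodBE.
  apply: (prod_joined_le (w := fun i j => cmod (1 + z (f i) (f j)))) => [i j|s' sub].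
    exact: cmod_ge0.
  have sub_xs : subseq (map f s') (x :: s) by rewrite -[X in subseq _ X]xsE map_subseq.
  by have := stable _ sub_xs; rewrite pairs_prod_map big_map.
apply: ler_wpM2l.
  by apply: le_trans (stable _ (subseq_refl _)); apply: pairs_prod_ge0 => *; exact: cmod_ge0.
have -> : forest_sum t m [:: x] s =
    forest_sum (fun i j => t (f i) (f j)) m [:: ord0] (behead (enum 'I_(size (x :: s)))).
  by rewrite -(forest_sum_map f t) sE.
apply: le_trans (sum_rooted_forest_le _ _ _ _) => //.
- rewrite [leLHS]big_mkcond [leRHS]big_mkcond; apply: ler_sum => G _.
  case: ifP => [/tree_rooted_forest ->//|_].
  by case: ifP => // _; apply: prodr_ge0.
- by have := enum_uniq 'I_(size (x :: s)); rewrite enum_ordSl.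
- by rewrite enum_ordSl /= size_map size_enum_ord.
Qed.

End ConnectedSumBound.

(** * Measurability on finite sequences *)

Definition seq_display : measure_display -> measure_display.
Proof. exact. Qed.

Section JointComposition.
Context {dU dS dT dV dY} {U : measurableType dU} {S : measurableType dS}
  {T : measurableType dT} {V : measurableType dV} {Y : measurableType dY}.

Lemma measurable_comp2 (F : S -> T -> Y) (f : U -> S) (g : U -> T) :
  measurable_fun setT (fun p : S * T => F p.1 p.2) ->
  measurable_fun setT f -> measurable_fun setT g ->
  measurable_fun setT (fun u => F (f u) (g u)).
Proof. by move=> mF mf mg; exact: (measurableT_comp mF (measurable_fun_pair mf mg)). Qed.

Lemma measurable_comp3 (F : S -> T -> V -> Y) (f : U -> S) (g : U -> T) (h : U -> V) :
  measurable_fun setT (fun p : S * (T * V) => F p.1 p.2.1 p.2.2) ->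
  measurable_fun setT f -> measurable_fun setT g -> measurable_fun setT h ->
  measurable_fun setT (fun u => F (f u) (g u) (h u)).
Proof.
move=> mF mf mg mh.
exact: (measurableT_comp mF (measurable_fun_pair mf (measurable_fun_pair mg mh))).
Qed.

End JointComposition.

HB.instance Definition _ (T : choiceType) := isPointed.Build (seq T) [::].

Section MeasurableSeq.
Context {d : measure_display} {X : measurableType d}.

Definition seq_generator : set (set (seq X)) :=
  preimage_set_system setT size measurable `|`
  \bigcup_i preimage_set_system setT (fun s => nth point s i) measurable.

HB.instance Definition _ := @isMeasurable.Build (seq_display d) (seq X)
  <<s seq_generator >> (@sigma_algebra0 _ setT seq_generator)
  (@sigma_algebraC (seq X) seq_generator) (@sigma_algebra_bigcup _ setT seq_generator).

Lemma measurable_size : measurable_fun setT (@size X).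
Proof. by move=> _ A mA; apply: sub_sigma_algebra; left; exists A. Qed.

Lemma measurable_nth i : measurable_fun setT (fun s : seq X => nth point s i).
Proof. by move=> _ A mA; apply: sub_sigma_algebra; right; exists i => //; exists A. Qed.

Section IntoSeq.
Context {dS} {S : measurableType dS}.

Lemma measurable_fun_seqP (f : S -> seq X) :
  measurable_fun setT f <->
  measurable_fun setT (fun s => size (f s)) /\
  (forall i, measurable_fun setT (fun s => nth point (f s) i)).
Proof.
split=> [mf|[msize mnth]].
  split=> [|i]; first exact: (measurableT_comp measurable_size mf).
  exact: (measurableT_comp (measurable_nth i) mf).
apply: (measurability seq_generator) => // _ [_ [[A mA <-]|[i _ [A mA <-]]] <-].
  by rewrite setTI; have := msize measurableT A mA; rewrite !setTI.
by rewrite setTI; have := mnth i measurableT A mA; rewrite !setTI.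
Qed.

Lemma measurable_fun_cons (x : S -> X) (f : S -> seq X) :
  measurable_fun setT x -> measurable_fun setT f -> measurable_fun setT (fun s => x s :: f s).
Proof.
move=> mx /measurable_fun_seqP[fsize fnth]; apply/measurable_fun_seqP; split.
  exact: (measurableT_comp (f := fun n => n.+1) _ fsize).
by case.
Qed.

Lemma measurable_fun_behead (f : S -> seq X) :
  measurable_fun setT f -> measurable_fun setT (fun s => behead (f s)).
Proof.
move=> /measurable_fun_seqP[fsize fnth]; apply/measurable_fun_seqP; split.
  by under eq_fun do rewrite size_behead; exact: (measurableT_comp (f := predn) _ fsize).
by move=> i; under eq_fun do rewrite nth_behead; exact: fnth.
Qed.

End IntoSeq.

Lemma measurable_fun_nat_param {dS dY} {S : measurableType dS} {Y : measurableType dY}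
    (N : S -> nat) (F : nat -> S -> Y) :
  measurable_fun setT N -> (forall n, measurable_fun setT (F n)) ->
  measurable_fun setT (fun s => F (N s) s).
Proof.
move=> mN mF _ A mA; rewrite setTI.
have -> : (fun s => F (N s) s) @^-1` A =
    \bigcup_n ((setT `&` N @^-1` [set n]) `&` (setT `&` F n @^-1` A)).
  apply/seteqP; split => [s As|s [n _ [[_ <-] [_ //]]]].
  by exists (N s) => //; rewrite !setTI.
by apply: bigcup_measurable => n _; apply: measurableI; [exact: mN|exact: mF].
Qed.

Section JointlyMeasurable.
Context {dS} {S : measurableType dS}.

Lemma measurable_fun_cat (f g : S -> seq X) :
  measurable_fun setT f -> measurable_fun setT g ->
  measurable_fun setT (fun s => f s ++ g s).
Proof.
move=> /measurable_fun_seqP[fsize fnth] /measurable_fun_seqP[gsize gnth].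
apply/measurable_fun_seqP; split.
  under eq_fun do rewrite size_cat.
  exact: measurable_fun_addn.
move=> i; under eq_fun do rewrite nth_cat.
apply: (@measurable_fun_nat_param _ _ _ _ (fun s => size (f s))
  (fun n s => if (i < n)%N then nth point (f s) i else nth point (g s) (i - n))) => // n.
by case: (i < n)%N; [exact: fnth|exact: gnth].
Qed.

Lemma measurable_fun_seq_param {dY} {Y : measurableType dY} (F : S -> seq X -> Y) :
  (forall n, measurable_fun setT
     (fun p : S * seq X => F p.1 (mkseq (nth point p.2) n))) ->
  measurable_fun setT (fun p : S * seq X => F p.1 p.2).
Proof.
move=> mF; rewrite (_ : (fun _ => _) =
    (fun p : S * seq X => F p.1 (mkseq (nth point p.2) (size p.2)))).
  exact: (measurable_fun_nat_param (measurableT_comp measurable_size measurable_snd) mF).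
by apply/funext => -[s J] /=; rewrite mkseq_nth.
Qed.

Lemma measurable_nth_snd i : measurable_fun setT (fun p : S * seq X => nth point p.2 i).
Proof. exact: (measurableT_comp (measurable_nth i) measurable_snd). Qed.

End JointlyMeasurable.

Section SplitSums.
Context {R : realType}.

Let measurable_split_sum_map {dS} {S : measurableType dS}
    (A : S -> seq X -> seq X -> R) (x : nat -> S -> X) (r : seq nat) :
  measurable_fun setT (fun p : S * (seq X * seq X) => A p.1 p.2.1 p.2.2) ->
  (forall i, measurable_fun setT (x i)) ->
  measurable_fun setT (fun s => split_sum (A s) [seq x i s | i <- r]).
Proof.
move=> + mx; elim: r A => [|i r IHr] A mA /=.
  by apply: (measurable_comp3 mA) => //; exact: measurable_cst.
have mx1 : measurable_fun setT (fun p : S * (seq X * seq X) => x i p.1).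
  exact: measurableT_comp (mx i) measurable_fst.
have mK : measurable_fun setT (fun p : S * (seq X * seq X) => p.2.1).
  exact: measurableT_comp measurable_fst measurable_snd.
have mL : measurable_fun setT (fun p : S * (seq X * seq X) => p.2.2).
  exact: measurableT_comp measurable_snd measurable_snd.
by apply: measurable_funD; apply: IHr; apply: (measurable_comp3 mA) => //;
  exact: measurable_fun_cons.
Qed.

Lemma measurable_split_sum_param {dS} {S : measurableType dS} (A : S -> seq X -> seq X -> R) :
  measurable_fun setT (fun p : S * (seq X * seq X) => A p.1 p.2.1 p.2.2) ->
  measurable_fun setT (fun p : S * seq X => split_sum (A p.1) p.2).
Proof.
move=> mA; apply: (measurable_fun_seq_param (F := fun s J => split_sum (A s) J)) => n.
apply: (@measurable_split_sum_map _ _ (fun p => A p.1) (fun i p => nth point p.2 i));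
  last exact: measurable_nth_snd.
apply: (measurable_comp3 mA) => //; last 2 first.
- exact: measurableT_comp measurable_fst measurable_snd.
- exact: measurableT_comp measurable_snd measurable_snd.
exact: measurableT_comp measurable_fst measurable_fst.
Qed.

Lemma measurable_split_sum (A : seq X -> seq X -> R) :
  measurable_fun setT (fun p : seq X * seq X => A p.1 p.2) ->
  measurable_fun setT (split_sum A).
Proof.
move=> mA; have mA' : measurable_fun setT (fun p : unit * (seq X * seq X) => A p.2.1 p.2.2).
  exact: measurableT_comp mA measurable_snd.
exact: (measurableT_comp (measurable_split_sum_param (A := fun=> A) mA')
  (pair1_measurable tt)).
Qed.

Lemma measurable_prod_seq_param {dS} {S : measurableType dS} (f : S -> X -> R) :
  measurable_fun setT (fun p : S * X => f p.1 p.2) ->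
  measurable_fun setT (fun p : S * seq X => \prod_(x <- p.2) f p.1 x).
Proof.
move=> mf; apply: (measurable_fun_seq_param (F := fun s J => \prod_(x <- J) f s x)) => n.
under eq_fun do rewrite big_map; apply: measurable_prod => i _.
by apply: (measurable_comp2 mf) => //; exact: measurable_nth_snd.
Qed.

Lemma measurable_prod_seq (f : X -> R) : measurable_fun setT f ->
  measurable_fun setT (fun s : seq X => \prod_(x <- s) f x).
Proof.
move=> mf.
have mf' : measurable_fun setT (fun p : unit * X => f p.2).
  exact: measurableT_comp mf measurable_snd.
exact: (measurableT_comp (measurable_prod_seq_param (f := fun=> f) mf') (pair1_measurable tt)).
Qed.

Lemma measurable_forest_sum (t : X -> X -> R) m :
  measurable_fun setT (fun p : X * X => t p.1 p.2) ->
  measurable_fun setT (fun p : seq X * seq X => forest_sum t m p.1 p.2).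
Proof.
move=> mt; elim: m => [|m IHm] /=; first exact: measurable_cst.
pose A I K L :=
  (\prod_(k <- K) t (nth point I 0) k) * forest_sum t m (behead I ++ K) L.
rewrite (_ : (fun _ => _) = (fun p : seq X * seq X =>
    if size p.1 == 0%N then (size p.2 == 0)%:R else split_sum (A p.1) p.2)); last first.
  by apply/funext => -[[|i I] J].
have msize (f : seq X * seq X -> seq X) : measurable_fun setT f ->
    measurable_fun setT (fun p => size (f p) == 0%N).
  move=> mf; apply: measurable_fun_eqn; last exact: measurable_cst.
  exact: measurableT_comp measurable_size mf.
apply: measurable_fun_ifT; first exact: msize.
  apply: (measurableT_comp (f := fun b : bool => b%:R : R)) => //; exact: msize.
have mI : measurable_fun setT (fun p : seq X * (seq X * seq X) => p.1) := measurable_fst.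
have mK : measurable_fun setT (fun p : seq X * (seq X * seq X) => p.2.1).
  exact: measurableT_comp measurable_fst measurable_snd.
have mL : measurable_fun setT (fun p : seq X * (seq X * seq X) => p.2.2).
  exact: measurableT_comp measurable_snd measurable_snd.
apply: measurable_split_sum_param; apply: measurable_funM.
  have mroot := measurableT_comp (measurable_nth 0) mI.
  exact: (measurable_comp2 (F := fun s K => \prod_(k <- K) t s k) (measurable_prod_seq_param mt)
    mroot mK).
apply: (measurable_comp2 IHm) => //.
by apply: measurable_fun_cat => //; exact: measurable_fun_behead.
Qed.

End SplitSums.
End MeasurableSeq.

Section ComplexMeasurability.
Context {R : realType} {dT : measure_display} {T : measurableType dT}.
Implicit Types f g : T -> R[i].

Definition cmeasurable f :=
  measurable_fun setT (fun x => cRe (f x)) /\ measurable_fun setT (fun x => cIm (f x)).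

Lemma cmeasurable_cst (z : R[i]) : cmeasurable (fun=> z).
Proof. by split; exact: measurable_cst. Qed.

Lemma cmeasurableD f g :
  cmeasurable f -> cmeasurable g -> cmeasurable (fun x => f x + g x).
Proof.
move=> [fr fi] [gr gi]; split.
  by under eq_fun do rewrite cReD; exact: measurable_funD.
by under eq_fun do rewrite cImD; exact: measurable_funD.
Qed.

Lemma cmeasurableM f g :
  cmeasurable f -> cmeasurable g -> cmeasurable (fun x => f x * g x).
Proof.
move=> [fr fi] [gr gi]; split.
  by under eq_fun do rewrite cReM; apply: measurable_funB; exact: measurable_funM.
by under eq_fun do rewrite cImM; apply: measurable_funD; exact: measurable_funM.
Qed.

Lemma cmeasurable_sum (I : Type) (r : seq I) (P : pred I) (f : I -> T -> R[i]) :
  (forall i, cmeasurable (f i)) -> cmeasurable (fun x => \sum_(i <- r | P i) f i x).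
Proof.
move=> mf; elim: r => [|i r IHr].
  by under eq_fun do rewrite big_nil; exact: cmeasurable_cst.
under eq_fun do rewrite big_cons; case: (P i) => //; exact: cmeasurableD.
Qed.

Lemma cmeasurable_prod (I : Type) (r : seq I) (P : pred I) (f : I -> T -> R[i]) :
  (forall i, cmeasurable (f i)) -> cmeasurable (fun x => \prod_(i <- r | P i) f i x).
Proof.
move=> mf; elim: r => [|i r IHr].
  by under eq_fun do rewrite big_nil; exact: cmeasurable_cst.
under eq_fun do rewrite big_cons; case: (P i) => //; exact: cmeasurableM.
Qed.

Lemma measurable_cmod f : cmeasurable f -> measurable_fun setT (fun x => cmod (f x)).
Proof.
move=> [fr fi]; apply: measurableT_comp.
  by apply: continuous_measurable_fun; exact: sqrt_continuous.
by apply: measurable_funD; exact: measurable_funX.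
Qed.

Lemma measurable_ecmod f :
  cmeasurable f -> measurable_fun setT (fun x => (cmod (f x))%:E).
Proof. by move=> mf; apply/measurable_EFinP; exact: measurable_cmod. Qed.

Lemma cmeasurable_ifT (P : T -> bool) f g : measurable_fun setT P ->
  cmeasurable f -> cmeasurable g -> cmeasurable (fun x => if P x then f x else g x).
Proof.
move=> mP [fr fi] [gr gi]; split.
  by under eq_fun do rewrite (fun_if (@cRe R)); exact: measurable_fun_ifT.
by under eq_fun do rewrite (fun_if (@cIm R)); exact: measurable_fun_ifT.
Qed.

Lemma cmeasurable_cexp f : cmeasurable f -> cmeasurable (fun x => cexp (f x)).
Proof.
move=> [fr fi]; split.
  under eq_fun do rewrite cRe_cexp; apply: measurable_funM; first exact: measurableT_comp.
  by apply: measurableT_comp fi; apply: continuous_measurable_fun; exact: continuous_cos.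
under eq_fun do rewrite cIm_cexp; apply: measurable_funM; first exact: measurableT_comp.
by apply: measurableT_comp fi; apply: continuous_measurable_fun; exact: continuous_sin.
Qed.

End ComplexMeasurability.

Lemma cmeasurable_comp {R : realType} {dT dS : measure_display} {T : measurableType dT}
    {S : measurableType dS} (f : T -> R[i]) (g : S -> T) :
  cmeasurable f -> measurable_fun setT g -> cmeasurable (fun s => f (g s)).
Proof.
by move=> [fr fi] mg; split; [exact: measurableT_comp fr mg|exact: measurableT_comp fi mg].
Qed.

Section GraphSumMeasurability.
Context {R : realType} {d : measure_display} {X : measurableType d}.
Variable z : X -> X -> R[i].
Hypothesis mz : cmeasurable (fun p : X * X => z p.1 p.2).

Let cmeasurable_size (F : seq X -> R[i]) (G : nat -> seq X -> R[i]) :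
  (forall n, cmeasurable (G n)) -> (forall s, F s = G (size s) s) -> cmeasurable F.
Proof.
move=> mG FG; rewrite (_ : F = fun s => G (size s) s); last exact/funext.
split.
  exact: (measurable_fun_nat_param (F := fun n s => cRe (G n s)) measurable_size
    (fun n => (mG n).1)).
exact: (measurable_fun_nat_param (F := fun n s => cIm (G n s)) measurable_size
  (fun n => (mG n).2)).
Qed.

Let cmeasurable_pair_nth i j :
  cmeasurable (fun s : seq X => z (nth point s i) (nth point s j)).
Proof.
exact: (cmeasurable_comp mz (measurable_fun_pair (measurable_nth i) (measurable_nth j))).
Qed.

Lemma cmeasurable_connected_sum : cmeasurable (connected_sum point z).
Proof.
apply: (cmeasurable_size (G := fun n s =>
  \sum_(G : {set 'I_n * 'I_n} | graph_on G && gconnected G)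
    \prod_(e in G) z (nth point s e.1) (nth point s e.2))) => // n.
by apply: cmeasurable_sum => G; apply: cmeasurable_prod => e; exact: cmeasurable_pair_nth.
Qed.

Lemma cmeasurable_pairs_prod1D : cmeasurable (pairs_prod (fun x y => 1 + z x y)).
Proof.
apply: (cmeasurable_size (G := fun n s => \prod_(i < n) \prod_(j < n | (i < j)%N)
    (1 + z (nth point s i) (nth point s j)))) => [n|s]; last first.
  exact/esym/(pairs_prodE (fun x y => 1 + z x y)).
do 2 (apply: cmeasurable_prod => ?).
by apply: cmeasurableD; [exact: cmeasurable_cst|exact: cmeasurable_pair_nth].
Qed.

End GraphSumMeasurability.

(** * Iterated integrals *)

Section BinomialSums.
Variable V : nmodType.
Implicit Types a : nat -> nat -> V.

Definition binomial_sum a n : V := \sum_(k < n.+1) a k (n - k)%N *+ 'C(n, k).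

Lemma binomial_sum0 a : binomial_sum a 0 = a 0%N 0%N.
Proof. by rewrite /binomial_sum big_ord_recl big_ord0 /= addr0 mulr1n. Qed.

Lemma eq_binomial_sum a1 a2 n :
  (forall k l, a1 k l = a2 k l) -> binomial_sum a1 n = binomial_sum a2 n.
Proof. by move=> a12; apply: eq_bigr => k _; rewrite a12. Qed.

Lemma binomial_sumS a n :
  binomial_sum (fun k l => a k.+1 l) n + binomial_sum (fun k l => a k l.+1) n =
  binomial_sum a n.+1.
Proof.
rewrite /binomial_sum [RHS]big_ord_recl /= bin0 subn0.
under [X in _ = _ + X]eq_bigr => k _ do rewrite /bump /= add1n subSS binS mulrnDr.
rewrite big_split /= [RHS]addrA [RHS]addrC; congr (_ + _).
rewrite [X in _ = _ + X]big_ord_recr /= bin_small// mulr0n addr0.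
rewrite big_ord_recl /= bin0 subn0; congr (_ + _).
by apply: eq_bigr => k _; rewrite /bump /= add1n subnSK.
Qed.

End BinomialSums.

Lemma invr_fact_mul_bin (F : numFieldType) n k : (k <= n)%N ->
  n`!%:R^-1 * 'C(n, k)%:R = k`!%:R^-1 * (n - k)`!%:R^-1 :> F.
Proof.
move=> kn; rewrite -(bin_fact kn) !natrM; field.
by rewrite !pnatr_eq0 -!lt0n !fact_gt0 bin_gt0 kn.
Qed.

Lemma sum_triangle (V : nmodType) (f : nat -> nat -> V) M :
  \sum_(j < M) \sum_(k < j.+1) f k (j - k)%N = \sum_(k < M) \sum_(l < M - k) f k l.
Proof.
elim: M => [|M IHM]; first by rewrite !big_ord0.
rewrite big_ord_recr /= IHM [RHS]big_ord_recr [X in _ + X]big_ord_recr /=.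
rewrite subSnn big_ord1 subnn addrA -big_split /=; congr (_ + _).
by apply: eq_bigr => k _; rewrite subSn ?big_ord_recr//= ltnW.
Qed.

Section ERealSums.
Context {R : realType}.
Local Open Scope ereal_scope.

Lemma mulrn_EFin (x : \bar R) n : (x *+ n)%R = n%:R%:E * x.
Proof.
case: n => [|n]; first by rewrite mulr0n mul0e.
by rewrite mule_natl; elim: n => [|n IHn]; rewrite ?mulr1n// mulrS IHn.
Qed.

Lemma sum_triangle_lee (f : nat -> nat -> \bar R) M : (forall k l, 0 <= f k l) ->
  \sum_(j < M) \sum_(k < j.+1) f k (j - k)%N <= \sum_(k < M) \sum_(l < M) f k l.
Proof.
move=> f0; rewrite sum_triangle; apply: lee_sum => k _.
rewrite (big_ord_widen M (fun l => f k l) (leq_subr k M)) big_mkcond.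
by apply: lee_sum => l _; case: ifP.
Qed.

End ERealSums.

Lemma exp_partial_sum_le {R : realType} (x : R) M : 0 <= x ->
  \sum_(k < M) k`!%:R^-1 * x ^+ k <= expR x.
Proof.
move=> x0.
have -> : \sum_(k < M) k`!%:R^-1 * x ^+ k = series (exp_coeff x) M.
  by rewrite seriesEord; apply: eq_bigr => k _; exact: mulrC.
apply: nondecreasing_cvgn_le (is_cvg_series_exp_coeff x) M.
by apply: nondecreasing_series => k _ _; exact: exp_coeff_ge0.
Qed.

Section IteratedIntegral.
Context {R : realType} {d : measure_display} {X : measurableType d}.
Variable nu : {finite_measure set X -> \bar R}.
Local Open Scope ereal_scope.
Implicit Types (F G : seq X -> \bar R) (P Q : seq X -> Prop).

Lemma iabs_ge0 n F : (forall s, 0 <= F s) -> 0 <= iabs nu n F.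
Proof. by elim: n F => //= n IHn F F0; apply: integral_ge0 => x _; exact: IHn. Qed.

Lemma eq_iabs n F G :
  (forall s, size s = n -> F s = G s) -> iabs nu n F = iabs nu n G.
Proof.
elim: n F G => [|n IHn] F G FG /=; first exact: FG.
by apply: eq_integral => x _; apply: IHn => s sn; rewrite FG//= sn.
Qed.

Lemma measurable_iabs {dS} {S : measurableType dS} (A : S -> seq X -> \bar R) n :
  (forall s J, 0 <= A s J) ->
  measurable_fun setT (fun p : S * seq X => A p.1 p.2) ->
  measurable_fun setT (fun s => iabs nu n (A s)).
Proof.
elim: n dS S A => [|n IHn] dS S A A0 mA /=.
  by apply: (measurable_comp2 mA) => //; exact: measurable_cst.
apply: (@measurable_fun_fubini_tonelli_F _ _ _ _ _ nu
  (fun p : S * X => iabs nu n (fun J => A p.1 (p.2 :: J)))) => [|p].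
  apply: (IHn _ _ (fun p : S * X => fun J => A p.1 (p.2 :: J))) => //.
  apply: (measurable_comp2 mA); first exact: measurableT_comp measurable_fst measurable_fst.
  apply: measurable_fun_cons => //.
  exact: measurableT_comp measurable_snd measurable_fst.
exact: iabs_ge0.
Qed.

Lemma measurable_fun_consl {dY} {Y : measurableType dY} (F : seq X -> Y) :
  measurable_fun setT F -> measurable_fun setT (fun p : X * seq X => F (p.1 :: p.2)).
Proof. by move=> mF; apply: (measurableT_comp mF); exact: measurable_fun_cons. Qed.

Lemma measurable_fun_cons1 {dY} {Y : measurableType dY} (F : seq X -> Y) x :
  measurable_fun setT F -> measurable_fun setT (fun s => F (x :: s)).
Proof. by move=> mF; apply: (measurableT_comp mF); exact: measurable_fun_cons. Qed.

Lemma measurable_iabs_cons n F : (forall s, 0 <= F s) -> measurable_fun setT F ->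
  measurable_fun setT (fun x => iabs nu n (fun s => F (x :: s))).
Proof.
move=> F0 mF; apply: (measurable_iabs (A := fun x s => F (x :: s))) => //.
exact: measurable_fun_consl.
Qed.

Lemma iabsD n F G : (forall s, 0 <= F s) -> (forall s, 0 <= G s) ->
  measurable_fun setT F -> measurable_fun setT G ->
  iabs nu n (fun s => F s + G s) = iabs nu n F + iabs nu n G.
Proof.
elim: n F G => [|n IHn] F G F0 G0 mF mG //=.
rewrite -ge0_integralD//; try (by move=> x _; exact: iabs_ge0);
  try exact: measurable_iabs_cons.
by apply: eq_integral => x _; apply: IHn => //; exact: measurable_fun_cons1.
Qed.

Lemma iabsZl n F (k : \bar R) : (forall s, 0 <= F s) -> 0 <= k ->
  measurable_fun setT F -> iabs nu n (fun s => k * F s) = k * iabs nu n F.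
Proof.
move=> + k0; elim: n F => [|n IHn] F F0 mF //=.
rewrite -ge0_integralZl//; last by move=> x _; exact: iabs_ge0.
  by apply: eq_integral => x _; apply: IHn => //; exact: measurable_fun_cons1.
exact: measurable_iabs_cons.
Qed.

Lemma iabs0 n : iabs nu n (fun=> 0) = 0.
Proof. by elim: n => //= n IHn; rewrite IHn integral0. Qed.

Lemma iabs_sum n (I : Type) (r : seq I) (F : I -> seq X -> \bar R) :
  (forall i s, 0 <= F i s) -> (forall i, measurable_fun setT (F i)) ->
  iabs nu n (fun s => \sum_(i <- r) F i s) = \sum_(i <- r) iabs nu n (F i).
Proof.
move=> F0 mF; elim: r => [|i r IHr].
  by rewrite big_nil -[RHS](iabs0 n); apply: eq_iabs => s _; rewrite big_nil.
rewrite big_cons -IHr -iabsD//.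
- by apply: eq_iabs => s _; rewrite big_cons.
- by move=> s; exact: sume_ge0.
- exact: emeasurable_sum.
Qed.

Lemma iabs_integral (A : X -> seq X -> \bar R) n : (forall x s, 0 <= A x s) ->
  measurable_fun setT (fun p : X * seq X => A p.1 p.2) ->
  iabs nu n (fun s => \int[nu]_x A x s) = \int[nu]_x iabs nu n (A x).
Proof.
elim: n A => [//|n IHn] A A0 mA /=.
have mAxy : measurable_fun setT (fun p : X * X * seq X => A p.1.2 (p.1.1 :: p.2)).
  apply: (measurable_comp2 mA); first exact: measurableT_comp measurable_snd measurable_fst.
  by apply: measurable_fun_cons => //; exact: measurableT_comp measurable_fst measurable_fst.
transitivity (\int[nu]_y \int[nu]_x iabs nu n (fun s => A x (y :: s))).
  apply: eq_integral => y _; apply: (IHn (fun x s => A x (y :: s))) => //.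
  by apply: (measurable_comp2 mA) => //; exact: measurable_fun_cons.
rewrite (@fubini_tonelli _ _ _ _ _ nu nu
  (fun yx : X * X => iabs nu n (fun s => A yx.2 (yx.1 :: s))))//.
  exact: (measurable_iabs (A := fun yx s => A yx.2 (yx.1 :: s))).
by move=> yx; exact: iabs_ge0.
Qed.

Lemma iabs_prod_le (g : X -> R) (c : R) n : (forall x, (0 <= g x)%R) ->
  measurable_fun setT g -> \int[nu]_x (g x)%:E <= c%:E ->
  iabs nu n (fun s => (\prod_(x <- s) g x)%:E) <= (c ^+ n)%:E.
Proof.
move=> g0 mg gc; elim: n => [|n IHn] /=; first by rewrite big_nil.
have prod0 s : 0 <= (\prod_(x <- s) g x)%:E by rewrite lee_fin prodr_ge0.
have mprod : measurable_fun setT (fun s : seq X => (\prod_(x <- s) g x)%:E).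
  by apply/measurable_EFinP; exact: measurable_prod_seq.
rewrite (eq_integral (fun x => (g x)%:E * iabs nu n (fun s => (\prod_(x <- s) g x)%:E)));
  last first.
  move=> x _; rewrite -iabsZl ?lee_fin//; apply: eq_iabs => s _.
  by rewrite big_cons EFinM.
rewrite ge0_integralZr//.
- by rewrite exprS EFinM lee_pmul ?iabs_ge0// integral_ge0// => x _; rewrite lee_fin.
- exact/measurable_EFinP.
- by move=> x _; rewrite lee_fin.
- exact: iabs_ge0.
Qed.

Fixpoint iterated_ae (n : nat) P : Prop :=
  if n is n'.+1 then {ae nu, forall x, iterated_ae n' (fun s => P (x :: s))} else P [::].

Lemma iterated_aeS n P Q : (forall s, size s = n -> P s -> Q s) ->
  iterated_ae n P -> iterated_ae n Q.
Proof.
elim: n P Q => [|n IHn] P Q PQ /=; first exact: PQ.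
by apply: filterS => x; apply: IHn => s sn; apply: PQ; rewrite /= sn.
Qed.

Lemma iterated_aeW n P : (forall s, P s) -> iterated_ae n P.
Proof. by elim: n P => [|n IHn] P HP //=; apply: aeW => x; exact: IHn. Qed.

Lemma iterated_ae_forall (I : finType) n (P : I -> seq X -> Prop) :
  (forall i, iterated_ae n (P i)) -> iterated_ae n (fun s => forall i, P i s).
Proof.
elim: n P => [|n IHn] P HP //=.
suff : {ae nu, forall x, forall i, iterated_ae n (fun s => P i (x :: s))}.
  by apply: filterS => x; exact: IHn.
exact: (@filter_forall _ I (fun i x => iterated_ae n (fun s => P i (x :: s)))
  (almost_everywhere nu) (ae_filter_ringOfSetsType nu) HP).
Qed.

Lemma iterated_ae_mask (m : bitseq) P :
  iterated_ae (count id m) P -> iterated_ae (size m) (fun s => P (mask m s)).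
Proof.
elim: m P => [|[] m IHm] P //=.
- by apply: filterS => x; exact: IHm.
- by move=> HP; apply: aeW => x; exact: IHm.
Qed.

Lemma iterated_ae_subseq P n : (forall k, iterated_ae k P) ->
  iterated_ae n (fun s => forall s', subseq s' s -> P s').
Proof.
move=> HP; have : iterated_ae n (fun s => forall m : n.-tuple bool, P (mask m s)).
  by apply: iterated_ae_forall => m; have := iterated_ae_mask (HP (count id m));
    rewrite size_tuple.
apply: iterated_aeS => s sn Pmask s' /subseqP[m sm ->].
have szm : size m == n by rewrite sm sn.
exact: (Pmask (Tuple szm)).
Qed.

Lemma iterated_ae_all (p : X -> Prop) n : {ae nu, forall x, p x} ->
  iterated_ae n (fun s => forall x, x \in s -> p x).
Proof.
move=> aep; elim: n => [|n IHn] //=; move: aep; apply: filterS => x px.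
by apply: iterated_aeS IHn => s _ ps y; rewrite inE => /orP[/eqP ->|/ps].
Qed.

Lemma le_iabs n F G : (forall s, 0 <= F s) -> (forall s, 0 <= G s) ->
  measurable_fun setT F -> measurable_fun setT G ->
  iterated_ae n (fun s => F s <= G s) -> iabs nu n F <= iabs nu n G.
Proof.
elim: n F G => [|n IHn] F G F0 G0 mF mG FG //=.
apply: ae_ge0_le_integral => //; try (by move=> x _; exact: iabs_ge0);
  try exact: measurable_iabs_cons.
move: FG => /=; apply: filterS => x FGx _; apply: IHn => //; exact: measurable_fun_cons1.
Qed.

Lemma iabs_eq0 n F : (forall s, 0 <= F s) -> measurable_fun setT F ->
  iabs nu n F = 0 -> iterated_ae n (fun s => F s = 0).
Proof.
elim: n F => [|n IHn] F F0 mF //= intF.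
have mI := measurable_iabs_cons n F0 mF.
have intF_abs : \int[nu]_x `|iabs nu n (fun s => F (x :: s))| = 0.
  by rewrite -[RHS]intF; apply: eq_integral => x _; rewrite gee0_abs ?iabs_ge0.
have := ae_eq_integral_abs nu measurableT mI; move=> /iffLR/(_ intF_abs).
by apply: filterS => x /(_ I) /= Ix; apply: IHn => //; exact: measurable_fun_cons1.
Qed.

Lemma prod_ae_iterated_ae n (p : seq X -> bool) : measurable_fun setT p ->
  prod_ae nu n (fun s => p s) -> iterated_ae n (fun s => p s).
Proof.
rewrite /prod_ae => mp; rewrite (@eq_iabs _ _ (fun s => (~~ p s)%:R%:E)); last first.
  move=> s _; rewrite indicE; suff -> : (s \in [set s' | ~ p s']) = ~~ p s by [].
  by apply/idP/idP => [/set_mem/negP//|/negP ps]; exact: mem_set.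
move=> /iabs_eq0 p0; apply: iterated_aeS (p0 _ _) => [s _ [/eqP]|s|].
- by case: (p s) => //=; rewrite oner_eq0.
- by rewrite lee_fin.
- apply/measurable_EFinP.
  by apply: (measurableT_comp (f := fun b : bool => (~~ b)%:R : R)).
Qed.

End IteratedIntegral.

Section PoissonIntegral.
Context {R : realType} {d : measure_display} {X : measurableType d}.
Variable nu : {finite_measure set X -> \bar R}.
Local Open Scope ereal_scope.
Implicit Types F G : seq X -> \bar R.

Let mule_natr_ge0 (x : \bar R) n : 0 <= x -> 0 <= (x *+ n)%R.
Proof. by move=> x0; rewrite mulrn_EFin mule_ge0. Qed.

Let measurable_mulrn {dT} {T : measurableType dT} (f : T -> \bar R) n :
  measurable_fun setT f -> measurable_fun setT (fun x => (f x *+ n)%R).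
Proof. by move=> mf; under eq_fun do rewrite mulrn_EFin; exact: measurable_funeM. Qed.

Lemma measurable_binomial_sum (a : nat -> nat -> X -> \bar R) n :
  (forall k l, measurable_fun setT (a k l)) ->
  measurable_fun setT (fun x => binomial_sum (fun k l => a k l x) n).
Proof. by move=> ma; apply: emeasurable_sum => k; exact: measurable_mulrn. Qed.

Lemma binomial_sum_ge0 (a : nat -> nat -> \bar R) n :
  (forall k l, 0 <= a k l) -> 0 <= binomial_sum a n.
Proof. by move=> a0; apply: sume_ge0 => k _; exact: mule_natr_ge0. Qed.

Lemma ge0_integral_binomial_sum (a : nat -> nat -> X -> \bar R) n :
  (forall k l x, 0 <= a k l x) -> (forall k l, measurable_fun setT (a k l)) ->
  \int[nu]_x binomial_sum (fun k l => a k l x) n =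
  binomial_sum (fun k l => \int[nu]_x a k l x) n.
Proof.
move=> a0 ma; rewrite /binomial_sum ge0_integral_sum//.
- apply: eq_bigr => k _; rewrite mulrn_EFin -ge0_integralZl//.
  by apply: eq_integral => x _; rewrite mulrn_EFin.
- by move=> k; exact: measurable_mulrn.
- by move=> k x _; exact: mule_natr_ge0.
Qed.

Definition iabs2 k l (A : seq X -> seq X -> R) : \bar R :=
  iabs nu k (fun K => iabs nu l (fun L => (A K L)%:E)).

Lemma iabs2_ge0 k l (A : seq X -> seq X -> R) :
  (forall K L, (0 <= A K L)%R) -> 0 <= iabs2 k l A.
Proof. by move=> A0; do 2 apply: iabs_ge0 => ?; rewrite lee_fin. Qed.

Section TwoLists.
Variable A : X -> seq X -> seq X -> R.
Hypothesis A_ge0 : forall y K L, (0 <= A y K L)%R.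
Hypothesis mA : measurable_fun setT (fun p : X * (seq X * seq X) => A p.1 p.2.1 p.2.2).

Let measurable_iabs_section l :
  measurable_fun setT (fun p : X * seq X => iabs nu l (fun L => (A p.1 p.2 L)%:E)).
Proof.
apply: (measurable_iabs nu (A := fun p : X * seq X => fun L => (A p.1 p.2 L)%:E)).
  by move=> p L; rewrite lee_fin.
apply/measurable_EFinP; apply: (measurable_comp3 mA) => //.
  exact: measurableT_comp measurable_fst measurable_fst.
exact: measurableT_comp measurable_snd measurable_fst.
Qed.

Let measurable_iabs2 k l : measurable_fun setT (fun y => iabs2 k l (A y)).
Proof.
apply: (measurable_iabs nu (A := fun y K => iabs nu l (fun L => (A y K L)%:E))) => //.
by move=> y K; apply: iabs_ge0 => L; rewrite lee_fin.
Qed.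

Lemma integral_iabs2 k l : \int[nu]_y iabs2 k l (A y) =
  iabs nu k (fun K => \int[nu]_y iabs nu l (fun L => (A y K L)%:E)).
Proof.
rewrite (@iabs_integral _ _ _ nu (fun y K => iabs nu l (fun L => (A y K L)%:E)))//.
by move=> y K; apply: iabs_ge0 => L; rewrite lee_fin.
Qed.

Lemma measurable_binomial_iabs2 n :
  measurable_fun setT (fun y => binomial_sum (fun k l => iabs2 k l (A y)) n).
Proof. exact: measurable_binomial_sum. Qed.

Lemma binomial_iabs2_ge0 n y : 0 <= binomial_sum (fun k l => iabs2 k l (A y)) n.
Proof. by apply: binomial_sum_ge0 => k l; exact: iabs2_ge0. Qed.

Lemma integral_binomial_iabs2 n :
  \int[nu]_y binomial_sum (fun k l => iabs2 k l (A y)) n =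
  binomial_sum (fun k l => \int[nu]_y iabs2 k l (A y)) n.
Proof. by apply: ge0_integral_binomial_sum => // k l y; exact: iabs2_ge0. Qed.

Lemma measurable_split_sum_section y :
  measurable_fun setT (fun J => (split_sum (A y) J)%:E).
Proof.
apply/measurable_EFinP; apply: measurable_split_sum.
exact: (measurableT_comp mA (pair1_measurable y)).
Qed.

End TwoLists.

Lemma iabs_split_sum (A : seq X -> seq X -> R) n :
  (forall K L, (0 <= A K L)%R) ->
  measurable_fun setT (fun p : seq X * seq X => A p.1 p.2) ->
  iabs nu n (fun J => (split_sum A J)%:E) = binomial_sum (fun k l => iabs2 k l A) n.
Proof.
elim: n A => [|n IHn] A A0 mA; first by rewrite binomial_sum0.
pose Al y K L := A (y :: K) L; pose Ar y K L := A K (y :: L).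
have [Al0 Ar0] : (forall y K L, (0 <= Al y K L)%R) * (forall y K L, (0 <= Ar y K L)%R).
  by split=> *; exact: A0.
have mAl : measurable_fun setT (fun p : X * (seq X * seq X) => Al p.1 p.2.1 p.2.2).
  apply: (measurable_comp2 mA); last exact: measurableT_comp measurable_snd measurable_snd.
  by apply: measurable_fun_cons => //; exact: measurableT_comp measurable_fst measurable_snd.
have mAr : measurable_fun setT (fun p : X * (seq X * seq X) => Ar p.1 p.2.1 p.2.2).
  apply: (measurable_comp2 mA); first exact: measurableT_comp measurable_fst measurable_snd.
  by apply: measurable_fun_cons => //; exact: measurableT_comp measurable_snd measurable_snd.
transitivity (\int[nu]_y (binomial_sum (fun k l => iabs2 k l (Al y)) n +
                          binomial_sum (fun k l => iabs2 k l (Ar y)) n)).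
  apply: eq_integral => y _; rewrite -!IHn//.
  - rewrite -iabsD//; try exact: measurable_split_sum_section.
    + by move=> J; rewrite lee_fin split_sum_ge0.
    + by move=> J; rewrite lee_fin split_sum_ge0.
  - exact: (measurableT_comp mAr (pair1_measurable y)).
  - exact: (measurableT_comp mAl (pair1_measurable y)).
rewrite ge0_integralD//; try (by move=> y _; exact: binomial_iabs2_ge0);
  try exact: measurable_binomial_iabs2.
rewrite !integral_binomial_iabs2// -binomial_sumS; congr (_ + _).
by apply: eq_binomial_sum => k l; exact: integral_iabs2.
Qed.

(* The integral with respect to the Lebesgue-Poisson measure of intensity [nu],
   restricted to configurations of fewer than [M] points. *)
Definition poisson_int M F : \bar R :=
  \sum_(n < M) (n`!%:R^-1)%:E * iabs nu n F.

Lemma poisson_int_ge0 M F : (forall s, 0 <= F s) -> 0 <= poisson_int M F.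
Proof. by move=> F0; apply: sume_ge0 => n _; rewrite mule_ge0 ?iabs_ge0. Qed.

Lemma eq_poisson_int M F G : (forall s, F s = G s) -> poisson_int M F = poisson_int M G.
Proof. by move=> FG; apply: eq_bigr => n _; congr (_ * _); exact: eq_iabs. Qed.

Lemma le_poisson_int M F G : (forall s, 0 <= F s) -> (forall s, 0 <= G s) ->
  measurable_fun setT F -> measurable_fun setT G ->
  (forall n, iterated_ae nu n (fun s => F s <= G s)) ->
  poisson_int M F <= poisson_int M G.
Proof.
move=> F0 G0 mF mG FG; apply: lee_sum => n _.
by apply: lee_wpmul2l; [rewrite lee_fin|exact: le_iabs].
Qed.

Lemma poisson_intZl M F (k : \bar R) : (forall s, 0 <= F s) -> 0 <= k ->
  measurable_fun setT F -> poisson_int M (fun s => k * F s) = k * poisson_int M F.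
Proof.
move=> F0 k0 mF; rewrite ge0_sume_distrr => [|n _]; last by rewrite mule_ge0 ?iabs_ge0.
by apply: eq_bigr => n _; rewrite iabsZl// muleCA.
Qed.

Lemma measurable_poisson_int {dS} {S : measurableType dS} M (A : S -> seq X -> \bar R) :
  (forall s J, 0 <= A s J) ->
  measurable_fun setT (fun p : S * seq X => A p.1 p.2) ->
  measurable_fun setT (fun s => poisson_int M (A s)).
Proof.
move=> A0 mA; apply: emeasurable_sum => n; apply: measurable_funeM.
exact: measurable_iabs.
Qed.

Lemma poisson_int_size0_le M :
  poisson_int M (fun J => ((size J == 0)%:R)%:E) <= 1.
Proof.
case: M => [|M]; first by rewrite /poisson_int big_ord0.
rewrite /poisson_int big_ord_recl big1 => [|n _]; first by rewrite /= invr1 mul1e adde0.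
by rewrite (eq_iabs nu (G := fun=> 0)) ?iabs0 ?mule0// => J ->.
Qed.

Lemma poisson_int_prod_le M (g : X -> R) (c : R) : (forall x, (0 <= g x)%R) ->
  measurable_fun setT g -> \int[nu]_x (g x)%:E <= c%:E ->
  poisson_int M (fun s => (\prod_(x <- s) g x)%:E) <= (expR c)%:E.
Proof.
move=> g0 mg gc; have c0 : (0 <= c)%R.
  by rewrite -lee_fin (le_trans _ gc)// integral_ge0// => x _; rewrite lee_fin.
apply: (@le_trans _ _ (\sum_(n < M) (n`!%:R^-1 * c ^+ n)%:E)).
  apply: lee_sum => n _; rewrite EFinM; apply: lee_wpmul2l; first by rewrite lee_fin.
  exact: iabs_prod_le.
by rewrite sumEFin lee_fin exp_partial_sum_le.
Qed.

Lemma poisson_int_split_sum_le M (A : seq X -> seq X -> R) :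
  (forall K L, (0 <= A K L)%R) ->
  measurable_fun setT (fun p : seq X * seq X => A p.1 p.2) ->
  poisson_int M (fun J => (split_sum A J)%:E) <=
  poisson_int M (fun K => poisson_int M (fun L => (A K L)%:E)).
Proof.
move=> A0 mA.
pose f k l := (k`!%:R^-1)%:E * ((l`!%:R^-1)%:E * iabs2 k l A).
have AE0 K L : 0 <= (A K L)%:E by rewrite lee_fin.
have mAE : measurable_fun setT (fun p : seq X * seq X => (A p.1 p.2)%:E).
  exact/measurable_EFinP.
have iabsA0 l K : 0 <= iabs nu l (fun L => (A K L)%:E) by exact: iabs_ge0.
have miabsA l : measurable_fun setT (fun K => iabs nu l (fun L => (A K L)%:E)).
  exact: (measurable_iabs nu (A := fun K L => (A K L)%:E)).
have -> : poisson_int M (fun J => (split_sum A J)%:E) =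
    \sum_(j < M) \sum_(k < j.+1) f k (j - k)%N.
  apply: eq_bigr => j _; rewrite iabs_split_sum// ge0_sume_distrr; last first.
    by move=> k _; rewrite mule_natr_ge0// iabs2_ge0.
  apply: eq_bigr => k _.
  by rewrite mulrn_EFin muleA -EFinM invr_fact_mul_bin -1?ltnS// EFinM -muleA.
have -> : poisson_int M (fun K => poisson_int M (fun L => (A K L)%:E)) =
    \sum_(k < M) \sum_(l < M) f k l.
  apply: eq_bigr => k _; rewrite -ge0_sume_distrr; last first.
    by move=> l _; rewrite mule_ge0 ?lee_fin// iabs_ge0.
  congr (_ * _); rewrite iabs_sum => [|l K|l].
  - by apply: eq_bigr => l _; rewrite iabsZl ?lee_fin.
  - by rewrite mule_ge0 ?lee_fin.
  - exact: measurable_funeM.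
apply: sum_triangle_lee => k l.
by rewrite !mule_ge0 ?lee_fin// iabs2_ge0.
Qed.

End PoissonIntegral.

Section ForestIntegral.
Context {R : realType} {d : measure_display} {X : measurableType d}.
Variable nu : {finite_measure set X -> \bar R}.
Local Open Scope ereal_scope.
Variables (t : X -> X -> R) (a : X -> R).
Hypothesis t_ge0 : forall x y, (0 <= t x y)%R.
Hypotheses (mt : measurable_fun setT (fun p : X * X => t p.1 p.2))
  (ma : measurable_fun setT a).

Definition kotecky_preiss x := \int[nu]_y (t x y * expR (a y))%:E <= (a x)%:E.

Hypothesis ae_kotecky_preiss : {ae nu, forall x, kotecky_preiss x}.

Let forest_sumE_ge0 m I J : 0 <= (forest_sum t m I J)%:E.
Proof. by rewrite lee_fin forest_sum_ge0. Qed.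

Let measurable_forest_sumE m :
  measurable_fun setT (fun p : seq X * seq X => (forest_sum t m p.1 p.2)%:E).
Proof. by apply/measurable_EFinP; exact: measurable_forest_sum. Qed.

Let measurable_t_expR i : measurable_fun setT (fun y => t i y * expR (a y))%R.
Proof.
apply: measurable_funM; last exact: measurableT_comp.
exact: (measurableT_comp mt (pair1_measurable i)).
Qed.

Let prod_expR_ge0 (K : seq X) : (0 <= \prod_(x <- K) expR (a x))%R.
Proof. by apply: prodr_ge0 => x _; exact: expR_ge0. Qed.

Let measurable_prod_t i : measurable_fun setT (fun K : seq X => \prod_(k <- K) t i k)%R.
Proof. by apply: measurable_prod_seq; exact: (measurableT_comp mt (pair1_measurable i)). Qed.

Let measurable_forest_sum_catE m I :
  measurable_fun setT (fun p : seq X * seq X => (forest_sum t m (I ++ p.1) p.2)%:E).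
Proof.
apply: (measurable_comp2 (F := fun I' J => (forest_sum t m I' J)%:E)) => //.
by apply: measurable_fun_cat.
Qed.

Let poisson_int_children_le M i I : kotecky_preiss i ->
  poisson_int nu M (fun K => (\prod_(k <- K) t i k)%:E *
    (\prod_(x <- I ++ K) expR (a x))%:E) <=
  (\prod_(x <- i :: I) expR (a x))%:E.
Proof.
move=> kpi; rewrite big_cons mulrC EFinM.
rewrite (@eq_poisson_int _ _ _ _ _ _ (fun K => (\prod_(x <- I) expR (a x))%:E *
    (\prod_(k <- K) (t i k * expR (a k)))%:E)); last first.
  by move=> K; rewrite -!EFinM big_cat big_split /= mulrCA.
rewrite poisson_intZl ?lee_fin//.
- apply: lee_wpmul2l; first by rewrite lee_fin.
  by apply: poisson_int_prod_le => // x; rewrite mulr_ge0 ?expR_ge0.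
- by move=> K; rewrite lee_fin prodr_ge0// => x _; rewrite mulr_ge0 ?expR_ge0.
- by apply/measurable_EFinP; exact: measurable_prod_seq.
Qed.

(* Only the children of the first root are integrated explicitly; by induction
   the remaining forest contributes [expR (a x)] for each of its roots [x]. *)
Lemma poisson_int_forest_sum_le M m I : (forall x, x \in I -> kotecky_preiss x) ->
  poisson_int nu M (fun J => (forest_sum t m I J)%:E) <= (\prod_(x <- I) expR (a x))%:E.
Proof.
elim: m I => [|m IHm] [|i I] kpI.
- by rewrite /poisson_int big1 => [|n _]; rewrite ?lee_fin// iabs0 mule0.
- by rewrite /poisson_int big1 => [|n _]; rewrite ?lee_fin// iabs0 mule0.
- by rewrite big_nil; exact: poisson_int_size0_le.
rewrite /=.
have kpi : kotecky_preiss i by apply: kpI; rewrite mem_head.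
have prodt_ge0 K : 0 <= (\prod_(k <- K) t i k)%:E by rewrite lee_fin prodr_ge0.
have mprodt : measurable_fun setT (fun K : seq X => (\prod_(k <- K) t i k)%:E).
  by apply/measurable_EFinP; exact: measurable_prod_t.
apply: le_trans (poisson_int_split_sum_le _ _ _ _) _ => [K L||].
- by rewrite mulr_ge0 ?prodr_ge0 ?forest_sum_ge0.
- apply: measurable_funM; first exact: measurableT_comp (measurable_prod_t i) measurable_fst.
  by apply/measurable_EFinP; exact: measurable_forest_sum_catE.
apply: le_trans (poisson_int_children_le M I kpi).
rewrite (@eq_poisson_int _ _ _ _ M _ (fun K => (\prod_(k <- K) t i k)%:E *
    poisson_int nu M (fun J => (forest_sum t m (I ++ K) J)%:E))); last first.
  move=> K; rewrite -poisson_intZl//.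
  exact: (measurableT_comp (measurable_forest_sum_catE m I) (pair1_measurable K)).
apply: le_poisson_int => [K|K|||n].
- by rewrite mule_ge0// poisson_int_ge0.
- by rewrite mule_ge0// lee_fin.
- apply: emeasurable_funM => //.
  apply: (measurable_poisson_int nu M (A := fun K J => (forest_sum t m (I ++ K) J)%:E)) => //.
- apply: emeasurable_funM => //; apply/measurable_EFinP.
  apply: (measurableT_comp (f := fun K : seq X => \prod_(x <- K) expR (a x))%R).
    by apply: measurable_prod_seq; exact: measurableT_comp.
  exact: measurable_fun_cat.
apply: iterated_aeS (iterated_ae_all n ae_kotecky_preiss) => K _ kpK.
apply: lee_wpmul2l => //; apply: IHm => x; rewrite mem_cat => /orP[xI|/kpK//].
by apply: kpI; rewrite inE xI orbT.
Qed.

End ForestIntegral.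

(** * Complex iterated integrals *)

Section ComplexIntegral.
Context {R : realType} {d : measure_display} {X : measurableType d}.
Variable nu : {finite_measure set X -> \bar R}.
Implicit Types f g : X -> R[i].

Definition cintegrable f :=
  nu.-integrable setT (EFin \o (fun x => cRe (f x))) /\
  nu.-integrable setT (EFin \o (fun x => cIm (f x))).

Lemma cintegrable_cmeasurable f : cintegrable f -> cmeasurable f.
Proof.
by move=> [/integrableP[fr _] /integrableP[fi _]]; split; exact/measurable_EFinP.
Qed.

Lemma integrable_cmod f : cmeasurable f -> (\int[nu]_x (cmod (f x))%:E < +oo)%E ->
  nu.-integrable setT (EFin \o (fun x => cmod (f x))).
Proof.
move=> mf fin; apply/integrableP; split.
  exact: measurable_ecmod.
rewrite (eq_integral (fun x => (cmod (f x))%:E))// => x _.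
by rewrite /= ger0_norm ?cmod_ge0.
Qed.

Lemma cmeasurable_cintegrable f : cmeasurable f ->
  (\int[nu]_x (cmod (f x))%:E < +oo)%E -> cintegrable f.
Proof.
move=> mf fin; have fc := integrable_cmod mf fin; have [mr mi] := mf.
split; apply: (le_integrable _ _ _ fc) => //; try exact/measurable_EFinP.
  by move=> x _ /=; rewrite lee_fin (le_trans (normr_cRe_le _))// ler_norm.
by move=> x _ /=; rewrite lee_fin (le_trans (normr_cIm_le _))// ler_norm.
Qed.

Lemma eq_cint f g : (forall x, f x = g x) -> cint nu f = cint nu g.
Proof. by move=> fg; congr cint; exact/funext. Qed.

Lemma cintegrableD f g :
  cintegrable f -> cintegrable g -> cintegrable (fun x => f x + g x).
Proof.
move=> [fr fi] [gr gi]; split.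
  by apply: eq_integrable (integrableD _ fr gr) => // x _; rewrite /= cReD EFinD.
by apply: eq_integrable (integrableD _ fi gi) => // x _; rewrite /= cImD EFinD.
Qed.

Let integrable_scale (r : R) (u : X -> R) :
  nu.-integrable setT (EFin \o u) -> nu.-integrable setT (EFin \o (fun x => r * u x)).
Proof. by move=> ui; apply: eq_integrable (integrableZl measurableT r ui). Qed.

Lemma cintegrableZl c f : cintegrable f -> cintegrable (fun x => c * f x).
Proof.
move=> [fr fi]; split.
  apply: eq_integrable
    (integrableB measurableT (integrable_scale (cRe c) fr) (integrable_scale (cIm c) fi)) => //.
  by move=> x _; rewrite /= cReM EFinB.
apply: eq_integrable
  (integrableD measurableT (integrable_scale (cRe c) fi) (integrable_scale (cIm c) fr)) => //.
by move=> x _; rewrite /= cImM EFinD.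
Qed.

Lemma cintD f g : cintegrable f -> cintegrable g ->
  cint nu (fun x => f x + g x) = cint nu f + cint nu g.
Proof.
move=> [fr fi] [gr gi]; rewrite /cint; under [in X in X +i* _]eq_fun do rewrite cReD.
under [in X in _ +i* X]eq_fun do rewrite cImD.
by rewrite !RintegralD.
Qed.

Lemma cintZl c f : cintegrable f -> cint nu (fun x => c * f x) = c * cint nu f.
Proof.
move=> [fr fi]; rewrite /cint; under [in X in X +i* _]eq_fun do rewrite cReM.
under [in X in _ +i* X]eq_fun do rewrite cImM.
rewrite RintegralB ?RintegralD//; try exact: integrable_scale.
by rewrite !RintegralZl//; apply: complex_ext; rewrite !(cReM, cImM).
Qed.

Lemma cint0 : cint nu (fun=> 0) = 0.
Proof. by rewrite /cint /= /Rintegral integral0. Qed.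

Lemma cintegrable0 : cintegrable (fun=> 0).
Proof. by split; exact: integrable0. Qed.

Lemma cintegrable_sum (I : Type) (r : seq I) (F : I -> X -> R[i]) :
  (forall i, cintegrable (F i)) -> cintegrable (fun x => \sum_(i <- r) F i x).
Proof.
move=> Fi; elim: r => [|i r IHr]; first by under eq_fun do rewrite big_nil; exact: cintegrable0.
by under eq_fun do rewrite big_cons; exact: cintegrableD.
Qed.

Lemma cint_sum (I : Type) (r : seq I) (F : I -> X -> R[i]) :
  (forall i, cintegrable (F i)) ->
  cint nu (fun x => \sum_(i <- r) F i x) = \sum_(i <- r) cint nu (F i).
Proof.
move=> Fi; elim: r => [|i r IHr].
  by rewrite big_nil; under eq_fun do rewrite big_nil; exact: cint0.
rewrite big_cons -IHr -cintD//; last exact: cintegrable_sum.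
by under eq_fun do rewrite big_cons.
Qed.

Lemma ae_eq_cint f g : cmeasurable f -> cmeasurable g ->
  {ae nu, forall x, f x = g x} -> cint nu f = cint nu g.
Proof.
move=> [fr fi] [gr gi] fg; rewrite /cint /Rintegral; congr (fine _ +i* fine _);
  apply: ae_eq_integral => //; try exact/measurable_EFinP;
  by apply: filterS fg => x -> _.
Qed.

(* The integral is projected onto its own direction, where the real inequality applies. *)
Lemma cmod_cint_le f : cmeasurable f ->
  ((cmod (cint nu f))%:E <= \int[nu]_x (cmod (f x))%:E)%E.
Proof.
move=> mf; set J := (\int[nu]_x _)%E.
have J0 : (0 <= J)%E by apply: integral_ge0 => x _; rewrite lee_fin cmod_ge0.
have [Jfin|] := ltP J +oo%E; last by rewrite leye_eq => /eqP ->; rewrite leey.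
have [fr fi] := cmeasurable_cintegrable mf Jfin.
have JE : J = (Rintegral nu setT (fun x => cmod (f x)))%:E.
  by rewrite /Rintegral fineK// ge0_fin_numE.
rewrite JE lee_fin; set I := cint nu f.
have [I0|I0] := eqVneq (cmod I) 0.
  by rewrite I0; apply: Rintegral_ge0 => x _; exact: cmod_ge0.
have Ip : 0 < cmod I by rewrite lt_def I0 cmod_ge0.
have fc := integrable_cmod mf Jfin.
have -> : cmod I = (cmod I)^-1 *
    Rintegral nu setT (fun x => cRe I * cRe (f x) + cIm I * cIm (f x)).
  rewrite RintegralD ?RintegralZl//; try exact: integrable_scale.
  by rewrite -[_ + _]/(cRe I ^+ 2 + cIm I ^+ 2) -sqr_cmod expr2 mulKf.
rewrite ler_pdivrMl// -RintegralZl//.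
have fre := integrable_scale (cRe I) fr; have fim := integrable_scale (cIm I) fi.
apply: le_Rintegral => //; last by move=> x _; exact: cRe_cIm_dot_le.
  by apply: eq_integrable (integrableD _ fre fim) => // x _; rewrite /= EFinD.
exact: integrable_scale.
Qed.

End ComplexIntegral.

Section ParametricIntegral.
Context {R : realType} {d dS : measure_display} {X : measurableType d}
  {S : measurableType dS}.
Variable nu : {finite_measure set X -> \bar R}.

Lemma measurable_Rintegral_param (f : S * X -> R) : measurable_fun setT f ->
  measurable_fun setT (fun s => Rintegral nu setT (fun x => f (s, x))).
Proof.
move=> mf; have mfE : measurable_fun setT (EFin \o f) by exact/measurable_EFinP.
apply: measurableT_comp; first exact: fine_measurable.
rewrite (_ : (fun _ => _) = (fun s => \int[nu]_x ((EFin \o f)^\+ (s, x))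
    - \int[nu]_x ((EFin \o f)^\- (s, x)))%E); last first.
  apply/funext => s; rewrite integralE; congr (_ - _)%E; apply: eq_integral => x _;
    by rewrite ?funeposE ?funenegE.
apply: emeasurable_funB.
  apply: (@measurable_fun_fubini_tonelli_F _ _ _ _ _ nu (EFin \o f)^\+%E) => //.
  exact: measurable_funepos.
apply: (@measurable_fun_fubini_tonelli_F _ _ _ _ _ nu (EFin \o f)^\-%E) => //.
exact: measurable_funeneg.
Qed.

Lemma cmeasurable_cint_param (f : S * X -> R[i]) :
  cmeasurable f -> cmeasurable (fun s => cint nu (fun x => f (s, x))).
Proof.
move=> [fr fi]; split; first exact: (measurable_Rintegral_param fr).
exact: (measurable_Rintegral_param fi).
Qed.

End ParametricIntegral.

Section ComplexSplitSums.
Context {R : realType}.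

Lemma cRe_split_sum (T : Type) (A : seq T -> seq T -> R[i]) J :
  cRe (split_sum A J) = split_sum (fun K L => cRe (A K L)) J.
Proof. by elim: J A => //= y J IHJ A; rewrite cReD !IHJ. Qed.

Lemma cIm_split_sum (T : Type) (A : seq T -> seq T -> R[i]) J :
  cIm (split_sum A J) = split_sum (fun K L => cIm (A K L)) J.
Proof. by elim: J A => //= y J IHJ A; rewrite cImD !IHJ. Qed.

Lemma cmod_split_sum_le (T : Type) (A : seq T -> seq T -> R[i]) J :
  cmod (split_sum A J) <= split_sum (fun K L => cmod (A K L)) J.
Proof.
by elim: J A => //= y J IHJ A; apply: le_trans (cmodD _ _) (lerD _ _); exact: IHJ.
Qed.

Context {d : measure_display} {X : measurableType d}.

Lemma cmeasurable_split_sum_mul (A B : seq X -> R[i]) :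
  cmeasurable A -> cmeasurable B -> cmeasurable (split_sum (fun K L => A K * B L)).
Proof.
move=> mA mB.
have [mr mi] : cmeasurable (fun p : seq X * seq X => A p.1 * B p.2).
  by apply: cmeasurableM; exact: cmeasurable_comp.
split.
  under eq_fun do rewrite cRe_split_sum.
  exact: (measurable_split_sum (A := fun K L => cRe (A K * B L))).
under eq_fun do rewrite cIm_split_sum.
exact: (measurable_split_sum (A := fun K L => cIm (A K * B L))).
Qed.

End ComplexSplitSums.

Section IteratedComplexIntegral.
Context {R : realType} {d : measure_display} {X : measurableType d}.
Variables (nu : {finite_measure set X -> \bar R}) (h : X -> R[i]).
Hypotheses (mh : cmeasurable h) (h1 : forall x, cmod (h x) = 1).
Implicit Types F G A B : seq X -> R[i].

Lemma eq_iint n F G :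
  (forall s, size s = n -> F s = G s) -> iint nu h n F = iint nu h n G.
Proof.
elim: n F G => [|n IHn] F G FG /=; first exact: FG.
apply: eq_cint => x; congr (_ * _).
by apply: IHn => s sn; rewrite FG//= sn.
Qed.

Lemma cmeasurable_iint {dS} {S : measurableType dS} (A : S -> seq X -> R[i]) n :
  cmeasurable (fun p : S * seq X => A p.1 p.2) -> cmeasurable (fun s => iint nu h n (A s)).
Proof.
elim: n dS S A => [|n IHn] dS S A mA /=.
  have mnil : measurable_fun setT (fun s : S => (s, [::] : seq X)).
    by apply: measurable_fun_pair => //; exact: measurable_cst.
  exact: (cmeasurable_comp mA mnil).
apply: (cmeasurable_cint_param nu
  (f := fun p : S * X => h p.2 * iint nu h n (fun J => A p.1 (p.2 :: J)))).
apply: cmeasurableM; first exact: cmeasurable_comp mh measurable_snd.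
apply: (IHn _ _ (fun p : S * X => fun J => A p.1 (p.2 :: J))).
apply: (cmeasurable_comp mA (g := fun q : S * X * seq X => (q.1.1, q.1.2 :: q.2))).
apply: measurable_fun_pair; first exact: measurableT_comp measurable_fst measurable_fst.
by apply: measurable_fun_cons => //; exact: measurableT_comp measurable_snd measurable_fst.
Qed.

Lemma cmeasurable_cons F x : cmeasurable F -> cmeasurable (fun s => F (x :: s)).
Proof. by move=> mF; apply: (cmeasurable_comp mF); exact: measurable_fun_cons. Qed.

Definition iint_head n F x := h x * iint nu h n (fun s => F (x :: s)).

Lemma cmeasurable_iint_head n F : cmeasurable F -> cmeasurable (iint_head n F).
Proof.
move=> mF; apply: cmeasurableM => //.
apply: (cmeasurable_iint (A := fun x s => F (x :: s))).
by apply: (cmeasurable_comp mF); exact: measurable_fun_cons.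
Qed.

Lemma measurable_iabs_ecmod_cons n F : cmeasurable F ->
  measurable_fun setT (fun x => iabs nu n (fun s => (cmod (F (x :: s)))%:E)).
Proof.
move=> mF; apply: (measurable_iabs_cons nu n (F := fun s => (cmod (F s))%:E)) => //.
exact: measurable_ecmod.
Qed.

Lemma cmod_iint_le n F : cmeasurable F ->
  ((cmod (iint nu h n F))%:E <= iabs nu n (fun s => (cmod (F s))%:E))%E.
Proof.
elim: n F => [|n IHn] F mF //=.
apply: le_trans (cmod_cint_le nu (cmeasurable_iint_head n mF)) _.
apply: ge0_le_integral => //.
- by apply: measurable_ecmod; exact: cmeasurable_iint_head.
- exact: measurable_iabs_ecmod_cons.
- by move=> x _; rewrite cmodM h1 mul1r; apply: IHn; exact: cmeasurable_cons.
Qed.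

(* Outside this class the real integrals inside [iint] may be junk values. *)
Definition iintegrable n F :=
  cmeasurable F /\ (iabs nu n (fun s => (cmod (F s))%:E) < +oo)%E.

Lemma iintegrable_cons_ae n F : iintegrable n.+1 F ->
  {ae nu, forall x, iintegrable n (fun s => F (x :: s))}.
Proof.
move=> [mF Ffin].
have int_abs : nu.-integrable setT (fun x => iabs nu n (fun s => (cmod (F (x :: s)))%:E)).
  apply/integrableP; split.
    exact: measurable_iabs_ecmod_cons.
  rewrite (eq_integral (fun x => iabs nu n (fun s => (cmod (F (x :: s)))%:E)))// => x _.
  by rewrite gee0_abs// iabs_ge0.
apply: filterS (integrable_ae measurableT int_abs) => x /(_ I) xfin.
split; first exact: cmeasurable_cons.
by rewrite -ge0_fin_numE// iabs_ge0.
Qed.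

Lemma iintegrable_all_cons_ae F : (forall n, iintegrable n F) ->
  {ae nu, forall x, forall n, iintegrable n (fun s => F (x :: s))}.
Proof. by move=> Fi; apply: ae_foralln => n; exact: iintegrable_cons_ae. Qed.

Lemma cintegrable_iint_head n F : iintegrable n.+1 F -> cintegrable nu (iint_head n F).
Proof.
move=> [mF Ffin]; have mi := cmeasurable_iint_head n mF.
apply: cmeasurable_cintegrable => //; apply: le_lt_trans Ffin; apply: ge0_le_integral => //.
- exact: measurable_ecmod.
- exact: measurable_iabs_ecmod_cons.
- by move=> x _; rewrite cmodM h1 mul1r; apply: cmod_iint_le; exact: cmeasurable_cons.
Qed.

Lemma iintD n F G : iintegrable n F -> iintegrable n G ->
  iint nu h n (fun s => F s + G s) = iint nu h n F + iint nu h n G.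
Proof.
elim: n F G => [|n IHn] F G Fi Gi //=.
rewrite -cintD; [|exact: cintegrable_iint_head|exact: cintegrable_iint_head].
have [[mF _] [mG _]] := (Fi, Gi).
apply: ae_eq_cint; first exact: cmeasurable_iint_head (cmeasurableD mF mG).
  by apply: cmeasurableD; exact: cmeasurable_iint_head.
apply: filterS2 (iintegrable_cons_ae Fi) (iintegrable_cons_ae Gi) => x Fx Gx.
by rewrite IHn// mulrDr.
Qed.

Lemma iintZl n c F : iintegrable n F -> iint nu h n (fun s => c * F s) = c * iint nu h n F.
Proof.
elim: n F => [|n IHn] F Fi //=; have [mF _] := Fi.
rewrite -cintZl; last exact: cintegrable_iint_head.
apply: ae_eq_cint.
- exact: cmeasurable_iint_head (cmeasurableM (cmeasurable_cst c) mF).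
- exact: cmeasurableM (cmeasurable_cst c) (cmeasurable_iint_head n mF).
by apply: filterS (iintegrable_cons_ae Fi) => x Fx; rewrite IHn// mulrCA.
Qed.

Lemma iabs_split_sum_mul (a b : seq X -> R) n :
  (forall s, 0 <= a s) -> (forall s, 0 <= b s) ->
  measurable_fun setT a -> measurable_fun setT b ->
  iabs nu n (fun J => (split_sum (fun K L => a K * b L) J)%:E) =
  binomial_sum (fun k l => iabs nu k (EFin \o a) * iabs nu l (EFin \o b))%E n.
Proof.
move=> a0 b0 ma mb; rewrite iabs_split_sum; last 2 first.
- by move=> K L; rewrite mulr_ge0.
- by apply: measurable_funM; exact: measurableT_comp.
apply: eq_binomial_sum => k l; have [maE mbE] :
    measurable_fun setT (EFin \o a) /\ measurable_fun setT (EFin \o b).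
  by split; exact/measurable_EFinP.
have [a0E b0E] : (forall s, 0 <= (EFin \o a) s)%E /\ (forall s, 0 <= (EFin \o b) s)%E.
  by split=> s; rewrite lee_fin.
rewrite /iabs2 muleC -iabsZl ?iabs_ge0//; apply: eq_iabs => K _.
by rewrite muleC -iabsZl.
Qed.

Lemma iintegrable_split_sum A B n :
  (forall k, iintegrable k A) -> (forall k, iintegrable k B) ->
  iintegrable n (split_sum (fun K L => A K * B L)).
Proof.
move=> Ai Bi; have [[mA _] [mB _]] := (Ai 0%N, Bi 0%N).
have msplit := cmeasurable_split_sum_mul mA mB.
have [maA maB] := (measurable_cmod mA, measurable_cmod mB).
split=> //.
apply: (@le_lt_trans _ _ (iabs nu n (fun J =>
    (split_sum (fun K L => cmod (A K) * cmod (B L)) J)%:E))).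
  apply: le_iabs => //.
  - by move=> s; rewrite lee_fin split_sum_ge0// => K L; rewrite mulr_ge0 ?cmod_ge0.
  - exact: measurable_ecmod.
  - apply/measurable_EFinP.
    apply: (measurable_split_sum (A := fun K L => cmod (A K) * cmod (B L))).
    apply: measurable_funM; first exact: measurableT_comp maA measurable_fst.
    exact: measurableT_comp maB measurable_snd.
  - apply: iterated_aeW => J; rewrite lee_fin; apply: le_trans (cmod_split_sum_le _ _) _.
    by rewrite (eq_split_sum (B := fun K L => cmod (A K) * cmod (B L)))// => K L; rewrite cmodM.
rewrite iabs_split_sum_mul//; apply: lte_sum_pinfty => k _; rewrite mulrn_EFin.
have iabs_fin F m : iintegrable m F -> iabs nu m (fun s => (cmod (F s))%:E) \is a fin_num.
  by move=> [_ Ffin]; rewrite ge0_fin_numE// iabs_ge0.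
by rewrite ltey_eq; apply/orP; left; rewrite !fin_numM// iabs_fin.
Qed.

Lemma cintegrable_binomial_sum (a : nat -> nat -> X -> R[i]) n :
  (forall k l, cintegrable nu (a k l)) ->
  cintegrable nu (fun x => binomial_sum (fun k l => a k l x) n).
Proof.
move=> ia; apply: cintegrable_sum => k.
by under eq_fun do rewrite -mulr_natl; exact: cintegrableZl.
Qed.

Lemma cint_binomial_sum (a : nat -> nat -> X -> R[i]) n :
  (forall k l, cintegrable nu (a k l)) ->
  cint nu (fun x => binomial_sum (fun k l => a k l x) n) =
  binomial_sum (fun k l => cint nu (a k l)) n.
Proof.
move=> ia; rewrite cint_sum => [|k]; last first.
  by under eq_fun do rewrite -mulr_natl; exact: cintegrableZl.
apply: eq_bigr => k _; under eq_fun do rewrite -mulr_natl.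
by rewrite cintZl// mulr_natl.
Qed.

Lemma mulr_binomial_sumr (c : R[i]) (a : nat -> nat -> R[i]) n :
  c * binomial_sum a n = binomial_sum (fun k l => c * a k l) n.
Proof. by rewrite /binomial_sum big_distrr /=; apply: eq_bigr => k _; rewrite mulrnAr. Qed.

Section BinomialHead.
Variables (F : seq X -> R[i]) (m : nat -> nat -> nat) (c : nat -> nat -> R[i]).
Hypothesis Fi : forall n, iintegrable n F.

Let cintegrable_head k l : cintegrable nu (fun x => iint_head (m k l) F x * c k l).
Proof.
under eq_fun do rewrite mulrC.
by apply: cintegrableZl; exact: cintegrable_iint_head.
Qed.

Lemma cintegrable_binomial_head n :
  cintegrable nu (fun x => binomial_sum (fun k l => iint_head (m k l) F x * c k l) n).
Proof. exact: cintegrable_binomial_sum. Qed.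

Lemma cint_binomial_head n :
  cint nu (fun x => binomial_sum (fun k l => iint_head (m k l) F x * c k l) n) =
  binomial_sum (fun k l => iint nu h (m k l).+1 F * c k l) n.
Proof.
rewrite cint_binomial_sum//; apply: eq_binomial_sum => k l.
under eq_fun do rewrite mulrC.
by rewrite cintZl 1?mulrC//; exact: cintegrable_iint_head.
Qed.

End BinomialHead.

Lemma iint_split_sum A B n : (forall k, iintegrable k A) -> (forall k, iintegrable k B) ->
  iint nu h n (split_sum (fun K L => A K * B L)) =
  binomial_sum (fun k l => iint nu h k A * iint nu h l B) n.
Proof.
elim: n A B => [|n IHn] A B Ai Bi; first by rewrite binomial_sum0.
have [[mA _] [mB _]] := (Ai 0%N, Bi 0%N).
pose left x := binomial_sum (fun k l => iint_head k A x * iint nu h l B) n.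
pose right x := binomial_sum (fun k l => iint_head l B x * iint nu h k A) n.
have left_int : cintegrable nu left.
  exact: (cintegrable_binomial_head (fun k l => k) (fun k l => iint nu h l B)).
have right_int : cintegrable nu right.
  exact: (cintegrable_binomial_head (fun k l => l) (fun k l => iint nu h k A)).
have -> : binomial_sum (fun k l => iint nu h k A * iint nu h l B) n.+1 =
    cint nu (fun x => left x + right x).
  rewrite cintD// -binomial_sumS; congr (_ + _).
    by rewrite (cint_binomial_head (fun k l => k) (fun k l => iint nu h l B)).
  rewrite (cint_binomial_head (fun k l => l) (fun k l => iint nu h k A))//.
  by apply: eq_binomial_sum => k l; exact: mulrC.
rewrite -[LHS]/(cint nu (iint_head n (split_sum (fun K L => A K * B L)))).
apply: ae_eq_cint.
- exact: cmeasurable_iint_head (cmeasurable_split_sum_mul mA mB).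
- exact: cintegrable_cmeasurable (cintegrableD left_int right_int).
apply: filterS2 (iintegrable_all_cons_ae Ai) (iintegrable_all_cons_ae Bi) => x Ax Bx.
rewrite /iint_head /= (iintD (iintegrable_split_sum n Ax Bi) (iintegrable_split_sum n Ai Bx)).
rewrite !IHn// mulrDr !mulr_binomial_sumr.
by congr (_ + _); apply: eq_binomial_sum => k l; rewrite /iint_head; ring.
Qed.

(* The integrated form of the decomposition of a graph according to the connected
   component of its first vertex. *)
Lemma iint_cons_split_sum A B F n :
  (forall k, iintegrable k A) -> (forall k, iintegrable k B) -> cmeasurable F ->
  (forall x J, F (x :: J) = split_sum (fun K L => A (x :: K) * B L) J) ->
  iint nu h n.+1 F = binomial_sum (fun k l => iint nu h k.+1 A * iint nu h l B) n.
Proof.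
move=> Ai Bi mF FE.
rewrite -(cint_binomial_head (fun k l => k) (fun k l => iint nu h l B))//.
rewrite -[LHS]/(cint nu (iint_head n F)).
apply: ae_eq_cint; first exact: cmeasurable_iint_head.
  by apply: (cintegrable_cmeasurable (nu := nu)); exact: cintegrable_binomial_head.
apply: filterS (iintegrable_all_cons_ae Ai) => x Ax.
rewrite /iint_head (eq_iint (fun J _ => FE x J)) (iint_split_sum n Ax Bi) mulr_binomial_sumr.
by apply: eq_binomial_sum => k l; rewrite /iint_head mulrA.
Qed.

End IteratedComplexIntegral.

(** * Exponentials of power series *)

Section NonnegativeSums.
Context {R : realType}.
Implicit Types u : nat -> R.

Lemma ler_sum_ord u p q : (forall n, 0 <= u n) -> (p <= q)%N ->
  \sum_(n < p) u n <= \sum_(n < q) u n.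
Proof.
move=> u0 pq; rewrite (big_ord_widen q u pq) big_mkcond.
by apply: ler_sum => n _; case: ifP.
Qed.

Lemma is_cvg_bounded_sum u (K : R) : (forall n, 0 <= u n) ->
  (forall N, \sum_(n < N) u n <= K) -> cvgn (fun N => \sum_(n < N) u n).
Proof.
move=> u0 uK; apply: nondecreasing_is_cvgn.
  by move=> p q pq; exact: ler_sum_ord.
by exists K => _ [N _ <-].
Qed.

Lemma is_cvg_abs_bounded_sum u (K : R) :
  (forall N, \sum_(n < N) `|u n| <= K) -> cvgn (fun N => \sum_(n < N) u n).
Proof.
move=> uK; have serE (v : nat -> R) : (fun N => \sum_(n < N) v n) = series v.
  by apply/funext => N; rewrite seriesEord.
rewrite serE; apply: normed_cvg; rewrite /normed_series_of /= -serE.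
by apply: (is_cvg_bounded_sum (u := fun n => `|u n|)) uK.
Qed.

Lemma sum_square_le_triangle (f : nat -> nat -> R) N : (forall k m, 0 <= f k m) ->
  \sum_(k < N./2) \sum_(m < N./2) f k m <= \sum_(k < N) \sum_(m < N - k) f k m.
Proof.
move=> f0; have halfN : (N./2 <= N)%N by lia.
apply: le_trans (ler_sum_ord (u := fun k => \sum_(m < N - k) f k m) _ halfN); last first.
  by move=> k; exact: sumr_ge0.
by apply: ler_sum => k _; apply: ler_sum_ord => //; have := ltn_ord k; lia.
Qed.

Lemma cvg_half : (fun N => N./2) @ \oo --> \oo.
Proof.
apply/cvgnyPge => M; near=> N.
have : (M.*2 <= N)%N by near: N; exact: nbhs_infty_ge.
by lia.
Unshelve. all: by end_near. Qed.

End NonnegativeSums.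

Section ComplexLimits.
Context {R : realType}.

Lemma cmod_sub_cvg0 (u : nat -> R[i]) (w : R[i]) :
  (fun N => cRe (u N)) @ \oo --> cRe w -> (fun N => cIm (u N)) @ \oo --> cIm w ->
  (fun N => cmod (u N - w)) @ \oo --> (0 : R).
Proof.
have dist (v : nat -> R) (r : R) : v @ \oo --> r -> (fun N => `|v N - r|) @ \oo --> (0 : R).
  move=> vr; rewrite -[X in _ --> X](normr0 R) -(subrr r).
  by apply: cvg_norm; apply: cvgB => //; exact: cvg_cst.
move=> ur ui.
apply: (squeeze_cvgr (f := fun=> 0) (h := fun N => `|cRe (u N) - cRe w| + `|cIm (u N) - cIm w|)).
- apply: nearW => N; rewrite cmod_ge0 (le_trans (cmod_le_cRe_cIm _))//.
  by rewrite cReD cImD cReN cImN.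
- exact: cvg_cst.
- by rewrite -[X in _ --> X]addr0; apply: cvgD; exact: dist.
Qed.

Lemma cexp_cvg (u : nat -> R[i]) (w : R[i]) :
  (fun N => cRe (u N)) @ \oo --> cRe w -> (fun N => cIm (u N)) @ \oo --> cIm w ->
  (fun N => cmod (cexp (u N) - cexp w)) @ \oo --> (0 : R).
Proof.
move=> ur ui; have er : (fun N => expR (cRe (u N))) @ \oo --> expR (cRe w).
  by apply: continuous_cvg => //; exact: continuous_expR.
apply: cmod_sub_cvg0.
  under eq_fun do rewrite cRe_cexp; rewrite cRe_cexp; apply: cvgM => //.
  by apply: continuous_cvg => //; exact: continuous_cos.
under eq_fun do rewrite cIm_cexp; rewrite cIm_cexp; apply: cvgM => //.
by apply: continuous_cvg => //; exact: continuous_sin.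
Qed.

Lemma cmod_sum_diff_le (c : nat -> R[i]) (u : nat -> R) p q :
  (forall n, cmod (c n) <= u n) -> (p <= q)%N ->
  cmod (\sum_(n < p) c n - \sum_(n < q) c n) <= \sum_(n < q) u n - \sum_(n < p) u n.
Proof.
move=> cu pq; rewrite -cmodN opprB -!(big_mkord xpredT).
rewrite !(big_cat_nat (leq0n p) pq)/= ![_ + _ - _]addrAC !subrr !add0r.
by apply: le_trans (cmod_sum _ _ _) _; apply: ler_sum.
Qed.

End ComplexLimits.

Section PowerSums.
Context {R : realType}.
Implicit Types (c : nat -> R[i]) (t : R).

Definition power_sum c N t : R[i] := \sum_(n < N) c n * (t ^+ n)%:C.

Definition power_sum_deriv c N t : R[i] := \sum_(n < N) c n * (n%:R * t ^+ n.-1)%:C.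

Lemma is_cderive_power_sum c N t :
  is_cderive t (power_sum c N) (power_sum_deriv c N t).
Proof.
apply: is_cderive_sum => n.
have Xn : is_derive t 1 (fun u : R => u ^+ n) (n%:R * t ^+ n.-1).
  rewrite (_ : (fun _ => _) = (id : R -> R) ^+ n); last by apply/funext => u; rewrite exprfctE.
  by apply: is_derive_eq; rewrite /GRing.scale /= mulr1.
have := is_cderiveM (is_cderive_cst t (c n)) (is_cderive_real Xn).
by rewrite mul0r add0r.
Qed.

Lemma power_sum1 c N : power_sum c N 1 = \sum_(n < N) c n.
Proof. by apply: eq_bigr => n _; rewrite expr1n mulr1. Qed.

Lemma power_sum0 c N : power_sum c N.+1 0 = c 0%N.
Proof.
rewrite /power_sum big_ord_recl expr0 mulr1 big1 ?addr0// => n _.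
by rewrite lift0 exprS mul0r mulr0.
Qed.

Lemma cmod_power_sum_le c N t : 0 <= t <= 1 ->
  cmod (power_sum c N t) <= \sum_(n < N) cmod (c n).
Proof.
move=> /andP[t0 t1]; apply: le_trans (cmod_sum _ _ _) _; apply: ler_sum => n _.
by rewrite cmodM cmod_real ler_piMr ?cmod_ge0// normrX ger0_norm// exprn_ile1.
Qed.

End PowerSums.

Section SeriesExponential.
Context {R : realType}.
Variables (z l : nat -> R[i]) (C D : R).
Hypotheses (z0 : z 0%N = 1) (l0 : l 0%N = 0).
Hypothesis z_rec : forall n,
  n.+1%:R * z n.+1 = \sum_(k < n.+1) (k.+1%:R * l k.+1) * z (n - k)%N.
Hypothesis lC : forall N, \sum_(n < N) n%:R * cmod (l n) <= C.
Hypothesis zD : forall N, \sum_(n < N) cmod (z n) <= D.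

Let dl_abs k := k.+1%:R * cmod (l k.+1).
Let z_abs m := cmod (z m).
Let dl_sum N := \sum_(k < N) dl_abs k.
Let z_sum N := \sum_(m < N) z_abs m.

Let dl_abs_ge0 k : 0 <= dl_abs k. Proof. by rewrite mulr_ge0 ?cmod_ge0. Qed.

Let dl_sum_le N : dl_sum N <= C.
Proof. by apply: le_trans (lC N.+1); rewrite big_ord_recl /= mul0r add0r. Qed.

(* The truncated derivative [z' - l' z] has no terms in the triangle [k + m < N]. *)
Let remainder N :=
  dl_sum N * z_sum N.+1 - \sum_(k < N) \sum_(m < N - k) dl_abs k * z_abs m.

Let cmod_deriv_le N (t : R) : 0 <= t <= 1 ->
  cmod (power_sum_deriv z N.+1 t - power_sum_deriv l N.+1 t * power_sum z N.+1 t) <=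
  remainder N.
Proof.
move=> /andP[t0 t1].
pose a k := k.+1%:R * l k.+1 * (t ^+ k)%:C.
pose b m := z m * (t ^+ m)%:C.
have natC n : (n%:R : R)%:C = n%:R :> R[i] by rewrite rmorph_nat.
have dlE : power_sum_deriv l N.+1 t = \sum_(k < N) a k.
  rewrite /power_sum_deriv big_ord_recl l0 mul0r add0r; apply: eq_bigr => k _.
  by rewrite lift0 /a rmorphM /= natC; ring.
have dzE : power_sum_deriv z N.+1 t = \sum_(k < N) \sum_(m < N - k) a k * b m.
  rewrite -(sum_triangle (fun k m => a k * b m)).
  rewrite /power_sum_deriv big_ord_recl mul0r mulr0 add0r; apply: eq_bigr => n _.
  rewrite lift0 rmorphM /= natC mulrA [z _ * _]mulrC z_rec big_distrl /=.
  apply: eq_bigr => k _; rewrite /a /b.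
  have -> : t ^+ n = t ^+ k * t ^+ (n - k) by rewrite -exprD subnKC// -ltnS.
  by rewrite rmorphM; ring.
have tn n : `|t ^+ n| <= 1 by rewrite normrX ger0_norm// exprn_ile1.
have abs_le k m : cmod (a k * b m) <= dl_abs k * z_abs m.
  rewrite cmodM; apply: ler_pM; rewrite ?cmod_ge0//.
    by rewrite /a !cmodM cmod_nat cmod_real ler_piMr ?mulr_ge0 ?cmod_ge0.
  by rewrite /b cmodM cmod_real ler_piMr ?cmod_ge0.
rewrite dzE dlE /power_sum /remainder !big_distrlr /= -!sumrB.
apply: le_trans (cmod_sum _ _ _) _; apply: ler_sum => k _.
apply: (cmod_sum_diff_le (c := fun m => a k * b m) (u := fun m => dl_abs k * z_abs m)) => //.
by rewrite leqW// leq_subr.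
Qed.

Let sum_cmod_l_le N : \sum_(n < N) cmod (l n) <= C.
Proof.
apply: le_trans (lC N); apply: ler_sum => -[[|n] nN] _ /=.
  by rewrite l0 cmod0 mulr0.
by rewrite ler_peMl ?cmod_ge0// (ler_nat _ 1).
Qed.

Let expR_cRe_le N (t : R) w : 0 <= t <= 1 ->
  `|w| <= cmod (power_sum l N t) -> expR w <= expR C.
Proof.
move=> t01 wl; rewrite ler_expR; apply: le_trans (sum_cmod_l_le N).
exact: le_trans (ler_norm _) (le_trans wl (cmod_power_sum_le _ _ t01)).
Qed.

Let quotient N (t : R) := power_sum z N.+1 t * cexp (- power_sum l N.+1 t).

Let quotient_increment_le N : cmod (quotient N 1 - 1) <= remainder N * expR C.
Proof.
have -> : (1 : R[i]) = quotient N 0.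
  by rewrite /quotient !power_sum0 z0 l0 oppr0 cexp0 mulr1.
apply: (cmod_increment_le (df := fun t =>
  (power_sum_deriv z N.+1 t - power_sum_deriv l N.+1 t * power_sum z N.+1 t) *
  cexp (- power_sum l N.+1 t))) => [t|t t01].
  have := is_cderiveM (is_cderive_power_sum z N.+1 t)
    (is_cderive_cexp (is_cderiveN (is_cderive_power_sum l N.+1 t))).
  by congr is_cderive; ring.
rewrite cmodM cmod_cexp; apply: ler_pM; rewrite ?cmod_ge0 ?expR_ge0//; first exact: cmod_deriv_le.
by apply: (expR_cRe_le (N := N.+1) t01); rewrite -cmodN normr_cRe_le.
Qed.

Let cmod_z_sum_sub_cexp_le N :
  cmod (\sum_(n < N.+1) z n - cexp (\sum_(n < N.+1) l n)) <= remainder N * expR C * expR C.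
Proof.
have t01 : 0 <= (1 : R) <= 1 by rewrite lexx ler01.
have -> : \sum_(n < N.+1) z n - cexp (\sum_(n < N.+1) l n) =
    (quotient N 1 - 1) * cexp (\sum_(n < N.+1) l n).
  by rewrite /quotient !power_sum1 mulrBl mul1r -mulrA -cexpD addNr cexp0 mulr1.
rewrite cmodM cmod_cexp; apply: ler_pM; rewrite ?cmod_ge0 ?expR_ge0//;
by apply: (expR_cRe_le (N := N.+1) t01); rewrite power_sum1 normr_cRe_le.
Qed.

Let remainder_ge0 N : 0 <= remainder N.
Proof.
apply: le_trans (cmod_ge0 _) (cmod_deriv_le N (t := 0) _).
by rewrite lexx ler01.
Qed.

Let remainder_cvg0 : remainder @ \oo --> (0 : R).
Proof.
have dl_cvg : cvgn dl_sum := is_cvg_bounded_sum dl_abs_ge0 dl_sum_le.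
have z_cvg : cvgn z_sum := is_cvg_bounded_sum (fun m => cmod_ge0 (z m)) zD.
apply: (squeeze_cvgr (f := fun=> 0)
  (h := fun N => dl_sum N * z_sum N.+1 - dl_sum N./2 * z_sum N./2)).
- apply: nearW => N; rewrite remainder_ge0 lerD2l lerN2 big_distrlr /=.
  apply: (sum_square_le_triangle (f := fun k m => dl_abs k * z_abs m)) => k m.
  by rewrite mulr_ge0 ?cmod_ge0.
- exact: cvg_cst.
rewrite -[X in _ --> X](subrr (limn dl_sum * limn z_sum)).
apply: cvgB; apply: cvgM => //; first by rewrite (cvg_shiftS z_sum).
  exact: cvg_comp cvg_half dl_cvg.
exact: cvg_comp cvg_half z_cvg.
Qed.

Lemma series_exponential : exists S : R[i],
  (fun N => cmod (\sum_(n < N) l n - S)) @ \oo --> (0 : R) /\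
  (fun N => cmod (\sum_(n < N) z n - cexp S)) @ \oo --> (0 : R).
Proof.
have cvg_part (p : R[i] -> R) : (forall w, `|p w| <= cmod w) ->
    cvgn (fun N => \sum_(n < N) p (l n)).
  move=> p_le; apply: (is_cvg_abs_bounded_sum (u := fun n => p (l n)) (K := C)) => N.
  by apply: le_trans (sum_cmod_l_le N); apply: ler_sum => n _; exact: p_le.
pose S := limn (fun N => \sum_(n < N) cRe (l n)) +i* limn (fun N => \sum_(n < N) cIm (l n)).
have l_re : (fun N => cRe (\sum_(n < N) l n)) @ \oo --> cRe S.
  under eq_fun do rewrite (big_morph _ cReD (erefl : cRe 0 = 0)).
  exact: cvg_part normr_cRe_le.
have l_im : (fun N => cIm (\sum_(n < N) l n)) @ \oo --> cIm S.
  under eq_fun do rewrite (big_morph _ cImD (erefl : cIm 0 = 0)).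
  exact: cvg_part normr_cIm_le.
exists S; split; first exact: cmod_sub_cvg0.
rewrite -(cvg_shiftS (fun N => cmod (\sum_(n < N) z n - cexp S))).
apply: (squeeze_cvgr (f := fun=> 0) (h := fun N => remainder N * expR C * expR C +
   cmod (cexp (\sum_(n < N.+1) l n) - cexp S))).
- apply: nearW => N; rewrite cmod_ge0 /= -(subrKA (cexp (\sum_(n < N.+1) l n))).
  exact: le_trans (cmodD _ _) (lerD (cmod_z_sum_sub_cexp_le N) (lexx _)).
- exact: cvg_cst.
have -> : (0 : R) = 0 * expR C * expR C + 0 by rewrite !mul0r addr0.
apply: cvgD; first by apply: cvgMr_tmp; exact: cvgMr_tmp.
rewrite (cvg_shiftS (fun N => cmod (cexp (\sum_(n < N) l n) - cexp S))).
exact: cexp_cvg.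
Qed.

End SeriesExponential.

(** * The cluster expansion *)

Lemma expR_ge1 (R : realType) (x : R) : (1 <= expR x) = (0 <= x).
Proof. by rewrite -[X in X <= _]expR0 ler_expR. Qed.

Section UrsellFunctions.
Context {R : realType} {X : pointedType}.
Implicit Types (z : X -> X -> R[i]) (B : X -> R).

Definition ursell z (s : seq X) : R[i] := (size s)`!%:R^-1 * connected_sum point z s.

Definition boltzmann z : seq X -> R[i] := pairs_prod (fun x y => 1 + z x y).

Definition stable B z (s : seq X) : bool := cmod (boltzmann z s) <= \prod_(x <- s) B x.

Lemma connected_sum_ursell z s : connected_sum point z s = (size s)`!%:R * ursell z s.
Proof. by rewrite /ursell mulVKf// pnatr_eq0 -lt0n fact_gt0. Qed.

Lemma ursell_seq1 z x : ursell z [:: x] = 1.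
Proof.
have := pairs_prod1D_split_sum point z x [::].
by rewrite /= big_nil !mulr1 /ursell /= invr1 mul1r => <-.
Qed.

End UrsellFunctions.

Section PairInteraction.
Context {R : realType} {d : measure_display} {X : measurableType d}.
Variables (nu : {finite_measure set X -> \bar R}) (h : X -> R[i]).
Variables (z : X -> X -> R[i]) (t : X -> X -> R) (a B : X -> R).
Hypotheses (mh : cmeasurable h) (h1 : forall x, cmod (h x) = 1).
Hypothesis mz : cmeasurable (fun p : X * X => z p.1 p.2).
Hypothesis mt : measurable_fun setT (fun p : X * X => t p.1 p.2).
Hypotheses (ma : measurable_fun setT a) (mB : measurable_fun setT B).
Hypotheses (a_ge0 : forall x, 0 <= a x) (B_ge1 : forall x, 1 <= B x).
Hypotheses (t_sym : forall x y, t x y = t y x) (t_ge0 : forall x y, 0 <= t x y).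
Hypothesis z_le : forall x y, cmod (z x y) <= t x y * Num.max 1 (cmod (1 + z x y)).

Let tB x y := t x y * B y.
Hypothesis kp_ae : {ae nu, forall x, kotecky_preiss nu tB a x}.
Hypothesis stable_ae : forall n, iterated_ae nu n (stable B z).
Hypothesis expaB_int : (\int[nu]_x (expR (a x) * B x)%:E < +oo)%E.

Let B_ge0 x : 0 <= B x. Proof. exact: le_trans ler01 (B_ge1 x). Qed.

Let tB_ge0 x y : 0 <= tB x y. Proof. by rewrite mulr_ge0. Qed.

Let mtB : measurable_fun setT (fun p : X * X => tB p.1 p.2).
Proof. by apply: measurable_funM => //; exact: measurableT_comp mB measurable_snd. Qed.

Let cmeasurable_ursell : cmeasurable (ursell z).
Proof.
apply: cmeasurableM; last exact: cmeasurable_connected_sum.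
split; first exact: (measurableT_comp (f := fun n => cRe (n`!%:R^-1)) _ measurable_size).
exact: (measurableT_comp (f := fun n => cIm (n`!%:R^-1)) _ measurable_size).
Qed.

Let cmeasurable_boltzmann : cmeasurable (boltzmann z).
Proof. exact: cmeasurable_pairs_prod1D. Qed.

Definition stable_root x :=
  forall n, iterated_ae nu n (fun s => forall s', subseq s' (x :: s) -> stable B z s').

Lemma stable_root_ae : {ae nu, forall x, stable_root x}.
Proof.
by apply: ae_foralln => n; exact: (iterated_ae_subseq n.+1 stable_ae).
Qed.

Lemma connected_sum_le_forest_sum x s m :
  (forall s', subseq s' (x :: s) -> stable B z s') -> ((size s).+1 < m)%N ->
  cmod (connected_sum point z (x :: s)) <= B x * forest_sum tB m [:: x] s.
Proof.
move=> st szm; rewrite forest_sum_child_weight.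
apply: le_trans (connected_sum_le point (t := t) (B := B) _ _ _ _ szm) _ => //.
  by move=> s' /st; rewrite /stable /boltzmann cmod_pairs_prod.
by rewrite big_cons -mulrA [_ * forest_sum _ _ _ _]mulrC.
Qed.

Local Open Scope ereal_scope.

Lemma iabs_ursell_cons x n :
  n.+1%:R%:E * iabs nu n (fun s => (cmod (ursell z (x :: s)))%:E) =
  (n`!%:R^-1)%:E * iabs nu n (fun s => (cmod (connected_sum point z (x :: s)))%:E).
Proof.
rewrite -!iabsZl ?lee_fin ?invr_ge0//; first last.
- exact: measurable_ecmod (cmeasurable_cons x cmeasurable_ursell).
- exact: measurable_ecmod (cmeasurable_cons x (cmeasurable_connected_sum mz)).
apply: eq_iabs => s sn; rewrite connected_sum_ursell cmodM cmod_nat -!EFinM /= sn.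
by rewrite factS natrM -mulrA mulrCA mulKf// pnatr_eq0 -lt0n fact_gt0.
Qed.

Lemma iabs_connected_sum_le x n m : stable_root x -> (n.+1 < m)%N ->
  iabs nu n (fun s => (cmod (connected_sum point z (x :: s)))%:E) <=
  (B x)%:E * iabs nu n (fun s => (forest_sum tB m [:: x] s)%:E).
Proof.
move=> st nm.
have mforest : measurable_fun setT (fun s => (forest_sum tB m [:: x] s)%:E).
  apply/measurable_EFinP.
  exact: (measurableT_comp (measurable_forest_sum m mtB) (pair1_measurable [:: x])).
have forest0 s : 0 <= (forest_sum tB m [:: x] s)%:E by rewrite lee_fin forest_sum_ge0.
rewrite -iabsZl ?lee_fin//; apply: le_iabs => //.
- by move=> s; rewrite mule_ge0 ?lee_fin ?forest_sum_ge0.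
- exact: measurable_ecmod (cmeasurable_cons x (cmeasurable_connected_sum mz)).
- exact: measurable_funeM.
apply: iterated_aeS (st n) => s sn sts.
by rewrite -EFinM lee_fin connected_sum_le_forest_sum ?sn.
Qed.

Lemma ursell_rooted_partial_sum_le x N : kotecky_preiss nu tB a x -> stable_root x ->
  \sum_(1 <= n < N) n.+1%:R%:E * iabs nu n (fun s => (cmod (ursell z (x :: s)))%:E) <=
  ((expR (a x) - 1) * B x)%:E.
Proof.
move=> kp st; case: N => [|N].
  by rewrite big_geq// lee_fin mulr_ge0// subr_ge0 expR_ge1.
pose forest n := (n`!%:R^-1)%:E *
  iabs nu n (fun s => (forest_sum tB N.+2 [:: x] s)%:E).
have forest0 n : 0 <= forest n.
  by rewrite mule_ge0 ?lee_fin ?invr_ge0 ?iabs_ge0// => s; rewrite lee_fin forest_sum_ge0.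
apply: (@le_trans _ _ (\sum_(1 <= n < N.+1) (B x)%:E * forest n)).
  rewrite big_nat [leRHS]big_nat; apply: lee_sum => n /andP[_ nN].
  rewrite iabs_ursell_cons muleCA; apply: lee_wpmul2l; first by rewrite lee_fin invr_ge0.
  by apply: iabs_connected_sum_le.
rewrite -ge0_sume_distrr// [leRHS]EFinM muleC; apply: lee_wpmul2r; first by rewrite lee_fin.
have kp1 y : y \in [:: x] -> kotecky_preiss nu tB a y by rewrite inE => /eqP ->.
have := poisson_int_forest_sum_le tB_ge0 mtB ma kp_ae N.+1 N.+2 kp1.
rewrite big_seq1 /poisson_int -(big_mkord xpredT forest) big_ltn//.
have -> : forest 0%N = 1 by rewrite /forest /= invr1 mul1e /= !big_nil mul1r.
by rewrite EFinB leeBrDl.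
Qed.

Lemma ursell_rooted_sum_le_ae : {ae nu, forall x,
  \sum_(2 <= n <oo) n%:R%:E * iabs nu n.-1 (fun s => (cmod (ursell z (x :: s)))%:E) <=
  ((expR (a x) - 1) * B x)%:E}.
Proof.
apply: filterS2 kp_ae stable_root_ae => x kp st; apply: lime_le.
  by apply: is_cvg_nneseries => n _ _; rewrite mule_ge0 ?lee_fin// iabs_ge0.
by apply: nearW => N; rewrite big_add1 /=; exact: ursell_rooted_partial_sum_le.
Qed.

Let expaB_total := \int[nu]_x (expR (a x) * B x)%:E.

Let expaB_total_ge0 : 0 <= expaB_total.
Proof. by apply: integral_ge0 => x _; rewrite lee_fin mulr_ge0 ?expR_ge0. Qed.

Let measurable_expaB : measurable_fun setT (fun x => (expR (a x) * B x)%:E).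
Proof. by apply/measurable_EFinP; apply: measurable_funM => //; exact: measurableT_comp. Qed.

Lemma ursell_moment_le N :
  \sum_(n < N) n%:R%:E * iabs nu n (fun s => (cmod (ursell z s))%:E) <= expaB_total.
Proof.
rewrite -(big_mkord xpredT (fun n => n%:R%:E * iabs nu n (fun s => (cmod (ursell z s))%:E))).
case: N => [|N]; first by rewrite big_geq.
rewrite big_nat_recl//= mul0e add0e.
have mroot n := measurable_iabs_ecmod_cons nu n cmeasurable_ursell.
rewrite (eq_bigr (fun n => \int[nu]_x (n.+1%:R%:E *
    iabs nu n (fun s => (cmod (ursell z (x :: s)))%:E)))); last first.
  by move=> n _; rewrite ge0_integralZl ?lee_fin// => x _; exact: iabs_ge0.
rewrite -ge0_integral_sum//; last 2 first.
- by move=> n; exact: measurable_funeM.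
- by move=> n x _; rewrite mule_ge0 ?iabs_ge0// lee_fin.
apply: ae_ge0_le_integral => //.
- by move=> x _; apply: sume_ge0 => n _; rewrite mule_ge0 ?iabs_ge0// lee_fin.
- by apply: emeasurable_sum => n; exact: measurable_funeM.
- by move=> x _; rewrite lee_fin mulr_ge0 ?expR_ge0.
apply: filterS2 kp_ae stable_root_ae => x kp st _.
have := ursell_rooted_partial_sum_le N kp st; case: N => [|N] tail_le.
  by rewrite big_geq// lee_fin mulr_ge0 ?expR_ge0.
rewrite big_ltn//= ursell_seq1 cmod1 mul1e.
apply: le_trans (leeD2l _ tail_le) _; rewrite -EFinD lee_fin.
by rewrite mulrBl mul1r addrCA gerDl subr_le0.
Qed.

Lemma iabs_ursell_le n : iabs nu n.+1 (fun s => (cmod (ursell z s))%:E) <= expaB_total.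
Proof.
apply: le_trans (ursell_moment_le n.+2); rewrite big_ord_recr /= -[leLHS]add0e.
apply: leeD; first by apply: sume_ge0 => j _; rewrite mule_ge0 ?lee_fin// iabs_ge0.
rewrite -[leLHS]mul1e; apply: lee_wpmul2r.
  by apply: (iabs_ge0 nu n.+1 (F := fun s => (cmod (ursell z s))%:E)).
by rewrite lee_fin (ler_nat _ 1).
Qed.

Lemma ursell_summable :
  \sum_(1 <= n <oo) iabs nu n (fun s => (cmod (ursell z s))%:E) < +oo.
Proof.
apply: le_lt_trans expaB_int; apply: lime_le.
  by apply: is_cvg_nneseries => n _ _; exact: iabs_ge0.
apply: nearW => N; apply: le_trans (ursell_moment_le N).
rewrite -(big_mkord xpredT (fun n => n%:R%:E * iabs nu n (fun s => (cmod (ursell z s))%:E))).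
case: N => [|N]; first by rewrite !big_geq.
rewrite [leRHS]big_ltn// mul0e add0e [leLHS]big_nat [leRHS]big_nat.
apply: lee_sum => n /andP[n1 _]; rewrite -[leLHS]mul1e.
by apply: lee_wpmul2r; rewrite ?iabs_ge0// lee_fin (ler_nat _ 1).
Qed.

Lemma iabs_boltzmann_le n :
  iabs nu n (fun s => (cmod (boltzmann z s))%:E) <= (fine expaB_total ^+ n)%:E.
Proof.
apply: (@le_trans _ _ (iabs nu n (fun s => (\prod_(x <- s) B x)%:E))).
  apply: le_iabs => //.
  - by move=> s; rewrite lee_fin prodr_ge0.
  - exact: measurable_ecmod.
  - by apply/measurable_EFinP; exact: measurable_prod_seq.
apply: iabs_prod_le => //; rewrite fineK ?ge0_fin_numE//.
apply: ge0_le_integral => // [x _||x _]; first by rewrite lee_fin.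
  exact/measurable_EFinP.
by rewrite lee_fin ler_peMl// expR_ge1.
Qed.

Local Close Scope ereal_scope.

Let iintegrable_ursell n : iintegrable nu n (ursell z).
Proof.
split=> //; case: n => [|n]; first by rewrite /= ltry.
exact: le_lt_trans (iabs_ursell_le n) expaB_int.
Qed.

Let iintegrable_connected_sum n : iintegrable nu n (connected_sum point z).
Proof.
split; first exact: cmeasurable_connected_sum.
rewrite (eq_iabs nu (G := fun s => n`!%:R%:E * (cmod (ursell z s))%:E)%E); last first.
  by move=> s sn; rewrite connected_sum_ursell sn cmodM cmod_nat EFinM.
rewrite iabsZl ?lee_fin//; last exact: measurable_ecmod.
have [_ fin] := iintegrable_ursell n.
by rewrite ltey_eq fin_numM// ge0_fin_numE// iabs_ge0.
Qed.

Let iintegrable_boltzmann n : iintegrable nu n (boltzmann z).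
Proof. by split=> //; exact: le_lt_trans (iabs_boltzmann_le n) (ltry _). Qed.

Let partition_coef n := n`!%:R^-1 * iint nu h n (boltzmann z).
Let cluster_coef n := if n is 0 then 0 else iint nu h n (ursell z).

Let partition_coef_rec n : n.+1%:R * partition_coef n.+1 =
  \sum_(k < n.+1) (k.+1%:R * cluster_coef k.+1) * partition_coef (n - k).
Proof.
have fact_neq0 m : m`!%:R != 0 :> R[i] by rewrite pnatr_eq0 -lt0n fact_gt0.
have head k : iint nu h k.+1 (connected_sum point z) = k.+1`!%:R * cluster_coef k.+1.
  rewrite -(iintZl mh h1 _ (iintegrable_ursell k.+1)); apply: eq_iint => s sk.
  by rewrite connected_sum_ursell sk.
have -> : n.+1%:R * partition_coef n.+1 = n`!%:R^-1 * iint nu h n.+1 (boltzmann z).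
  by rewrite /partition_coef factS natrM invfM !mulrA mulfV ?mul1r// pnatr_eq0.
rewrite (iint_cons_split_sum mh h1 n iintegrable_connected_sum iintegrable_boltzmann) //.
  rewrite /binomial_sum big_distrr; apply: eq_bigr => k _.
  rewrite -[_ *+ 'C(n, k)]mulr_natl [LHS]mulrA invr_fact_mul_bin -1?ltnS// head.
  by rewrite /partition_coef factS natrM; field; rewrite !fact_neq0.
exact: pairs_prod1D_split_sum.
Qed.

Let sum_cluster_coef_le N : \sum_(n < N) n%:R * cmod (cluster_coef n) <= fine expaB_total.
Proof.
rewrite -lee_fin fineK ?ge0_fin_numE//; apply: le_trans (ursell_moment_le N).
rewrite -sumEFin; apply: lee_sum => -[n nN] _; rewrite -[nat_of_ord _]/n {nN} EFinM.
apply: lee_wpmul2l; first by rewrite lee_fin.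
case: n => [|n]; first by rewrite cmod0; exact: iabs_ge0.
exact: (cmod_iint_le nu mh h1 n.+1 cmeasurable_ursell).
Qed.

Let sum_partition_coef_le N : \sum_(n < N) cmod (partition_coef n) <= expR (fine expaB_total).
Proof.
apply: le_trans (exp_partial_sum_le N (fine_ge0 expaB_total_ge0)); apply: ler_sum => n _.
rewrite /partition_coef cmodM cmodV cmod_nat ler_wpM2l ?invr_ge0// -lee_fin.
exact: le_trans (cmod_iint_le nu mh h1 n cmeasurable_boltzmann) (iabs_boltzmann_le n).
Qed.

Lemma cluster_expansion : exists S : R[i],
  (fun N => cmod (\sum_(1 <= n < N) iint nu h n (ursell z) - S)) @ \oo --> (0 : R) /\
  (fun N => cmod (\sum_(n < N) n`!%:R^-1 * iint nu h n (boltzmann z) - cexp S))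
    @ \oo --> (0 : R).
Proof.
have partition0 : partition_coef 0 = 1 by rewrite /partition_coef /= invr1 mul1r.
have [S [l_cvg z_cvg]] := series_exponential partition0 (erefl : cluster_coef 0 = 0)
  partition_coef_rec sum_cluster_coef_le sum_partition_coef_le.
exists S; split=> //.
have clusterE N : \sum_(1 <= n < N) iint nu h n (ursell z) = \sum_(n < N) cluster_coef n.
  rewrite -(big_mkord xpredT cluster_coef); case: N => [|N]; first by rewrite !big_geq.
  by rewrite [RHS]big_ltn// add0r; apply: eq_big_nat => -[].
by under eq_fun do rewrite clusterE.
Qed.

End PairInteraction.

Section PairPotential.
Context {R : realType} {d : measure_display} {X : measurableType d}.
Variables (ur : X * X -> \bar R) (ui : X * X -> R).

Lemma Zterm_boltzmann : Zterm ur ui = boltzmann (zeta ur ui).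
Proof.
by apply/funext => s; exact: (pairs_prodE (fun x y => 1 + zeta ur ui x y)).
Qed.

Lemma cmod_zeta_le_ubar x y : cmod (zeta ur ui x y) <=
  cmod (ubar ur ui x y) * Num.max 1 (cmod (1 + zeta ur ui x y)).
Proof.
rewrite /zeta /ubar; case: ifP => _; first by rewrite cmodN cmod1 mul1r le_max lexx.
set u := _ +i* _; rewrite addrCA subrr addr0 cmod_cexp -(cmodN u).
exact: cmod_cexp_sub1_le.
Qed.

Hypotheses (mur : measurable_fun setT ur) (mui : measurable_fun setT ui).

Let measurable_infinite : measurable_fun setT (fun p => ur p == +oo%E).
Proof. by apply: measurable_fun_eqe => //; exact: measurable_cst. Qed.

Let cmeasurable_finite : cmeasurable (fun p => fine (ur p) +i* ui p).
Proof. by split=> //=; exact: measurableT_comp. Qed.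

Lemma cmeasurable_ubar : cmeasurable (fun p : X * X => ubar ur ui p.1 p.2).
Proof.
rewrite (_ : (fun _ => _) = (fun p => if ur p == +oo%E then 1 else fine (ur p) +i* ui p)).
  by apply: cmeasurable_ifT; [exact: measurable_infinite|exact: cmeasurable_cst|].
by apply/funext => -[x y].
Qed.

Lemma cmeasurable_zeta : cmeasurable (fun p : X * X => zeta ur ui p.1 p.2).
Proof.
rewrite (_ : (fun _ => _) = (fun p => if ur p == +oo%E then -1
    else cexp (-1 * (fine (ur p) +i* ui p)) + -1)).
  apply: cmeasurable_ifT; [exact: measurable_infinite|exact: cmeasurable_cst|].
  apply: cmeasurableD; last exact: cmeasurable_cst.
  apply: cmeasurable_cexp; apply: cmeasurableM; first exact: cmeasurable_cst.
  exact: cmeasurable_finite.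
by apply/funext => -[x y]; rewrite mulN1r.
Qed.

Variables (nu : {finite_measure set X -> \bar R}) (b : X -> R).
Hypothesis mb : measurable_fun setT b.

Lemma stability_iterated_ae n :
  prod_ae nu n (fun s => \prod_(i < size s) \prod_(j < size s | (i < j)%N)
      cmod (1 + zeta ur ui (nth point s i) (nth point s j))
    <= \prod_(i < size s) expR (b (nth point s i))) ->
  iterated_ae nu n (stable (expR \o b) (zeta ur ui)).
Proof.
have stableE s : (\prod_(i < size s) \prod_(j < size s | (i < j)%N)
      cmod (1 + zeta ur ui (nth point s i) (nth point s j))
    <= \prod_(i < size s) expR (b (nth point s i))) = stable (expR \o b) (zeta ur ui) s.
  rewrite /stable /boltzmann cmod_pairs_prod (big_nth point) big_mkord.
  by rewrite -(pairs_prodE (fun x y => cmod (1 + zeta ur ui x y)) point).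
rewrite (_ : (fun s => is_true _) = (fun s => is_true (stable (expR \o b) (zeta ur ui) s)));
  last by apply/funext => s; rewrite stableE.
apply: prod_ae_iterated_ae; apply: measurable_fun_ler.
  by apply: measurable_cmod; exact: cmeasurable_pairs_prod1D cmeasurable_zeta.
by apply: measurable_prod_seq; exact: measurableT_comp.
Qed.

End PairPotential.

Lemma kotecky_preiss_weight (R : realType) (d : measure_display) (X : measurableType d)
    (nu : {finite_measure set X -> \bar R}) (t : X -> X -> R)
    (a b c : X -> R) x :
  measurable_fun setT (fun p : X * X => t p.1 p.2) -> (forall y, 0 <= t x y) ->
  measurable_fun setT a -> measurable_fun setT b -> measurable_fun setT c ->
  (forall y, a y + b y <= c y) ->
  (\int[nu]_y (t x y * expR (c y))%:E <= (a x)%:E)%E ->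
  kotecky_preiss nu (fun x y => t x y * expR (b y)) a x.
Proof.
move=> mt t_ge0 ma mb mc abc; apply: le_trans.
have mtx : measurable_fun setT (t x) := measurableT_comp mt (pair1_measurable x).
apply: ge0_le_integral => //.
- by move=> y _; rewrite lee_fin !mulr_ge0 ?expR_ge0.
- apply/measurable_EFinP; apply: measurable_funM; last exact: measurableT_comp.
  by apply: measurable_funM => //; exact: measurableT_comp.
- by apply/measurable_EFinP; apply: measurable_funM => //; exact: measurableT_comp.
- by move=> y _; rewrite lee_fin -mulrA ler_wpM2l// -expRD addrC ler_expR.
Qed.

Section PotentialClusterExpansion.
Context {R : realType} {d : measure_display} {X : measurableType d}.
Variables (nu : {finite_measure set X -> \bar R}) (h : X -> R[i]).
Variables (ur : X * X -> \bar R) (ui : X * X -> R) (a b : X -> R).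
Hypotheses (mh : cmeasurable h) (h1 : forall x, cmod (h x) = 1).
Hypotheses (mur : measurable_fun setT ur) (mui : measurable_fun setT ui).
Hypotheses (ma : measurable_fun setT a) (mb : measurable_fun setT b).
Hypotheses (a_ge0 : forall x, 0 <= a x) (b_ge0 : forall x, 0 <= b x).
Hypothesis stability : forall n : nat, prod_ae nu n (fun s =>
  \prod_(i < size s) \prod_(j < size s | (i < j)%N)
     cmod (1 + zeta ur ui (nth point s i) (nth point s j))
  <= \prod_(i < size s) expR (b (nth point s i))).
Hypothesis integrability : (\int[nu]_y (expR (a y + 2 * b y))%:E < +oo)%E.

Let expab_int : (\int[nu]_y (expR (a y) * (expR \o b) y)%:E < +oo)%E.
Proof.
apply: le_lt_trans integrability; apply: ge0_le_integral => //.
- by move=> x _; rewrite lee_fin mulr_ge0 ?expR_ge0.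
- by apply/measurable_EFinP; apply: measurable_funM; exact: measurableT_comp.
- apply/measurable_EFinP; apply: measurableT_comp => //.
  by apply: measurable_funD => //; exact: measurable_funM.
- by move=> x _; rewrite lee_fin -expRD ler_expR lerD2l mulr_natl mulr2n lerDl.
Qed.

Lemma potential_cluster_expansion (t : X -> X -> R) :
  measurable_fun setT (fun p : X * X => t p.1 p.2) ->
  (forall x y, 0 <= t x y) -> (forall x y, t x y = t y x) ->
  (forall x y, cmod (zeta ur ui x y) <= t x y * Num.max 1 (cmod (1 + zeta ur ui x y))) ->
  {ae nu, forall x, kotecky_preiss nu (fun x y => t x y * expR (b y)) a x} ->
  (\sum_(1 <= n <oo) iabs nu n (fun s => (cmod (phi ur ui s))%:E) < +oo)%E /\
  (exists S : R[i],
     (fun N => cmod (logZpartial nu h ur ui N - S)) @ \oo --> (0 : R) /\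
     (fun N => cmod (Zpartial nu h ur ui N - cexp S)) @ \oo --> (0 : R)) /\
  {ae nu, forall x,
     (\sum_(2 <= n <oo) n%:R%:E * iabs nu n.-1 (fun s => (cmod (phi ur ui (x :: s)))%:E)
      <= ((expR (a x) - 1) * expR (b x))%:E)%E}.
Proof.
move=> mt t_ge0 t_sym z_le kp.
have mz := cmeasurable_zeta mur mui.
have mB : measurable_fun setT (expR \o b) by exact: measurableT_comp.
have B_ge1 x : 1 <= (expR \o b) x by rewrite expR_ge1.
have stable_ae n := stability_iterated_ae mur mui mb (stability n).
split; first exact: (ursell_summable mz mt ma mB a_ge0 B_ge1 t_sym t_ge0 z_le kp stable_ae).
split; last exact: (ursell_rooted_sum_le_ae mz mt ma mB a_ge0 B_ge1 t_sym t_ge0 z_le kp).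
rewrite /Zpartial Zterm_boltzmann.
exact: (cluster_expansion mh h1 mz mt ma mB a_ge0 B_ge1 t_sym t_ge0 z_le kp stable_ae).
Qed.

End PotentialClusterExpansion.

Theorem mainTheorem1 (R : realType) (d : measure_display) (X : measurableType d)
  (nu : {finite_measure set X -> \bar R}) (h : X -> R[i])
  (ur : X * X -> \bar R) (ui : X * X -> R) (a b : X -> R) :
  (* the complex measure mu = h . nu, with nu = |mu| *)
  measurable_fun setT (fun x => cRe (h x)) ->
  measurable_fun setT (fun x => cIm (h x)) ->
  (forall x, cmod (h x) = 1) ->
  (* u = ur + i ui complex, measurable, symmetric, Re u in (-oo, +oo] *)
  measurable_fun setT ur -> measurable_fun setT ui ->
  (forall p, ur p != -oo%E) ->
  (forall x y, ur (x, y) = ur (y, x)) -> (forall x y, ui (x, y) = ui (y, x)) ->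
  (* a, b nonnegative measurable functions *)
  measurable_fun setT a -> measurable_fun setT b ->
  (forall x, 0 <= a x) -> (forall x, 0 <= b x) ->
  (* Assumption 1 (stability) *)
  (forall n : nat, prod_ae nu n (fun s =>
      \prod_(i < size s) \prod_(j < size s | (i < j)%N)
         cmod (1 + zeta ur ui (nth point s i) (nth point s j))
      <= \prod_(i < size s) expR (b (nth point s i)))) ->
  (* integrability *)
  (\int[nu]_y (expR (a y + 2 * b y))%:E < +oo)%E ->
  let conclusion (c : R) :=
    (* absolute convergence of the series in the exponential *)
    (\sum_(1 <= n <oo) iabs nu n (fun s => (cmod (phi ur ui s))%:E) < +oo)%E /\
    (* Z = exp { sum_{n>=1} int...int phi } *)
    (exists S : R[i],
       (fun N => cmod (logZpartial nu h ur ui N - S)) @ \oo --> (0 : R) /\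
       (fun N => cmod (Zpartial nu h ur ui N - cexp S)) @ \oo --> (0 : R)) /\
    (* the pointwise bound, for |mu|-almost all x1 *)
    {ae nu, forall x1,
       (\sum_(2 <= n <oo) (n%:R)%:E *
           iabs nu n.-1 (fun s => (cmod (phi ur ui (x1 :: s)))%:E)
        <= ((expR (a x1) - 1) * expR (c * b x1))%:E)%E} in
  (* Assumption 2 *)
  ({ae nu, forall x,
      (\int[nu]_y (cmod (zeta ur ui x y) * expR (a y + 2 * b y))%:E <= (a x)%:E)%E}
     -> conclusion 2) /\
  (* Assumption 2' *)
  ({ae nu, forall x,
      (\int[nu]_y (cmod (ubar ur ui x y) * expR (a y + b y))%:E <= (a x)%:E)%E}
     -> conclusion 1).
Proof.
move=> mh_re mh_im h1 mur mui _ ur_sym ui_sym ma mb a_ge0 b_ge0.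
move=> stability integrable conclusion.
have expansion := potential_cluster_expansion (conj mh_re mh_im) h1 mur mui ma mb
  a_ge0 b_ge0 stability integrable.
have b_le_double x : b x <= 2 * b x by rewrite mulr_natl mulr2n lerDl.
have mzeta := measurable_cmod (cmeasurable_zeta mur mui).
have mubar := measurable_cmod (cmeasurable_ubar mur mui).
split=> assumption.
- have [|||summable [limits bound]] := expansion (fun x y => cmod (zeta ur ui x y))
      mzeta (fun _ _ => cmod_ge0 _).
  + by move=> x y; rewrite /zeta ur_sym ui_sym.
  + by move=> x y; rewrite ler_peMr ?cmod_ge0// le_max lexx.
  + apply: filterS assumption => x; apply: kotecky_preiss_weight => // [|y].
      by apply: measurable_funD => //; exact: measurable_funM.
    by rewrite lerD2l.
  split=> //; split=> //; apply: filterS bound => x; move/le_trans; apply.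
  by rewrite lee_fin ler_wpM2l ?subr_ge0 ?expR_ge1// ler_expR.
- have [|||summable [limits bound]] := expansion (fun x y => cmod (ubar ur ui x y))
      mubar (fun _ _ => cmod_ge0 _).
  + by move=> x y; rewrite /ubar ur_sym ui_sym.
  + exact: cmod_zeta_le_ubar.
  + apply: filterS assumption => x; apply: kotecky_preiss_weight => //.
    exact: measurable_funD.
  by split=> //; split=> //; apply: filterS bound => x; rewrite mul1r.
Qed.
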